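(* Consider the logit-normal multivariate generalized linear mixed model described in the context, with parameter set $\Theta=\mathbb R^p\times\mathbb R^p\times(0,\infty)\subseteq\mathbb R^d$, $d=2p+1$, and true parameter $\theta^0$. If $\theta^0$ is an interior point of $\Theta$ and $$\liminf_{N\to\infty}\lambda_{\min}\left(N^{-1}\sum_{i=1}^N x_{i,i}x_{i,i}^{\mathsf T}\right)>0,$$ then, $\mathsf P$-almost surely, there exists a sequence $\hat\theta_n$ of roots to the likelihood equations $\nabla\Lambda_n(\theta;Y)=0$ such that $\hat\theta_n\to\theta^0$ in $\mathsf P$-probability.
   Context: For subjects $(i,j)$, $i,j=1,\dots,N$, there are two responses: $Y_{i,j,1}$, continuous, and $Y_{i,j,2}\in\{0,1\}$, binary. Let $Y=[Y_{1,1,1},Y_{1,1,2},Y_{1,2,1},\dots,Y_{N,N,2}]^{\mathsf T}$, with $n=2N^2$ components. For each subject there is a non-stochastic predictor vector $x_{i,j}\in\mathbb R^p$ (which may depend on $n$), the same for both responses, with $\|x_{i,j}\|\le1$ for all $i,j$. The parameter is $\theta=(\theta_1,\dots,\theta_d)$ with $d=2p+1$, $\beta_1=[\theta_1,\dots,\theta_p]^{\mathsf T}$, $\beta_2=[\theta_{p+1},\dots,\theta_{2p}]^{\mathsf T}$, and $\theta_d>0$; $\Theta=\mathbb R^p\times\mathbb R^p\times(0,\infty)$ with the Euclidean metric. Random effects: $U^{(1)}\sim\mathcal N(0,\theta_dI_N)$ and $U^{(2)}\sim\mathcal N(0,\theta_dI_N)$ are independent, where $I_k$ is the $k\times k$ identity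 matrix, and $U=[U^{(1)\mathsf T},U^{(2)\mathsf T}]^{\mathsf T}$. The random effect design matrix is $Z=[Z_1,Z_2]$ with $Z_1=I_N\otimes1_N\otimes1_2$ and $Z_2=1_N\otimes I_N\otimes1_2$, where $1_k$ is the $k$-vector of ones, so that the linear predictors are $\eta_{i,j,k}=x_{i,j}^{\mathsf T}\beta_k+U^{(1)}_i+U^{(2)}_j$, $k=1,2$. Given $U$, all responses are independent, $Y_{i,j,1}$ is normal with mean $\eta_{i,j,1}$ and variance 1, and $Y_{i,j,2}$ is Bernoulli with success probability $1/(1+e^{-\eta_{i,j,2}})$. That is, with $u$ in place of $U$ in $\eta_{i,j,k}$, the conditional density of $Y$ given $U=u$ satisfies, up to a constant factor not depending on $\theta$, $$f^n_\theta(y\mid u)\propto\exp\Big[\sum_{i,j}-(y_{i,j,1}-\eta_{i,j,1})^2/2+y_{i,j,2}\eta_{i,j,2}-\log(1+e^{\eta_{i,j,2}})\Big].$$ The marginal density of $Y$ is $f^n_\theta(y)=\int_{\mathbb R^{2N}}f^n_\theta(y\mid u)\phi_\theta(u)\,du$ with $\phi_\theta$ the $\mathcal N(0,\theta_dI_{2N})$ density. The data are generated under $\theta^0$, which is the same for all $n$: $Y$ has density $f^n_{\theta^0}$ under $\mathsf P$ for every $n$. Set $\Lambda_n(\theta;Y)=\log[f^n_\theta(Y)/f^n_{\theta^0}(Y)]$; $\nabla$ is the gradient in $\theta$; $\lambda_{\min}(\cdot)$ is the minimum eigenvalue. The limit is $N\to\infty$, equivalently $n\to\infty$.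
   Formalization: Almost surely, roots are claimed only for all sufficiently large n, not every n: e.g. for N=1, p=1, x=1 and binary response 1 (positive probability), the score in the second coefficient is strictly positive, so no root of the likelihood equations exists. *)

(* Defs.v *)
From HB Require Import structures.
From mathcomp Require Import all_boot all_order all_algebra.
From mathcomp Require Import all_classical all_reals all_analysis.
Import Order.TTheory GRing.Theory Num.Theory.
Import numFieldNormedType.Exports.

Set Implicit Arguments.
Unset Strict Implicit.
Unset Printing Implicit Defensive.

Local Open Scope classical_set_scope.
Local Open Scope ring_scope.

(* [mu \x nu] with its sigma-finite structure: for general sigma-finite factors,
   the canonical sigma-finite instance on [\x] is shadowed in the library by the
   one for subprobabilities. *)
Section product_measure.
Context d1 d2 (T1 : measurableType d1) (T2 : measurableType d2) (R : realType).
Variable mu : {sigma_finite_measure set T1 -> \bar R}.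
Variable nu : {sigma_finite_measure set T2 -> \bar R}.

Definition product_measure : set (T1 * T2)%type -> \bar R := (mu \x nu)%E.

HB.instance Definition _ := Measure.on product_measure.

Let sigma_finite_product_measure : sigma_finite setT product_measure.
Proof.
have /sigma_finiteP[F [FT ndF Foo]] := sigma_finiteT mu.
have /sigma_finiteP[G [GT ndG Goo]] := sigma_finiteT nu.
exists (fun n => F n `*` G n).
  rewrite -setXTT FT GT predeqE => -[x y]; split.
    move=> [/= [n _ Fnx] [k _ Gky]]; exists (maxn n k) => //; split.
    - by move: x Fnx; exact/subsetPset/ndF/leq_maxl.
    - by move: y Gky; exact/subsetPset/ndG/leq_maxr.
  by move=> [n _ []/= ? ?]; split; exists n.
move=> k; have [? ?] := Foo k; have [? ?] := Goo k.
split; first exact: measurableX.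
by rewrite /product_measure product_measure1E// lte_mul_pinfty// ge0_fin_numE.
Qed.

HB.instance Definition _ := Measure_isSigmaFinite.Build _ _ _ product_measure
  sigma_finite_product_measure.

End product_measure.

(* The library has binary product measures and the product sigma-algebra on
   [n.-tuple T], but no n-fold product measure: it is built here as the
   image of iterated binary products under [cons]. *)
Section power_measure.
Context d (T : measurableType d) (R : realType).

Definition tcons n (q : T * n.-tuple T) : n.+1.-tuple T :=
  [tuple of q.1 :: q.2].

Lemma measurable_tcons n : measurable_fun setT (@tcons n).
Proof. exact: measurable_cons. Qed.

Section cons_measure.
Variables (n : nat) (mu : {sigma_finite_measure set T -> \bar R}).
Variable nu : {sigma_finite_measure set (n.-tuple T) -> \bar R}.

Definition cons_measure : set (n.+1.-tuple T) -> \bar R :=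
  pushforward (product_measure mu nu) (@tcons n).

Let measurable_preimage_tcons A :
  measurable A -> measurable (@tcons n @^-1` A).
Proof. by move=> mA; rewrite -[X in measurable X]setTI; exact: measurable_tcons. Qed.

Let cons_measure0 : cons_measure set0 = 0%E.
Proof. by rewrite /cons_measure /pushforward preimage_set0 measure0. Qed.

Let cons_measure_ge0 A : (0 <= cons_measure A)%E.
Proof. by rewrite /cons_measure /pushforward; exact: measure_ge0. Qed.

Let cons_measure_sigma_additive : semi_sigma_additive cons_measure.
Proof.
move=> F mF tF mUF; rewrite /cons_measure /pushforward preimage_bigcup.
apply: measure_semi_sigma_additive.
- by move=> k; exact: measurable_preimage_tcons.
- apply/trivIsetP => /= i j _ _ ij; rewrite -preimage_setI.
  by move/trivIsetP : tF => /(_ _ _ _ _ ij) ->//; rewrite preimage_set0.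
- by rewrite -preimage_bigcup; exact: measurable_preimage_tcons.
Qed.

HB.instance Definition _ := isMeasure.Build _ _ _ cons_measure
  cons_measure0 cons_measure_ge0 cons_measure_sigma_additive.

Let sigma_finite_cons_measure : sigma_finite setT cons_measure.
Proof.
have [F FT Foo] := sigma_finiteT (product_measure mu nu).
pose g (t : n.+1.-tuple T) : T * n.-tuple T := (thead t, [tuple of behead t]).
have mg : measurable_fun setT g.
  apply: measurable_fun_pair; first exact: measurable_tnth.
  exact: measurable_behead.
have gK q : g (tcons q) = q.
  by case: q => a t; congr pair; apply/val_inj.
exists (fun i => g @^-1` F i).
  by rewrite -preimage_bigcup -FT preimage_setT.
move=> i; have [mFi Fioo] := Foo i; split.
  by rewrite -[X in measurable X]setTI; exact: mg.
rewrite /cons_measure /pushforward -comp_preimage.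
by rewrite (_ : g \o @tcons n = id)//; apply/funext => q; exact: gK.
Qed.

HB.instance Definition _ :=
  Measure_isSigmaFinite.Build _ _ _ cons_measure sigma_finite_cons_measure.

End cons_measure.

Fixpoint power_measure (mu : {sigma_finite_measure set T -> \bar R}) (n : nat) :
    {sigma_finite_measure set (n.-tuple T) -> \bar R} :=
  match n with
  | 0 => @dirac _ (0.-tuple T) [tuple] R
  | m.+1 => cons_measure mu (power_measure mu m)
  end.

End power_measure.

Lemma finite_counting_bool (R : realType) : fin_num_fun (@counting bool R).
Proof. by move=> A _; rewrite /counting asboolT//; exact: finite_finset. Qed.

HB.instance Definition _ (R : realType) := Measure_isFinite.Build _ _ _
  (@counting bool R) (finite_counting_bool R).

Section euclidean.
Context (R : realType) (d : nat).

(* The library norm on matrices is the sup norm. *)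
Definition enorm (v : 'cV[R]_d) : R := Num.sqrt (\sum_i v i ord0 ^+ 2).

Definition gradient (f : 'cV[R]_d -> R) (a : 'cV[R]_d) : 'cV[R]_d :=
  \col_i 'D_(delta_mx i ord0) f a.

(* Only meaningful for matrices whose spectrum is real; the set of eigenvalues is
   finite, so that the infimum is a minimum. *)
Definition lambda_min (A : 'M[R]_d) : R := inf [set a | eigenvalue A a].

End euclidean.

Section logit_normal_model.
Context (R : realType) (p : nat).

Definition param := 'cV[R]_(p + p + 1).

Definition beta1 (theta : param) : 'cV[R]_p := usubmx (usubmx theta).
Definition beta2 (theta : param) : 'cV[R]_p := dsubmx (usubmx theta).
Definition var_comp (theta : param) : R := dsubmx theta ord0 ord0.

Definition Theta : set param := [set theta | 0 < var_comp theta].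

Definition observation (N : nat) := N.-tuple (N.-tuple (measurableTypeR R * bool)%type).

Definition resp1 N (y : observation N) (i j : 'I_N) : R := (tnth (tnth y i) j).1.
Definition resp2 N (y : observation N) (i j : 'I_N) : bool := (tnth (tnth y i) j).2.

Definition observation_measure (N : nat) :
    {sigma_finite_measure set (observation N) -> \bar R} :=
  power_measure
    (power_measure (product_measure (@lebesgue_measure R) (@counting bool R)) N) N.

(* The first [N] coordinates are u^(1), the last [N] are u^(2). *)
Definition effects (N : nat) := (N + N).-tuple (measurableTypeR R).

Definition eta N (x : 'I_N -> 'I_N -> 'cV[R]_p) (beta : 'cV[R]_p)
    (u : effects N) (i j : 'I_N) : R :=
  ((x i j)^T *m beta) ord0 ord0 + tnth u (lshift N i) + tnth u (rshift N j).

Definition cond_density N (x : 'I_N -> 'I_N -> 'cV[R]_p) (theta : param)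
    (y : observation N) (u : effects N) : R :=
  (Num.sqrt (2 * pi))^-1 ^+ (N * N) *
  expR (\sum_i \sum_j
    (- (resp1 y i j - eta x (beta1 theta) u i j) ^+ 2 / 2
     + (resp2 y i j)%:R * eta x (beta2 theta) u i j
     - ln (1 + expR (eta x (beta2 theta) u i j)))).

(* [normal_pdf] is parameterized by the standard deviation. *)
Definition effects_density N (theta : param) (u : effects N) : R :=
  \prod_k normal_pdf 0 (Num.sqrt (var_comp theta)) (tnth u k).

Definition density N (x : 'I_N -> 'I_N -> 'cV[R]_p) (theta : param)
    (y : observation N) : R :=
  \int[power_measure (@lebesgue_measure R) (N + N)]_u
    (cond_density x theta y u * effects_density theta u).

Definition Lambda N (x : 'I_N -> 'I_N -> 'cV[R]_p) (theta0 : param)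
    (y : observation N) (theta : param) : R :=
  ln (density x theta y / density x theta0 y).

Definition likelihood_root N (x : 'I_N -> 'I_N -> 'cV[R]_p) (theta0 : param)
    (y : observation N) (theta : param) : Prop :=
  [/\ Theta theta,
      differentiable (Lambda x theta0 y) theta
    & gradient (Lambda x theta0 y) theta = 0].

End logit_normal_model.

(* Main.v *)
Require Import Defs.
From HB Require Import structures.
From mathcomp Require Import all_boot all_order all_algebra.
From mathcomp Require Import all_classical all_reals all_analysis.
From mathcomp Require Import measurable_realfun.
From mathcomp Require Import ring lra.
Import Order.TTheory GRing.Theory Num.Theory.
Import numFieldNormedType.Exports.
Local Open Scope classical_set_scope.
Local Open Scope ring_scope.
Set Implicit Arguments.
Unset Strict Implicit.
Unset Printing Implicit Defensive.

(** The estimator is a maximizer of the likelihood over a closed box around the true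
    parameter, of sup-norm radius half the true variance component, so that the box lies
    in the parameter set. By compactness and differentiability of the likelihood
    ([differentiable_density]) a maximizer exists, and it can be chosen measurably in the
    data ([measurable_argmax]). Where it is interior to the box it is a root of the
    likelihood equations, by Fermat's rule ([interior_max_likelihood_root]). Everything
    thus follows from one bound: outside an event whose probability decays geometrically
    in [N], no parameter of the box at distance at least [eps] from the true one has a
    likelihood as large as that of the true one ([geometric_bad_event]). Such a bound is
    summable, hence roots almost surely by Borel-Cantelli, and it tends to zero, hence
    consistency.

    The responses are all dependent, through the random effects of their row and column,
    but the diagonal subjects [(i, i)] meet disjoint pairs of effects and are
    independent. For one such subject, three bounded statistics of its two responses
    identify the two linear predictors and the variance component: if one of these
    parameters moves, the mean of one of the statistics moves proportionally
    ([subject_separation]). The eigenvalue hypothesis on the diagonal design turns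
    differences of linear predictors into differences of regression coefficients, so that
    the squared gaps of these means sum over the diagonal to at least a multiple of
    [N |theta - theta0| ^ 2] ([parameter_separation]). Exponentially tilting by the
    statistics gives a test of [theta] against [theta0] whose errors are at most
    [exp (- kappa N)] ([likelihood_ratio_test]); comparing the two marginal densities
    through this test bounds the probability that the likelihood at [theta] exceeds that
    at [theta0], although the likelihood itself is an intractable integral.

    To treat all [theta] at once, the box is covered by a grid of mesh of order
    [N ^ -2]. Over one cell of the grid the conditional densities are dominated by an
    envelope, a slightly larger multiple of a density with slightly larger variance
    ([density_le_env]). There are [N ^ 2] subjects, so that with this mesh the envelope
    changes the bounds of the test by a bounded factor only. The grid has polynomially
    many points, and the union bound still decays exponentially ([bad_event]). *)

(** * Integrals over products and powers of measures *)

Section power_integral.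
Context d (T : measurableType d) (R : realType).
Variable mu : {sigma_finite_measure set T -> \bar R}.

Lemma integral_power_measureS n (f : n.+1.-tuple T -> \bar R) :
  measurable_fun [set: n.+1.-tuple T] f -> (forall t, (0 <= f t)%E) ->
  (\int[power_measure mu n.+1]_t f t =
   \int[mu]_a \int[power_measure mu n]_t f (tcons (a, t)))%E.
Proof.
move=> mf f0.
rewrite /= /cons_measure ge0_integral_pushforward//=; last exact: measurable_tcons.
rewrite preimage_setT /product_measure fubini_tonelli1//=.
by apply: measurableT_comp => //; exact: measurable_tcons.
Qed.

Lemma integral_power_measure0 (f : 0.-tuple T -> \bar R) :
  measurable_fun [set: 0.-tuple T] f -> (\int[power_measure mu 0]_t f t = f [tuple])%E.
Proof. by move=> mf; rewrite /= integral_dirac// diracT mul1e. Qed.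

Lemma measurable_prod_tnth n (g : 'I_n -> T -> R) :
  (forall i, measurable_fun setT (g i)) ->
  measurable_fun setT (fun t : n.-tuple T => \prod_i g i (tnth t i)).
Proof.
move=> mg; apply: measurable_prod => i _.
apply: measurableT_comp => //; exact: measurable_tnth.
Qed.

(** Iterated Tonelli; the integrals are asked to be finite so that the product is
    one of real numbers. *)
Lemma integral_power_measure_prod n (g : 'I_n -> T -> R) (c : 'I_n -> R) :
  (forall i, measurable_fun setT (g i)) -> (forall i x, 0 <= g i x) ->
  (forall i, \int[mu]_x (g i x)%:E = (c i)%:E)%E ->
  (\int[power_measure mu n]_t (\prod_i g i (tnth t i))%:E = (\prod_i c i)%:E)%E.
Proof.
elim: n g c => [|n IH] g c mg g0 gc.
  rewrite integral_power_measure0; last first.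
    by apply/measurable_EFinP; exact: measurable_prod_tnth.
  by rewrite !big_ord0.
have mG m (h : 'I_m -> T -> R) : (forall i, measurable_fun setT (h i)) ->
    measurable_fun setT (fun t : m.-tuple T => (\prod_i h i (tnth t i))%:E).
  by move=> mh; apply/measurable_EFinP; exact: measurable_prod_tnth.
rewrite integral_power_measureS//; last 2 first.
- exact: mG.
- by move=> t; rewrite lee_fin prodr_ge0.
transitivity (\int[mu]_a ((\prod_(i < n) c (lift ord0 i))%:E * (g ord0 a)%:E))%E.
  apply: eq_integral => a _.
  rewrite (eq_integral (fun t : n.-tuple T =>
      (g ord0 a)%:E * (\prod_(i < n) g (lift ord0 i) (tnth t i))%:E)%E); last first.
    move=> t _; rewrite -EFinM big_ord_recl tnth0; congr (_ * _)%:E.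
    by apply: eq_bigr => i _; rewrite tnthS.
  rewrite ge0_integralZl//; last 3 first.
  - exact: (mG _ (fun i => g (lift ord0 i))).
  - by move=> t _; rewrite lee_fin prodr_ge0.
  - by rewrite lee_fin.
  by rewrite (IH (fun i => g (lift ord0 i)) (fun i => c (lift ord0 i)))// muleC.
rewrite /= ge0_integralZl//; first last.
- rewrite lee_fin prodr_ge0// => i _; rewrite -lee_fin -gc.
  by apply: integral_ge0 => x _; rewrite lee_fin.
- by move=> x _; rewrite lee_fin.
- by apply/measurable_EFinP.
by rewrite gc -EFinM big_ord_recl mulrC.
Qed.

Lemma measurable_cat_tuple m n :
  measurable_fun setT (fun q : m.-tuple T * n.-tuple T => [tuple of q.1 ++ q.2]).
Proof.
apply/measurable_fun_tnthP => i /=; case: (split_ordP i) => j ->.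
- rewrite (_ : _ \o _ = (fun t => tnth t j) \o fst); last first.
    by apply/funext => q /=; rewrite tnth_lshift.
  by apply: measurableT_comp => //; exact: measurable_tnth.
- rewrite (_ : _ \o _ = (fun t => tnth t j) \o snd); last first.
    by apply/funext => q /=; rewrite tnth_rshift.
  by apply: measurableT_comp => //; exact: measurable_tnth.
Qed.

(** Concatenation splits the [2 N] random effects into the two groups of [N]. *)
Lemma integral_power_measureD m n (f : (m + n).-tuple T -> \bar R) :
  measurable_fun [set: (m + n).-tuple T] f -> (forall t, (0 <= f t)%E) ->
  (\int[power_measure mu (m + n)]_t f t =
   \int[power_measure mu m]_a \int[power_measure mu n]_b f [tuple of a ++ b])%E.
Proof.
elim: m f => [|m IH] f mf f0.
  rewrite integral_power_measure0; last first.
    apply: (measurable_fun_fubini_tonelli_F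
      (fun q : 0.-tuple T * n.-tuple T => f [tuple of q.1 ++ q.2])) => //.
    by apply: measurableT_comp => //; exact: measurable_cat_tuple.
  by apply: eq_integral => b _; congr f; apply/val_inj.
rewrite (@integral_power_measureS (m + n))//.
rewrite (@integral_power_measureS m)//; last 2 first.
- apply: (measurable_fun_fubini_tonelli_F
      (fun q : m.+1.-tuple T * n.-tuple T => f [tuple of q.1 ++ q.2])) => //.
  by apply: measurableT_comp => //; exact: measurable_cat_tuple.
- by move=> t; apply: integral_ge0.
apply: eq_integral => a _; rewrite IH//.
- apply: eq_integral => t _; apply: eq_integral => b _; congr f.
  exact/val_inj.
- apply: (measurableT_comp mf).
  apply: (measurableT_comp (@measurable_tcons _ T (m + n))).
  exact: pair1_measurable.
Qed.

End power_integral.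

Section bool_integral.
Context (R : realType).

Lemma integral_counting_bool (f : bool -> \bar R) : (forall b, (0 <= f b)%E) ->
  (\int[@counting bool R]_b f b = f true + f false)%E.
Proof.
move=> f0.
have mf (A : set bool) : measurable_fun A f by [].
have cE (b : bool) : @counting bool R [set b] = 1%E.
  by rewrite /counting asboolT// fset_set1 finmap.cardfs1.
have seteq b : (\int[@counting bool R]_(x in [set b]) f x = f b)%E.
  rewrite (eq_integral (fun=> f b)); last by move=> x /[1!inE] ->.
  rewrite integral_cst// [X in (_ * X)%E](_ : _ = 1%E) ?mule1//; exact: cE.
rewrite (_ : setT = [set true] `|` [set false]); last first.
  by apply/seteqP; split => -[]//= _; [left|right].
rewrite ge0_integral_setU//= ?seteq//.
by apply/disj_setPS => x [] /= -> .
Qed.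

Lemma integral_normal_bool (f : measurableTypeR R * bool -> \bar R) :
  measurable_fun setT f -> (forall z, (0 <= f z)%E) ->
  (\int[product_measure (@lebesgue_measure R) (@counting bool R)]_z f z =
   \int[@lebesgue_measure R]_a (f (a, true) + f (a, false)))%E.
Proof.
move=> mf f0; rewrite /product_measure fubini_tonelli1//=.
by apply: eq_integral => a _; rewrite /fubini_F integral_counting_bool.
Qed.

End bool_integral.

(** * Gaussian and logistic densities *)

Section gaussian.
Context (R : realType).
Implicit Types s w a u x e : R.

Definition gauss s x : R := normal_pdf 0 (Num.sqrt s) x.

Lemma gaussE s x : 0 < s ->
  gauss s x = Num.sqrt (2 * pi * s)^-1 * expR (- x ^+ 2 / (2 * s)).
Proof.
move=> s0; rewrite /gauss normal_pdfE ?gt_eqF ?sqrtr_gt0//.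
rewrite /normal_peak /normal_fun sqr_sqrtr ?ltW// subr0 -sqrtrV; last first.
  by rewrite mulrn_wge0 ?mulr_ge0 ?pi_ge0 ?ltW.
congr (Num.sqrt _^-1 * expR (_ / _)); ring.
Qed.

Lemma gauss_gt0 s x : 0 < s -> 0 < gauss s x.
Proof.
move=> s0; rewrite gaussE// mulr_gt0 ?expR_gt0// sqrtr_gt0 invr_gt0.
by rewrite !mulr_gt0// pi_gt0.
Qed.

Lemma gauss_ge0 s x : 0 <= gauss s x.
Proof. exact: normal_pdf_ge0. Qed.

Lemma measurable_gauss s : measurable_fun [set: measurableTypeR R] (gauss s).
Proof. exact: measurable_normal_pdf. Qed.

Lemma integral_gauss s m : 0 < s ->
  (\int[@lebesgue_measure R]_x (gauss s (x - m))%:E = 1)%E.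
Proof.
move=> s0; rewrite -(integral_normal_pdf m (Num.sqrt s)); apply: eq_integral => x _.
congr _%:E; rewrite /gauss !normal_pdfE ?gt_eqF ?sqrtr_gt0//.
by rewrite /normal_fun subr0.
Qed.

(** The factor on the right undoes the change of normalization, and the exponential
    grows with the variance. *)
Lemma gauss_var_le s s' x : 0 < s -> s <= s' ->
  gauss s x <= Num.sqrt (s' / s) * gauss s' x.
Proof.
move=> s0 ss'; have s'0 : 0 < s' by exact: lt_le_trans ss'.
rewrite !gaussE//.
have := @pi_gt0 R; move: (pi : R) => q q0.
rewrite mulrA -sqrtrM; last by rewrite divr_ge0 ?ltW.
rewrite (_ : s' / s * (2 * q * s')^-1 = (2 * q * s)^-1); last first.
  by field; rewrite !gt_eqF//.
rewrite ler_wpM2l ?sqrtr_ge0// ler_expR !mulNr lerN2 ler_wpM2l ?sqr_ge0//.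
by rewrite lef_pV2 ?posrE ?mulr_gt0// ler_wpM2l.
Qed.

(** Completing the square: the Gaussian weight of variance [w] at [a + u]
    times the [N(m, s)] density is, up to a factor free of [u], a normal
    density of variance [w s / (w + s)] in [u]. *)
Lemma gauss_convolution w s m a : 0 < w -> 0 < s ->
  (\int[@lebesgue_measure R]_u
     (expR (- (a + u) ^+ 2 / (2 * w)) * gauss s (u - m))%:E =
   (Num.sqrt (w / (w + s)) * expR (- (a + m) ^+ 2 / (2 * (w + s))))%:E)%E.
Proof.
move=> w0 s0; have ws0 : 0 < w + s by exact: addr_gt0.
have v0 : 0 < w * s / (w + s) by rewrite divr_gt0// mulr_gt0.
rewrite (eq_integral (fun u : measurableTypeR R => (Num.sqrt (w / (w + s)) *
    expR (- (a + m) ^+ 2 / (2 * (w + s))))%:E *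
    (gauss (w * s / (w + s)) (u - (m * w - a * s) / (w + s)))%:E)%E); last first.
  move=> u _; rewrite -EFinM !gaussE//; congr _%:E.
  have := @pi_gt0 R; move: (pi : R) => q q0.
  rewrite mulrACA -sqrtrM ?divr_ge0 ?ltW// -expRD mulrCA -expRD.
  congr (Num.sqrt _ * expR _).
    by field; rewrite !gt_eqF//.
  by field; rewrite !gt_eqF//.
rewrite ge0_integralZl//.
- by rewrite integral_gauss// mule1.
- apply/measurable_EFinP; apply: measurableT_comp; first exact: measurable_gauss.
  exact: measurable_funB.
- by move=> x _; rewrite lee_fin gauss_ge0.
Qed.

(** Upper envelope of the translates of the standard normal density by at
    most [e], obtained from [|z| <= (1 + z ^ 2) / 2]; it is again a multiple
    of a normal density, and its mass tends to [1] with [e]. *)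
Definition gauss_env e z : R :=
  expR (e / 2) * (Num.sqrt (1 - e)^-1 * gauss (1 - e)^-1 z).

Lemma gauss_envE e z : e < 1 ->
  gauss_env e z = expR (e / 2) * (Num.sqrt (2 * pi)^-1 * expR (- (1 - e) * z ^+ 2 / 2)).
Proof.
move=> e1; have e0 : 0 < 1 - e by rewrite subr_gt0.
rewrite /gauss_env gaussE ?invr_gt0//; have := @pi_gt0 R; move: (pi : R) => q q0.
rewrite !mulrA; congr (_ * expR _).
  rewrite -!mulrA -sqrtrM ?invr_ge0 ?ltW//; congr (_ * Num.sqrt _).
  by field; rewrite !gt_eqF//.
by field; rewrite gt_eqF//.
Qed.

Lemma gauss_env_ge0 e z : 0 <= gauss_env e z.
Proof. by rewrite !mulr_ge0 ?expR_ge0 ?sqrtr_ge0 ?gauss_ge0. Qed.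

Lemma measurable_gauss_env e :
  measurable_fun [set: measurableTypeR R] (gauss_env e).
Proof.
by apply: measurable_funM => //; apply: measurable_funM => //; exact: measurable_gauss.
Qed.

Lemma gauss_env0 z : gauss_env 0 z = gauss 1 z.
Proof. by rewrite /gauss_env mul0r expR0 subr0 invr1 sqrtr1 !mul1r. Qed.

Lemma gauss_le_env e z x : 0 <= e -> e < 1 -> `|x| <= e ->
  gauss 1 (z + x) <= gauss_env e z.
Proof.
move=> e0 e1 xe; rewrite gaussE// gauss_envE//.
rewrite !mulr1 mulrCA -expRD ler_wpM2l ?sqrtr_ge0// ler_expR.
have h1 : - (z * x) <= `|z| * e.
  apply: (le_trans (ler_norm _)); rewrite normrN normrM.
  by rewrite ler_wpM2l.
have h2 : `|z| <= (1 + z ^+ 2) / 2.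
  by rewrite -(real_normK (num_real z)); have := sqr_ge0 (`|z| - 1); nra.
by have := sqr_ge0 x; nra.
Qed.

Lemma gauss_env_mass e : 0 <= e -> e <= 2^-1 -> exists2 M,
  (forall m, (\int[@lebesgue_measure R]_x (gauss_env e (x - m))%:E = M%:E)%E) &
  1 <= M <= expR (2 * e).
Proof.
move=> e0 e12; have e1 : 0 < 1 - e by lra.
exists (expR (e / 2) * Num.sqrt (1 - e)^-1).
  move=> m; under eq_integral do rewrite /gauss_env mulrA EFinM.
  rewrite ge0_integralZl//.
  - by rewrite integral_gauss ?mule1// invr_gt0.
  - apply/measurable_EFinP; apply: measurableT_comp; first exact: measurable_gauss.
    exact: measurable_funB.
  - by move=> x _; rewrite lee_fin gauss_ge0.
have sq1 : 1 <= Num.sqrt (1 - e)^-1.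
  by rewrite -[leLHS]sqrtr1 ler_wsqrtr// invf_ge1//; lra.
apply/andP; split.
  rewrite -[leLHS]mul1r ler_pM// -[leLHS]expR0 ler_expR; lra.
have : (1 - e)^-1 <= expR (2 * e).
  have h := expR_ge1Dx (2 * e).
  apply: le_trans h; rewrite -[leLHS]mul1r ler_pdivrMr//; nra.
move=> /ler_wsqrtr h.
rewrite (_ : 2 * e = e / 2 + e + e / 2)//; last by field.
rewrite !expRD -mulrA ler_wpM2l ?expR_ge0//.
apply: (le_trans h); rewrite -(ler_pXn2r (n:=2))// ?nnegrE ?mulr_ge0 ?expR_ge0//.
rewrite sqr_sqrtr ?expR_ge0// exprMn -!expRM_natl -expRD ler_expR; lra.
Qed.

End gaussian.

Section bernoulli.
Context (R : realType).
Implicit Types (h e : R) (b : bool).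

(** Bernoulli mass function with log-odds [h]. *)
Definition logit_pmf h b : R := expR (b%:R * h - ln (1 + expR h)).

Lemma logit_pmfT h : logit_pmf h true = expR h / (1 + expR h).
Proof.
by rewrite /logit_pmf mul1r expRB lnK// posrE addr_gt0// expR_gt0.
Qed.

Lemma logit_pmfF h : logit_pmf h false = 1 / (1 + expR h).
Proof.
by rewrite /logit_pmf mul0r sub0r expRN lnK ?mul1r// posrE addr_gt0// expR_gt0.
Qed.

Lemma logit_pmf_ge0 h b : 0 <= logit_pmf h b. Proof. exact: expR_ge0. Qed.

Lemma logit_pmfD h : logit_pmf h true + logit_pmf h false = 1.
Proof.
have := expR_gt0 h => h0.
by rewrite logit_pmfT logit_pmfF; field; rewrite gt_eqF// addr_gt0.
Qed.

Lemma logit_pmf_le1 h b : logit_pmf h b <= 1.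
Proof.
have := logit_pmfD h; case: b => /= <-; rewrite ?lerDl ?lerDr logit_pmf_ge0//.
Qed.

Lemma logit_pmf_le_expR h e b : logit_pmf (h + e) b <= expR `|e| * logit_pmf h b.
Proof.
have h0 := expR_gt0 h; have e0 := expR_gt0 e; have n0 := expR_ge0 `|e|.
have le1 : expR e <= expR `|e| by rewrite ler_expR ler_norm.
have le2 : 1 <= expR `|e| by rewrite -expR0 ler_expR.
have le3 : 1 <= expR `|e| * expR e.
  by rewrite -expRD -[leLHS]expR0 ler_expR; have := ler_norm (- e); rewrite normrN; lra.
have d1 : 0 < 1 + expR (h + e) by rewrite addr_gt0// expR_gt0.
have d2 : 0 < 1 + expR h by rewrite addr_gt0.
case: b; rewrite ?logit_pmfT ?logit_pmfF mulrA ler_pdivrMr// mulrAC ler_pdivlMr//.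
  rewrite !expRD; have k1 : 0 <= expR h * (expR `|e| - expR e).
    by rewrite mulr_ge0 ?subr_ge0 ?expR_ge0.
  have k2 : 0 <= expR h * expR h * expR e * (expR `|e| - 1).
    by rewrite !mulr_ge0 ?subr_ge0 ?expR_ge0.
  by nra.
have k1 : 0 <= expR h * (expR `|e| * expR e - 1).
  by rewrite mulr_ge0 ?subr_ge0 ?expR_ge0.
by rewrite mul1r mulr1 expRD; nra.
Qed.

(** The difference of the two logistic values is
    [(e^y - e^x) / ((1 + e^x) (1 + e^y))], at least a multiple of
    [(h' - h) exp (- 3 |a|)], where [x] and [y] are the arguments;
    the lower bound is put in Gaussian form in the offset [a], which is the random
    effect, so that its mean is explicit. *)
Lemma logit_pmf_increase (D h h' a : R) : `|h| <= D -> `|h'| <= D -> h <= h' ->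
  (h' - h) * (expR (- 3 * D - 9) / 4) * expR (- a ^+ 2 / 4) <=
  logit_pmf (h' + a) true - logit_pmf (h + a) true.
Proof.
move=> hD h'D hh'; rewrite !logit_pmfT.
set B := D + `|a|.
have B0 : 0 <= B by rewrite addr_ge0// (le_trans _ hD).
have ha : `|h + a| <= B by rewrite (le_trans (ler_normD _ _))// lerD2r.
have h'a : `|h' + a| <= B by rewrite (le_trans (ler_normD _ _))// lerD2r.
have x0 := expR_gt0 (h + a); have y0 := expR_gt0 (h' + a).
have le2 x : `|x| <= B -> 1 + expR x <= 2 * expR B.
  move=> xB; have : expR x <= expR B by rewrite ler_expR (le_trans (ler_norm _)).
  have : 1 <= expR B by rewrite -expR0 ler_expR.
  lra.
have dx := le2 _ ha; have dy := le2 _ h'a.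
have xB : expR (- B) <= expR (h + a).
  by rewrite ler_expR lerNl (le_trans _ ha)// -normrN ler_norm.
have d0 : 0 < (1 + expR (h + a)) * (1 + expR (h' + a)).
  by rewrite mulr_gt0// addr_gt0.
have -> : expR (h' + a) / (1 + expR (h' + a)) - expR (h + a) / (1 + expR (h + a)) =
   (expR (h' + a) - expR (h + a)) / ((1 + expR (h + a)) * (1 + expR (h' + a))).
  by field; rewrite !gt_eqF ?addr_gt0.
have num : (h' - h) * expR (- B) <= expR (h' + a) - expR (h + a).
  have -> : h' + a = (h + a) + (h' - h) by ring.
  have k1 : 0 <= expR (h + a) * (expR (h' - h) - (1 + (h' - h))).
    by rewrite mulr_ge0 ?subr_ge0 ?expR_ge1Dx ?expR_ge0.
  have k2 : 0 <= (h' - h) * (expR (h + a) - expR (- B)).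
    by rewrite mulr_ge0 ?subr_ge0.
  rewrite expRD; nra.
have den : (1 + expR (h + a)) * (1 + expR (h' + a)) <= 4 * expR (2 * B).
  have -> : 2 * B = B + B by ring.
  rewrite [expR (B + B)]expRD; apply: (le_trans (ler_pM _ _ dx dy)).
  - by rewrite addr_ge0// expR_ge0.
  - by rewrite addr_ge0// expR_ge0.
  - by rewrite mulrACA -natrM.
rewrite ler_pdivlMr//.
(* [3 |a| <= a ^ 2 / 4 + 9] *)
have e3 : expR (- 3 * D - 9) * expR (- a ^+ 2 / 4) * expR (2 * B) <= expR (- B).
  rewrite -!expRD ler_expR /B -(real_normK (num_real a)).
  have := sqr_ge0 (`|a| / 2 - 3); nra.
apply: (le_trans _ num); rewrite -!mulrA ler_wpM2l ?subr_ge0//.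
apply: le_trans e3; rewrite -mulrA ler_wpM2l ?expR_ge0//.
rewrite mulrCA ler_wpM2l ?expR_ge0//; nra.
Qed.

Lemma measurable_logit_pmf d (T : measurableType d) (f : T -> R) (g : T -> bool) :
  measurable_fun setT f -> measurable_fun setT g ->
  measurable_fun setT (fun t => logit_pmf (f t) (g t)).
Proof.
move=> mf mg; apply: measurableT_comp => //; apply: measurable_funB.
  apply: measurable_funM => //.
  by apply: (measurableT_comp (f := fun b : bool => b%:R : R)).
apply: measurableT_comp; first exact: measurable_ln.
by apply: measurable_funD => //; exact: measurableT_comp.
Qed.

End bernoulli.

(** * The responses of one diagonal subject *)

Section subject.
Context (R : realType).
Notation leb := (@lebesgue_measure R).
Notation response := (measurableTypeR R * bool)%type.
Notation nu := (product_measure leb (@counting bool R)).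
Implicit Types (m s c : R) (z : response) (h : response -> R).

(** Conditional density of the two responses of a subject whose linear
    predictors are [m1] and [m2]. *)
Definition lik m1 m2 z : R := gauss 1 (z.1 - m1) * logit_pmf m2 z.2.

Lemma lik_ge0 m1 m2 z : 0 <= lik m1 m2 z.
Proof. by rewrite mulr_ge0 ?gauss_ge0 ?logit_pmf_ge0. Qed.

Lemma measurable_likT d (T : measurableType d) (f1 f2 : T -> R) (g : T -> response) :
  measurable_fun setT f1 -> measurable_fun setT f2 -> measurable_fun setT g ->
  measurable_fun setT (fun t => lik (f1 t) (f2 t) (g t)).
Proof.
move=> mf1 mf2 mg; apply: measurable_funM.
  apply: measurableT_comp; first exact: measurable_gauss.
  by apply: measurable_funB => //; apply: measurableT_comp => //.
by apply: measurable_logit_pmf => //; exact: measurableT_comp.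
Qed.

Lemma measurable_lik m1 m2 : measurable_fun [set: response] (lik m1 m2).
Proof. exact: measurable_likT. Qed.

Lemma integral_logit_response (g : R -> R) m2 :
  measurable_fun [set: measurableTypeR R] g -> (forall y, 0 <= g y) ->
  (\int[nu]_z (g z.1 * logit_pmf m2 z.2)%:E = \int[leb]_y (g y)%:E)%E.
Proof.
move=> mg g0; rewrite integral_normal_bool.
- apply: eq_integral => y _ /=.
  by rewrite -EFinD -mulrDr logit_pmfD mulr1.
- apply/measurable_EFinP; apply: measurable_funM.
    by apply: measurableT_comp.
  exact: measurable_logit_pmf.
- by move=> z; rewrite lee_fin mulr_ge0 ?logit_pmf_ge0.
Qed.

Lemma integral_lik m1 m2 : (\int[nu]_z (lik m1 m2 z)%:E = 1)%E.
Proof.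
rewrite (integral_logit_response m2 (g := fun y => gauss 1 (y - m1))).
- by rewrite integral_gauss.
- apply: measurableT_comp; first exact: measurable_gauss.
  exact: measurable_funB.
- by move=> y; exact: gauss_ge0.
Qed.

(** Joint density of the random effects [(u, v)] met by a diagonal subject
    and of its responses. *)
Definition subject_density m1 m2 s (t : (measurableTypeR R * measurableTypeR R) * response) : R :=
  lik (m1 + (t.1.1 + t.1.2)) (m2 + (t.1.1 + t.1.2)) t.2 * (gauss s t.1.1 * gauss s t.1.2).

Lemma subject_density_ge0 m1 m2 s t : 0 <= subject_density m1 m2 s t.
Proof. by rewrite /subject_density mulr_ge0 ?lik_ge0// mulr_ge0 ?gauss_ge0. Qed.

Lemma measurable_subject_density m1 m2 s :
  measurable_fun setT (subject_density m1 m2 s).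
Proof.
pose T := ((measurableTypeR R * measurableTypeR R) * response)%type.
have m1T : measurable_fun setT (fun t : T => t.1.1).
  by apply: measurableT_comp => //; exact: measurable_fst.
have m2T : measurable_fun setT (fun t : T => t.1.2).
  by apply: measurableT_comp => //; exact: measurable_fst.
apply: measurable_funM.
  by apply: measurable_likT => //; apply: measurable_funD => //; apply: measurable_funD.
apply: measurable_funM; (apply: measurableT_comp => //; exact: measurable_gauss).
Qed.

Definition subject_mean m1 m2 s h : \bar R :=
  (\int[product_measure (product_measure leb leb) nu]_t
     (h t.2 * subject_density m1 m2 s t)%:E)%E.

Let measurable_integrand m1 m2 s h : measurable_fun setT h ->
  measurable_fun setT (fun t => (h t.2 * subject_density m1 m2 s t)%:E).
Proof.
move=> mh; apply/measurable_EFinP; apply: measurable_funM.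
  exact: measurableT_comp.
exact: measurable_subject_density.
Qed.

(** With the responses integrated first, the statistic enters through its conditional
    mean given the predictors only. *)
Lemma subject_mean_effects m1 m2 s h :
  measurable_fun setT h -> (forall z, 0 <= h z) ->
  (subject_mean m1 m2 s h =
   \int[product_measure leb leb]_w ((gauss s w.1 * gauss s w.2)%:E *
     \int[nu]_z (h z * lik (m1 + (w.1 + w.2)) (m2 + (w.1 + w.2)) z)%:E))%E.
Proof.
move=> mh h0.
have i0 t : (0 <= (h t.2 * subject_density m1 m2 s t)%:E)%E.
  by rewrite lee_fin mulr_ge0 ?subject_density_ge0.
rewrite /subject_mean {1}/product_measure fubini_tonelli1//; last first.
  exact: measurable_integrand.
apply: eq_integral => w _; rewrite /fubini_F -ge0_integralZl//.
- apply: eq_integral => z _; rewrite -EFinM /subject_density/=; congr _%:E; ring.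
- apply/measurable_EFinP; apply: measurable_funM => //; exact: measurable_lik.
- by move=> z _; rewrite lee_fin mulr_ge0// lik_ge0.
- by rewrite lee_fin mulr_ge0// gauss_ge0.
Qed.

Lemma measurable_subject_effects m1 m2 s h :
  measurable_fun setT h -> (forall z, 0 <= h z) ->
  measurable_fun setT (fun w : measurableTypeR R * measurableTypeR R =>
    ((gauss s w.1 * gauss s w.2)%:E *
     \int[nu]_z (h z * lik (m1 + (w.1 + w.2)) (m2 + (w.1 + w.2)) z)%:E)%E).
Proof.
move=> mh h0.
have := @measurable_fun_fubini_tonelli_F _ _ _ _ _ nu _
  (@measurable_integrand m1 m2 s h mh).
have i0 t : (0 <= (h t.2 * subject_density m1 m2 s t)%:E)%E.
  by rewrite lee_fin mulr_ge0 ?subject_density_ge0.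
move=> /(_ i0); congr measurable_fun.
apply/funext => w; rewrite /fubini_F -ge0_integralZl//.
- apply: eq_integral => z _; rewrite -EFinM /subject_density/=; congr _%:E; ring.
- apply/measurable_EFinP; apply: measurable_funM => //; exact: measurable_lik.
- by move=> z _; rewrite lee_fin mulr_ge0// lik_ge0.
- by rewrite lee_fin mulr_ge0// gauss_ge0.
Qed.

Lemma subject_mean_iter m1 m2 s h (H : R -> R) :
  measurable_fun setT h -> (forall z, 0 <= h z) ->
  (forall a, \int[nu]_z (h z * lik (m1 + a) (m2 + a) z)%:E = (H a)%:E)%E ->
  (subject_mean m1 m2 s h =
   \int[leb]_u \int[leb]_v (H (u + v) * (gauss s u * gauss s v))%:E)%E.
Proof.
move=> mh h0 hH.
have mF := measurable_subject_effects m1 m2 s mh h0.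
rewrite subject_mean_effects// /product_measure fubini_tonelli1//; last first.
  move=> w; rewrite mule_ge0 ?lee_fin ?mulr_ge0 ?gauss_ge0//.
  by apply: integral_ge0 => z _; rewrite lee_fin mulr_ge0// lik_ge0.
apply: eq_integral => u _; apply: eq_integral => v _.
by rewrite hH -EFinM mulrC.
Qed.

Lemma subject_meanD m1 m2 s h1 h2 :
  measurable_fun setT h1 -> measurable_fun setT h2 ->
  (forall z, 0 <= h1 z) -> (forall z, 0 <= h2 z) ->
  (subject_mean m1 m2 s (fun z => (h1 z + h2 z)%R) =
   subject_mean m1 m2 s h1 + subject_mean m1 m2 s h2)%E.
Proof.
move=> mh1 mh2 h10 h20; rewrite /subject_mean -ge0_integralD//.
- by apply: eq_integral => t _; rewrite /= mulrDl EFinD.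
- by move=> t _; rewrite lee_fin mulr_ge0 ?subject_density_ge0.
- exact: measurable_integrand.
- by move=> t _; rewrite lee_fin mulr_ge0 ?subject_density_ge0.
- exact: measurable_integrand.
Qed.

Lemma subject_meanZ m1 m2 s c h :
  measurable_fun setT h -> (forall z, 0 <= h z) -> 0 <= c ->
  (subject_mean m1 m2 s (fun z => (c * h z)%R) = c%:E * subject_mean m1 m2 s h)%E.
Proof.
move=> mh h0 c0; rewrite /subject_mean -ge0_integralZl//.
- by apply: eq_integral => t _; rewrite -EFinM [in RHS]mulrA.
- exact: measurable_integrand.
- by move=> t _; rewrite lee_fin mulr_ge0 ?subject_density_ge0.
Qed.

Lemma subject_mean_le m1 m2 s h1 h2 :
  measurable_fun setT h1 -> measurable_fun setT h2 ->
  (forall z, 0 <= h1 z <= h2 z) ->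
  (subject_mean m1 m2 s h1 <= subject_mean m1 m2 s h2)%E.
Proof.
move=> mh1 mh2 h12; apply: ge0_le_integral => //.
- move=> t _; have /andP[? ?] := h12 t.2.
  by rewrite lee_fin mulr_ge0 ?subject_density_ge0.
- exact: measurable_integrand.
- exact: measurable_integrand.
- move=> t _; have /andP[? ?] := h12 t.2.
  by rewrite lee_fin ler_wpM2r ?subject_density_ge0.
Qed.

Lemma subject_mean_cst m1 m2 s c : 0 < s -> 0 <= c ->
  (subject_mean m1 m2 s (fun=> c) = c%:E)%E.
Proof.
move=> s0 c0; have iu : (\int[leb]_v (gauss s v)%:E = 1)%E.
  by have := integral_gauss 0 s0; under eq_integral do rewrite subr0.
rewrite (@subject_mean_iter m1 m2 s (fun=> c) (fun=> c))//; last first.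
  move=> a; under eq_integral do rewrite EFinM.
  rewrite ge0_integralZl//.
  - by rewrite integral_lik mule1.
  - by apply/measurable_EFinP; exact: measurable_lik.
  - by move=> z _; rewrite lee_fin lik_ge0.
transitivity (\int[leb]_u (c%:E * (gauss s u)%:E))%E.
  apply: eq_integral => u _; under eq_integral do rewrite mulrA EFinM.
  rewrite ge0_integralZl//.
  - by rewrite iu mule1 EFinM.
  - by apply/measurable_EFinP; exact: measurable_gauss.
  - by move=> z _; rewrite lee_fin gauss_ge0.
  - by rewrite lee_fin mulr_ge0// gauss_ge0.
rewrite ge0_integralZl//.
- by rewrite iu ?mule1.
- by apply/measurable_EFinP; exact: measurable_gauss.
- by move=> z _; rewrite lee_fin gauss_ge0.
Qed.

End subject.

Section expR_bounds.
Context (R : realType).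

Lemma expR_le_quadratic (x : R) : x <= 2^-1 -> expR x <= 1 + x + 2 * x ^+ 2.
Proof.
move=> x2; have x1 : 0 < 1 - x by lra.
have h := expR_ge1Dx (- x); rewrite expRN in h.
have e0 := expR_gt0 x.
have h1 : (1 - x) * expR x <= 1.
  by rewrite -ler_pdivlMr// div1r.
have h2 : 1 <= (1 - x) * (1 + x + 2 * x ^+ 2) by have := sqr_ge0 x; nra.
by rewrite -(ler_pM2l x1) (le_trans h1).
Qed.

End expR_bounds.

Section subject_means.
Context (R : realType).
Notation leb := (@lebesgue_measure R).
Notation response := (measurableTypeR R * bool)%type.
Notation nu := (product_measure leb (@counting bool R)).
Implicit Types (m s c t : R) (z : response) (h : response -> R).

Lemma subject_mean_fin m1 m2 s h : 0 < s -> measurable_fun setT h ->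
  (forall z, 0 <= h z <= 1) ->
  exists2 e, subject_mean m1 m2 s h = e%:E & 0 <= e <= 1.
Proof.
move=> s0 mh h01.
have h0 z : 0 <= h z by case/andP: (h01 z).
have ub : (subject_mean m1 m2 s h <= 1)%E.
  rewrite -(subject_mean_cst m1 m2 s0 ler01); apply: subject_mean_le => //.
have lb : (0 <= subject_mean m1 m2 s h)%E.
  apply: integral_ge0 => t _.
  by rewrite lee_fin mulr_ge0 ?subject_density_ge0.
have fin : subject_mean m1 m2 s h \is a fin_num.
  by rewrite ge0_fin_numE// (le_lt_trans ub)// ltry.
exists (fine (subject_mean m1 m2 s h)); rewrite ?fineK//.
by rewrite -!lee_fin fineK// lb.
Qed.

Lemma subject_meanC m1 m2 s h (e : R) : 0 < s -> measurable_fun setT h ->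
  (forall z, 0 <= h z <= 1) -> subject_mean m1 m2 s h = e%:E ->
  subject_mean m1 m2 s (fun z => 1 - h z) = (1 - e)%:E.
Proof.
move=> s0 mh h01 he.
have h0 z : 0 <= h z by case/andP: (h01 z).
have h1 z : 0 <= 1 - h z by case/andP: (h01 z); rewrite subr_ge0.
have mh1 : measurable_fun setT (fun z => 1 - h z) by exact: measurable_funB.
have := subject_meanD m1 m2 s mh mh1 h0 h1.
rewrite he (_ : (fun z => h z + (1 - h z)) = (fun=> 1)); last by apply/funext => z; ring.
rewrite subject_mean_cst// => /esym /eqP.
rewrite addeC eq_sym -sube_eq ?fin_num_adde_defl//.
by rewrite -EFinB => /eqP.
Qed.

(** A crude form of Hoeffding's lemma, by the quadratic bound on the exponential. *)
Lemma subject_mean_mgf m1 m2 s h e t c : 0 < s -> measurable_fun setT h ->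
  (forall z, 0 <= h z <= 1) -> subject_mean m1 m2 s h = e%:E ->
  0 <= t <= 1 -> `|c| <= 2^-1 ->
  (subject_mean m1 m2 s (fun z => expR (c * (h z - t))) <=
   (expR (c * (e - t) + 2 * c ^+ 2))%:E)%E.
Proof.
move=> s0 mh h01 he t01 c2.
have h0 z : 0 <= h z by case/andP: (h01 z).
have mpsi : measurable_fun setT (fun z => expR (c * (h z - t))).
  apply: measurableT_comp => //; apply: measurable_funM => //.
  exact: measurable_funB.
have pt z : expR (c * (h z - t)) <= 1 + c * (h z - t) + 2 * c ^+ 2.
  have ht1 : `|h z - t| <= 1.
    by have /andP[? ?] := h01 z; rewrite ler_norml; move/andP: t01 => -[]; lra.
  have ht2 : (h z - t) ^+ 2 <= 1.
    by rewrite -(real_normK (num_real _)) expr_le1.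
  have lect : c * (h z - t) <= 2^-1.
    apply: (le_trans (ler_norm _)); rewrite normrM -[leRHS]mulr1.
    by rewrite ler_pM.
  apply: (le_trans (expR_le_quadratic lect)).
  rewrite exprMn; have := sqr_ge0 c; nra.
have fin : (1 + c * (e - t) + 2 * c ^+ 2 <= expR (c * (e - t) + 2 * c ^+ 2)).
  by rewrite -addrA expR_ge1Dx.
have k0 : 0 <= 1 - c * t + 2 * c ^+ 2.
  have := ler_normlP _ _ c2; move/andP: t01 => -[t0 t1] [c1 c3].
  have := sqr_ge0 c; nra.
apply: (@le_trans _ _ (1 + c * (e - t) + 2 * c ^+ 2)%:E); last by rewrite lee_fin.
(* the term in [h] is kept on the side of the inequality where it is nonnegative *)
have [c0|c0] := leP 0 c.
  have := @subject_mean_le _ m1 m2 s (fun z => expR (c * (h z - t)))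
    (fun z => (1 - c * t + 2 * c ^+ 2) + c * h z).
  rewrite subject_meanD// ?subject_mean_cst ?subject_meanZ// ?he; last 2 first.
  - exact: measurable_funM.
  - by move=> z; rewrite mulr_ge0.
  move=> H; apply: (le_trans (H _ _ _)) => //.
  - by apply: measurable_funD => //; exact: measurable_funM.
  - by move=> z; rewrite expR_ge0/=; have := pt z; lra.
  - by rewrite -EFinM -EFinD lee_fin; lra.
have c0' : 0 <= - c by rewrite oppr_ge0 ltW.
have := @subject_mean_le _ m1 m2 s (fun z => expR (c * (h z - t)) + (- c) * h z)
    (fun=> 1 - c * t + 2 * c ^+ 2).
rewrite subject_meanD// ?subject_mean_cst ?subject_meanZ// ?he; first last.
- by move=> z; rewrite mulr_ge0.
- exact: measurable_funM.
move=> H.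
have {}H : (subject_mean m1 m2 s (fun z => expR (c * (h z - t))) +
   (- c * e)%:E <= (1 - c * t + 2 * c ^+ 2)%:E)%E.
  apply: H => //.
  - by apply: measurable_funD => //; exact: measurable_funM.
  - move=> z; apply/andP; split; last by have := pt z; lra.
    by rewrite addr_ge0 ?expR_ge0// mulr_ge0.
rewrite -leeBrDr// in H; apply: (le_trans H).
by rewrite -EFinB lee_fin; lra.
Qed.

(** Each of the two effects costs a factor [sqrt (s' / s)], by [gauss_var_le]. *)
Lemma subject_mean_var_le m1 m2 s s' h : 0 < s -> s <= s' ->
  measurable_fun setT h -> (forall z, 0 <= h z) ->
  (subject_mean m1 m2 s h <= (s' / s)%:E * subject_mean m1 m2 s' h)%E.
Proof.
move=> s0 ss' mh h0; have s'0 : 0 < s' by exact: lt_le_trans ss'.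
have r0 : 0 <= s' / s by rewrite divr_ge0// ltW.
have mi (a : R) : measurable_fun setT (fun q => (h q.2 * subject_density m1 m2 a q)%:E).
  apply/measurable_EFinP; apply: measurable_funM.
    exact: measurableT_comp.
  exact: measurable_subject_density.
rewrite /subject_mean -ge0_integralZl//; last first.
  by move=> t _; rewrite lee_fin mulr_ge0 ?subject_density_ge0.
apply: ge0_le_integral => //.
- by move=> t _; rewrite lee_fin mulr_ge0 ?subject_density_ge0.
- exact: measurable_funeM.
- move=> t _; rewrite -EFinM lee_fin [leRHS]mulrCA ler_wpM2l//.
  rewrite /subject_density [leRHS]mulrCA ler_wpM2l ?lik_ge0//.
  rewrite -[s' / s](sqr_sqrtr r0) expr2 mulrACA.
  by rewrite ler_pM ?gauss_ge0// gauss_var_le.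
Qed.

(** [subject_mean_var_le] bounds [e] above by means of [h], and below by means of
    [1 - h]. *)
Lemma subject_mean_var_lipschitz m1 m2 s s' h (e e' lo : R) : 0 < lo -> lo <= s -> lo <= s' ->
  measurable_fun setT h -> (forall z, 0 <= h z <= 1) ->
  subject_mean m1 m2 s h = e%:E -> subject_mean m1 m2 s' h = e'%:E ->
  `|e - e'| <= `|s - s'| / lo.
Proof.
move=> lo0; wlog ss' : s s' e e' / s <= s' => [hw|].
  move=> los los' mh h01 he he'; have [ss'|/ltW ss'] := leP s s'; first exact: hw.
  by rewrite distrC (distrC s); exact: hw.
move=> los los' mh h01 he he'; have s0 : 0 < s by exact: lt_le_trans los.
have s'0 : 0 < s' by exact: lt_le_trans ss'.
have h0 z : 0 <= h z by case/andP: (h01 z).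
have h1 z : 0 <= 1 - h z by case/andP: (h01 z); rewrite subr_ge0.
have r0 : 0 < s' / s by rewrite divr_gt0.
have mh1 : measurable_fun setT (fun z => 1 - h z) by exact: measurable_funB.
have A1 := subject_mean_var_le m1 m2 s0 ss' mh h0.
have A2 := subject_mean_var_le m1 m2 s0 ss' mh1 h1.
rewrite he he' -EFinM lee_fin in A1.
rewrite (subject_meanC s0 mh h01 he) (subject_meanC s'0 mh h01 he') -EFinM lee_fin in A2.
have [e2 + e01] := subject_mean_fin m1 m2 s'0 mh h01; rewrite he' => -[E1].
rewrite -E1 in e01; case/andP: e01 => e0 e1.
have rE : s' / s - 1 <= (s' - s) / lo.
  have -> : s' / s - 1 = (s' - s) / s by field; rewrite gt_eqF.
  rewrite ler_wpM2l ?subr_ge0//.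
  by rewrite lef_pV2 ?posrE.
have r1 : 0 <= s' / s - 1 by rewrite subr_ge0 ler_pdivlMr// mul1r.
rewrite (distrC s) (ger0_norm (_ : 0 <= s' - s)) ?subr_ge0//.
apply: le_trans rE; rewrite ler_norml.
move: (s' / s) r0 A1 A2 r1 => r r0 A1 A2 r1.
by apply/andP; split; nra.
Qed.

End subject_means.

Section subject_statistics.
Context (R : realType).
Notation leb := (@lebesgue_measure R).
Notation response := (measurableTypeR R * bool)%type.
Notation nu := (product_measure leb (@counting bool R)).
Implicit Types (m s c k : R) (z : response) (h : response -> R).

Lemma subject_mean_le_iter m1 m2 m1' m2' s h h' :
  measurable_fun setT h -> measurable_fun setT h' ->
  (forall z, 0 <= h z) -> (forall z, 0 <= h' z) ->
  (forall a, \int[nu]_z (h z * lik (m1 + a) (m2 + a) z)%:E <=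
             \int[nu]_z (h' z * lik (m1' + a) (m2' + a) z)%:E)%E ->
  (subject_mean m1 m2 s h <= subject_mean m1' m2' s h')%E.
Proof.
move=> mh mh' h0 h'0 hh'.
rewrite (subject_mean_effects m1 m2 s mh h0) (subject_mean_effects m1' m2' s mh' h'0).
apply: ge0_le_integral.
- exact: measurableT.
- move=> w _; rewrite mule_ge0 ?lee_fin ?mulr_ge0 ?gauss_ge0//.
  by apply: integral_ge0 => z _; rewrite lee_fin mulr_ge0// lik_ge0.
- exact: measurable_subject_effects.
- exact: measurable_subject_effects.
- by move=> w _; rewrite lee_wpmul2l// lee_fin mulr_ge0// gauss_ge0.
Qed.

(** A bounded statistic whose mean is explicit: the response and the two random
    effects are removed by three Gaussian convolutions. *)
Definition bump k z : R := expR (- (z.1 - k) ^+ 2 / 2).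

Lemma bump01 k z : 0 <= bump k z <= 1.
Proof.
rewrite expR_ge0/= -[leRHS]expR0 ler_expR mulNr oppr_le0 divr_ge0//.
exact: sqr_ge0.
Qed.

Lemma measurable_bump k : measurable_fun setT (bump k).
Proof.
apply: measurableT_comp => //; apply: measurable_funM => //.
apply: measurableT_comp => //; apply: measurable_funX.
apply: measurable_funB => //.
Qed.

Let mexp (a w : R) : measurable_fun [set: measurableTypeR R]
  (fun y => expR (- (a + y) ^+ 2 / w)).
Proof.
apply: measurableT_comp => //; apply: measurable_funM => //.
apply: measurableT_comp => //; apply: measurable_funX.
exact: measurable_funD.
Qed.

Lemma integral_bump_lik k m1 m2 :
  (\int[nu]_z (bump k z * lik m1 m2 z)%:E =
   (Num.sqrt 2^-1 * expR (- (m1 - k) ^+ 2 / 4))%:E)%E.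
Proof.
under eq_integral do rewrite /lik mulrA.
rewrite (integral_logit_response m2
  (g := fun y => expR (- (y - k) ^+ 2 / 2) * gauss 1 (y - m1))).
- under eq_integral do rewrite (addrC _ (- k)) -[X in - _ / X]mulr1.
  rewrite gauss_convolution// div1r (addrC m1).
  by congr (Num.sqrt _^-1 * expR (_ / _))%:E; ring.
- apply: measurable_funM.
    under eq_fun do rewrite (addrC _ (- k)).
    exact: mexp.
  apply: measurableT_comp; first exact: measurable_gauss.
  exact: measurable_funB.
- by move=> y; rewrite mulr_ge0 ?expR_ge0 ?gauss_ge0.
Qed.

Lemma subject_mean_bump k m1 m2 s : 0 < s ->
  subject_mean m1 m2 s (bump k) =
  (Num.sqrt (2 * (1 + s))^-1 * expR (- (m1 - k) ^+ 2 / (4 * (1 + s))))%:E.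
Proof.
move=> s0; rewrite (@subject_mean_iter _ m1 m2 s (bump k)
  (fun a => Num.sqrt 2^-1 * expR (- (m1 + a - k) ^+ 2 / 4)))//; first last.
- by move=> a; exact: integral_bump_lik.
- by move=> z; case/andP: (bump01 k z).
- exact: measurable_bump.
have mg a (w : R) : measurable_fun [set: measurableTypeR R]
    (fun v => (expR (- (a + v) ^+ 2 / w) * gauss s v)%:E).
  by apply/measurable_EFinP; apply: measurable_funM => //; exact: measurable_gauss.
have g0 a (w v : R) : (0 <= (expR (- (a + v) ^+ 2 / w) * gauss s v)%:E)%E.
  by rewrite lee_fin mulr_ge0 ?expR_ge0 ?gauss_ge0.
have conv a (w : R) : 0 < w -> (\int[leb]_v (expR (- (a + v) ^+ 2 / (2 * w)) * gauss s v)%:E =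
   (Num.sqrt (w / (w + s)) * expR (- a ^+ 2 / (2 * (w + s))))%:E)%E.
  move=> w0; have := gauss_convolution 0 a w0 s0; rewrite addr0 => <-.
  by apply: eq_integral => v _; rewrite subr0.
transitivity (\int[leb]_u ((Num.sqrt 2^-1 * Num.sqrt (2 / (2 + s)))%:E *
    (expR (- ((m1 - k) + u) ^+ 2 / (2 * (2 + s))) * gauss s u)%:E))%E.
  apply: eq_integral => u _.
  rewrite (eq_integral (fun v : measurableTypeR R => ((Num.sqrt 2^-1 * gauss s u)%:E *
    (expR (- ((m1 - k + u) + v) ^+ 2 / (2 * 2)) * gauss s v)%:E)%E)); last first.
    move=> v _; rewrite -EFinM; congr _%:E.
    have -> : m1 + (u + v) - k = m1 - k + u + v by ring.
    have -> : 2 * 2 = 4 :> R by ring.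
    by ring.
  rewrite ge0_integralZl//.
    by rewrite conv// -!EFinM; congr _%:E; ring.
  by rewrite lee_fin mulr_ge0 ?gauss_ge0.
rewrite ge0_integralZl//.
rewrite conv ?addr_gt0// -EFinM; congr _%:E.
rewrite mulrA -!sqrtrM; [|by rewrite ?divr_ge0 ?mulr_ge0 ?invr_ge0 ?addr_ge0 ?(ltW s0)..].
congr (Num.sqrt _ * expR (_ / _)).
  by field; rewrite ?gt_eqF//; lra.
by ring.
Qed.

Definition success z : R := z.2%:R.

Lemma success01 z : 0 <= success z <= 1.
Proof. by rewrite /success; case: z.2; rewrite ?lexx ?ler01. Qed.

Lemma measurable_success : measurable_fun setT success.
Proof.
apply: (measurableT_comp (f := fun b : bool => b%:R : R)) => //.
Qed.

Lemma integral_success_lik m1 m2 :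
  (\int[nu]_z (success z * lik m1 m2 z)%:E = (logit_pmf m2 true)%:E)%E.
Proof.
rewrite integral_normal_bool.
- under eq_integral do rewrite /success /lik/= mul0r adde0 mul1r mulrC EFinM.
  rewrite ge0_integralZl//.
  + by rewrite integral_gauss ?mule1.
  + apply/measurable_EFinP; apply: measurableT_comp; first exact: measurable_gauss.
    exact: measurable_funB.
  + by move=> y _; rewrite lee_fin gauss_ge0.
  + by rewrite lee_fin logit_pmf_ge0.
- apply/measurable_EFinP; apply: measurable_funM; first exact: measurable_success.
  exact: measurable_lik.
- by move=> z; rewrite lee_fin mulr_ge0 ?lik_ge0//; case/andP: (success01 z).
Qed.

(** By [logit_pmf_increase], conditionally on the effects the success probability grows
    at least by a multiple of the mean of the bump centred at [m1]. *)
Lemma subject_mean_success_increase (D m1 m2 m2' s e e' : R) : 0 < s ->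
  `|m2| <= D -> `|m2'| <= D -> m2 <= m2' ->
  subject_mean m1 m2 s success = e%:E -> subject_mean m1 m2' s success = e'%:E ->
  (m2' - m2) * (expR (- 3 * D - 9) / 4) * Num.sqrt (1 + s)^-1 <= e' - e.
Proof.
move=> s0 m2D m2'D mm he he'.
set K := (m2' - m2) * (expR (- 3 * D - 9) / 4).
have K0 : 0 <= K * Num.sqrt 2.
  by rewrite !mulr_ge0 ?subr_ge0// expR_ge0.
have bK := logit_pmf_increase _ m2D m2'D mm; rewrite -/K in bK; clearbody K.
have suc0 z : 0 <= success z by case/andP: (success01 z).
have b0 z : 0 <= K * Num.sqrt 2 * bump m1 z.
  by rewrite mulr_ge0//; case/andP: (bump01 m1 z).
have mKb : measurable_fun setT (fun z => K * Num.sqrt 2 * bump m1 z).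
  by apply: measurable_funM => //; exact: measurable_bump.
have : (subject_mean m1 m2 s (fun z => (success z + K * Num.sqrt 2 * bump m1 z)%R) <=
       subject_mean m1 m2' s success)%E.
  apply: subject_mean_le_iter.
  - by apply: measurable_funD => //; exact: measurable_success.
  - exact: measurable_success.
  - by move=> z; rewrite addr_ge0.
  - exact: suc0.
  move=> a; rewrite integral_success_lik.
  rewrite (eq_integral (fun z => ((success z * lik (m1 + a) (m2 + a) z)%:E +
    (K * Num.sqrt 2)%:E * (bump m1 z * lik (m1 + a) (m2 + a) z)%:E)%E)); last first.
    by move=> z _; rewrite -EFinM -EFinD; congr _%:E; ring.
  rewrite ge0_integralD//; last 4 first.
  - by move=> z _; rewrite lee_fin mulr_ge0 ?lik_ge0.
  - apply/measurable_EFinP; apply: measurable_funM; first exact: measurable_success.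
    exact: measurable_lik.
  - move=> z _; rewrite -EFinM lee_fin mulr_ge0// mulr_ge0 ?lik_ge0//.
    by case/andP: (bump01 m1 z).
  - apply: measurable_funeM; apply/measurable_EFinP; apply: measurable_funM.
      exact: measurable_bump.
    exact: measurable_lik.
  rewrite integral_success_lik ge0_integralZl//; last 2 first.
  - apply/measurable_EFinP; apply: measurable_funM; first exact: measurable_bump.
    exact: measurable_lik.
  - by move=> z _; rewrite lee_fin mulr_ge0 ?lik_ge0//; case/andP: (bump01 m1 z).
  rewrite integral_bump_lik -EFinM -EFinD lee_fin.
  have -> : m1 + a - m1 = a by ring.
  rewrite mulrA -(mulrA K) -sqrtrM// mulfV// sqrtr1 mulr1.
  by have := bK a; lra.
rewrite subject_meanD//; last exact: measurable_success.
rewrite subject_meanZ//; last 2 first.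
- exact: measurable_bump.
- by move=> z; case/andP: (bump01 m1 z).
rewrite he he' subject_mean_bump// subrr expr0n/= oppr0 mul0r expR0 mulr1.
rewrite -EFinM -EFinD lee_fin -mulrA -sqrtrM// invfM mulrA mulfV// mul1r.
lra.
Qed.

End subject_statistics.

(** * Separation of the parameters of one subject *)

Section separation.
Context (R : realType).
Notation response := (measurableTypeR R * bool)%type.
Implicit Types (D lo hi m s q x : R) (h : response -> R).

Lemma expR_sinh_ge (w : R) : `|w| <= `|expR w - expR (- w)|.
Proof.
wlog w0 : w / 0 <= w => [hw|].
  have [/hw//|/ltW w0] := leP 0 w.
  have := hw (- w); rewrite oppr_ge0 w0 opprK normrN distrC; exact.
rewrite ger0_norm//; apply: le_trans (ler_norm _).
have := expR_ge1Dx w; have : expR (- w) <= 1 by rewrite expR_le1 oppr_le0.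
lra.
Qed.

Lemma inv_sqrt_separation q q' hi : 1 <= q <= hi -> 1 <= q' <= hi ->
  `|q - q'| / (4 * hi ^+ 2) <= `|Num.sqrt (2 * q)^-1 - Num.sqrt (2 * q')^-1|.
Proof.
move=> /andP[q1 qh] /andP[q'1 q'h].
have q0 : 0 < q by lra.
have q'0 : 0 < q' by lra.
have hi0 : 0 < hi by lra.
set A := Num.sqrt _; set B := Num.sqrt _.
have sq a : 1 <= a -> Num.sqrt (2 * a)^-1 <= 1.
  move=> a1; rewrite -[leRHS]sqrtr1 ler_wsqrtr// invf_le1//; lra.
have A1 : 0 <= A <= 1 by rewrite sqrtr_ge0 sq.
have B1 : 0 <= B <= 1 by rewrite sqrtr_ge0 sq.
have E : (A - B) * (A + B) = (q' - q) / (2 * q * q').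
  rewrite -subr_sqr !sqr_sqrtr ?invr_ge0 ?mulr_ge0 ?ltW//.
  by field; rewrite !gt_eqF.
have E' : `|A - B| * (A + B) = `|q - q'| / (2 * q * q').
  have <- : `|A + B| = A + B by rewrite ger0_norm//; lra.
  rewrite -normrM E normrM distrC; congr (_ * _).
  by rewrite gtr0_norm// invr_gt0 !mulr_gt0.
apply: (@le_trans _ _ (`|A - B| * (A + B) / 2)); last first.
  by have := normr_ge0 (A - B); nra.
rewrite E' -[leRHS]mulrA -invfM ler_wpM2l// lef_pV2 ?posrE; last 2 first.
- by rewrite mulr_gt0// exprn_gt0.
- by rewrite !mulr_gt0.
nra.
Qed.

(** Three bounded statistics of the responses of one subject determine, in
    turn, the first predictor (an odd combination of two bumps, whose mean does
    not depend on [s] at the reference predictor), then the variance component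
    (a centred bump, up to an error quadratic in the first difference), then
    the second predictor (the binary response, up to an error linear in the
    change of variance).  Whichever of the three has the largest change of
    mean controls all three parameter differences. *)
Lemma subject_separation D lo hi : 0 <= D -> 0 < lo -> lo <= hi ->
  exists2 K, 0 < K & forall m1 m2 s m1' m2' s',
    [/\ `|m1| <= D, `|m2| <= D, `|m1'| <= D & `|m2'| <= D] ->
    lo <= s <= hi -> lo <= s' <= hi ->
    exists h e e', [/\ measurable_fun setT h, forall z, 0 <= h z <= 1,
      subject_mean m1 m2 s h = e%:E, subject_mean m1' m2' s' h = e'%:E &
      [/\ `|m1 - m1'| <= K * `|e - e'|, `|m2 - m2'| <= K * `|e - e'| &
        `|s - s'| <= K * `|e - e'|]].
Proof.
move=> D0 lo0 lohi; have hi0 : 0 < hi by exact: lt_le_trans lohi.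
pose c1 := 2^-1 * Num.sqrt (2 * (1 + hi))^-1 * expR (- (4 * D ^+ 2 + 1) / 4) / (2 * (1 + hi)).
pose c2 := (4 * (1 + hi) ^+ 2)^-1.
pose c3 := expR (- 3 * D - 9) / 4 * Num.sqrt (1 + hi)^-1.
have hi1 : 0 < 1 + hi by rewrite addr_gt0.
have c10 : 0 < c1.
  by rewrite divr_gt0 ?mulr_gt0 ?expR_gt0// sqrtr_gt0 invr_gt0 mulr_gt0.
have c20 : 0 < c2 by rewrite invr_gt0 mulr_gt0// exprn_gt0.
have c30 : 0 < c3.
  by rewrite mulr_gt0 ?divr_gt0 ?expR_gt0// sqrtr_gt0 invr_gt0.
pose K1 := c1^-1; pose K2 := (1 + 2 * D * K1) / c2; pose K3 := (1 + K2 / lo) / c3.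
have K10 : 0 < K1 by rewrite invr_gt0.
have K20 : 0 < K2.
  by rewrite divr_gt0// ltr_wpDr// !mulr_ge0// ltW.
have K30 : 0 < K3 by rewrite divr_gt0// addr_gt0// divr_gt0.
exists (K1 + K2 + K3); first by rewrite !addr_gt0.
move=> m1 m2 s m1' m2' s' [m1D m2D m1'D m2'D] /andP[los shi] /andP[los' s'hi].
have s0 : 0 < s by exact: lt_le_trans los.
have s'0 : 0 < s' by exact: lt_le_trans los'.
set x := m1 - m1'.
have xD : `|x| <= 2 * D by rewrite (le_trans (ler_normB _ _))//; lra.
have xD2 : x ^+ 2 <= 4 * D ^+ 2.
  rewrite -(real_normK (num_real x)); have := normr_ge0 x; nra.
have xD3 : x ^+ 2 <= 2 * D * `|x|.
  by rewrite -(real_normK (num_real x)); have := normr_ge0 x; nra.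
(* at the reference predictor [m1'] the two bumps have equal means whatever the
   variance, so that the gap is driven by [x] alone, through a hyperbolic sine *)
pose h1 z : R := 2^-1 * (bump (m1' + 1) z + (1 - bump (m1' - 1) z)).
have b01 := @bump01 R.
have mb k : measurable_fun setT (fun z => 1 - bump k z).
  by apply: measurable_funB => //; exact: measurable_bump.
have mh1 : measurable_fun setT h1.
  apply: measurable_funM => //; apply: measurable_funD => //.
  exact: measurable_bump.
have h101 z : 0 <= h1 z <= 1.
  by have := b01 (m1' + 1) z; have := b01 (m1' - 1) z; rewrite /h1; lra.
have meanh1 (n1 n2 a : R) : 0 < a -> subject_mean n1 n2 a h1 =
   (2^-1 * (Num.sqrt (2 * (1 + a))^-1 * expR (- (n1 - (m1' + 1)) ^+ 2 / (4 * (1 + a))) +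
   (1 - Num.sqrt (2 * (1 + a))^-1 * expR (- (n1 - (m1' - 1)) ^+ 2 / (4 * (1 + a))))))%:E.
  move=> a0; have b0 (z : response) (k : R) : 0 <= bump k z by case/andP: (b01 k z).
  have b1 (z : response) (k : R) : 0 <= 1 - bump k z by case/andP: (b01 k z); lra.
  rewrite subject_meanZ//.
  - rewrite subject_meanD//; last exact: measurable_bump.
    rewrite subject_mean_bump//.
    rewrite (subject_meanC a0 _ _ (subject_mean_bump (m1' - 1) n1 n2 a0))//.
    exact: measurable_bump.
  - by apply: measurable_funD => //; exact: measurable_bump.
  - by move=> z; rewrite addr_ge0.
have [e1 [e1' [he1 he1' gap1]]] : exists e e', [/\ subject_mean m1 m2 s h1 = e%:E,
    subject_mean m1' m2' s' h1 = e'%:E & `|x| <= K1 * `|e - e'|].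
  do 2 eexists; split; [exact: meanh1|exact: meanh1|].
  have -> : m1 - (m1' + 1) = x - 1 by rewrite /x; ring.
  have -> : m1 - (m1' - 1) = x + 1 by rewrite /x; ring.
  have -> : m1' - (m1' + 1) = - 1 by ring.
  have -> : m1' - (m1' - 1) = 1 by ring.
  rewrite sqrrN ler_pdivlMl//.
  set A := Num.sqrt _; set A' := Num.sqrt (2 * (1 + s'))^-1.
  have q0 : 0 < 1 + s by rewrite addr_gt0.
  set B := expR (- (x ^+ 2 + 1) / (4 * (1 + s))).
  set w := x / (2 * (1 + s)).
  have -> : expR (- (x - 1) ^+ 2 / (4 * (1 + s))) = B * expR w.
    by rewrite -expRD; congr expR; rewrite /w; field; rewrite gt_eqF.
  have -> : expR (- (x + 1) ^+ 2 / (4 * (1 + s))) = B * expR (- w).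
    by rewrite -expRD; congr expR; rewrite /w; field; rewrite gt_eqF.
  set F := expR (- 1 ^+ 2 / _).
  have -> : 2^-1 * (A * (B * expR w) + (1 - A * (B * expR (- w)))) -
     2^-1 * (A' * F + (1 - A' * F)) = 2^-1 * A * B * (expR w - expR (- w)) by ring.
  have A0 : 0 <= A by exact: sqrtr_ge0.
  have B0 : 0 <= B by exact: expR_ge0.
  rewrite normrM (ger0_norm (_ : 0 <= 2^-1 * A * B)) ?mulr_ge0//.
  apply: (@le_trans _ _ (2^-1 * A * B * `|w|)); last first.
    by rewrite ler_wpM2l ?expR_sinh_ge ?mulr_ge0.
  rewrite /w normrM (ger0_norm (_ : 0 <= (2 * (1 + s))^-1)); last first.
    by rewrite invr_ge0 mulr_ge0// ltW.
  rewrite [leRHS]mulrCA [leRHS]mulrC ler_wpM2r//.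
  have hA : Num.sqrt (2 * (1 + hi))^-1 <= A.
    by rewrite ler_wsqrtr// lef_pV2 ?posrE ?mulr_gt0//; lra.
  have hB : expR (- (4 * D ^+ 2 + 1) / 4) <= B.
    rewrite ler_expR !mulNr lerN2 ler_pdivrMr ?mulr_gt0//.
    have -> : (4 * D ^+ 2 + 1) / 4 * (4 * (1 + s)) = (4 * D ^+ 2 + 1) * (1 + s) by field.
    by have := sqr_ge0 D; nra.
  have hq : (2 * (1 + hi))^-1 <= (2 * (1 + s))^-1.
    by rewrite lef_pV2 ?posrE ?mulr_gt0//; lra.
  rewrite /c1 ler_pM ?mulr_ge0 ?expR_ge0 ?sqrtr_ge0 ?invr_ge0 ?mulr_ge0 ?(ltW hi1)//.
  by rewrite ler_pM ?mulr_ge0 ?expR_ge0 ?sqrtr_ge0// ler_wpM2l.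
(* the mean of the centred bump is [(2 (1 + s)) ^ (-1 / 2)], up to [O (x ^ 2)] *)
have [e2 [e2' [he2 he2' gap2]]] : exists e e', [/\ subject_mean m1 m2 s (bump m1') = e%:E,
    subject_mean m1' m2' s' (bump m1') = e'%:E & c2 * `|s - s'| <= `|e - e'| + 2 * D * `|x|].
  do 2 eexists; split; [exact: subject_mean_bump|exact: subject_mean_bump|].
  rewrite subrr expr0n/= oppr0 mul0r expR0 mulr1 -/x.
  have := @inv_sqrt_separation (1 + s) (1 + s') (1 + hi).
  rewrite opprD addrACA subrr add0r mulrC -/c2.
  rewrite !lerD2l shi s'hi !andbT ?lerDl !(ltW s0) !(ltW s'0) => /(_ isT isT).
  set A := Num.sqrt (2 * (1 + s))^-1; set A' := Num.sqrt _; set F := expR _.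
  move=> sep.
  have A0 : 0 <= A <= 1.
    rewrite sqrtr_ge0 -[leRHS]sqrtr1 ler_wsqrtr// invf_le1//; lra.
  have F1 : 1 - x ^+ 2 <= F <= 1.
    have q0 : 0 < 4 * (1 + s) by lra.
    have u : x ^+ 2 / (4 * (1 + s)) <= x ^+ 2.
      by rewrite ler_pdivrMr//; have := sqr_ge0 x; nra.
    have u0 : 0 <= x ^+ 2 / (4 * (1 + s)).
      by rewrite divr_ge0// ?sqr_ge0// ltW.
    rewrite /F mulNr; apply/andP; split; last by rewrite expR_le1; lra.
    by apply: le_trans (expR_ge1Dx _); lra.
  have tri : `|A - A'| <= `|A * F - A'| + `|A - A * F|.
    have -> : A - A' = (A * F - A') + (A - A * F) by ring.
    exact: ler_normD.
  have : `|A - A * F| <= x ^+ 2.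
    have -> : A - A * F = A * (1 - F) by ring.
    case/andP: A0 => A0 A1; case/andP: F1 => F1 F2.
    rewrite ger0_norm ?mulr_ge0 ?subr_ge0//; nra.
  lra.
(* the mean of the binary response depends on [m2] and on [s]; the effect of the
   latter is removed by comparison with the mean at [m2'] and [s] *)
have [e3 he3 _] := subject_mean_fin m1 m2 s0 (@measurable_success R) (@success01 R).
have [e3' he3' _] := subject_mean_fin m1' m2' s'0 (@measurable_success R) (@success01 R).
have gap3 : c3 * `|m2 - m2'| <= `|e3 - e3'| + `|s - s'| / lo.
  have [f hf _] := subject_mean_fin m1 m2' s0 (@measurable_success R) (@success01 R).
  have [f' hf' _] := subject_mean_fin m1' m2' s0 (@measurable_success R) (@success01 R).
  have ff' : f = f'.
    apply/EFin_inj; rewrite -hf -hf'; apply/eqP; rewrite eq_le; apply/andP; split.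
      apply: subject_mean_le_iter => [|||z|a]; try exact: measurable_success.
      - by move=> z; case/andP: (success01 z).
      - by case/andP: (success01 z).
      - by rewrite !integral_success_lik.
    apply: subject_mean_le_iter => [|||z|a]; try exact: measurable_success.
    - by move=> z; case/andP: (success01 z).
    - by case/andP: (success01 z).
    - by rewrite !integral_success_lik.
  rewrite -ff' in hf'.
  have lip := subject_mean_var_lipschitz lo0 los los' (@measurable_success R) (@success01 R) hf' he3'.
  have sc : Num.sqrt (1 + hi)^-1 <= Num.sqrt (1 + s)^-1.
    by rewrite ler_wsqrtr// lef_pV2 ?posrE//; lra.
  have E0 : 0 <= expR (- 3 * D - 9) / 4 by rewrite divr_ge0 ?expR_ge0.
  have main : c3 * `|m2 - m2'| <= `|e3 - f|.
    rewrite mulrC /c3 mulrA.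
    have [mm|/ltW mm] := leP m2 m2'.
      have := subject_mean_success_increase s0 m2D m2'D mm he3 hf.
      rewrite distrC (ger0_norm (_ : 0 <= m2' - m2)) ?subr_ge0// => H.
      rewrite distrC; apply: le_trans (ler_norm _); apply: le_trans H.
      by rewrite ler_wpM2l// mulr_ge0 ?subr_ge0.
    have := subject_mean_success_increase s0 m2'D m2D mm hf he3.
    rewrite (ger0_norm (_ : 0 <= m2 - m2')) ?subr_ge0// => H.
    apply: le_trans (ler_norm _); apply: le_trans H.
    by rewrite ler_wpM2l// mulr_ge0 ?subr_ge0.
  have -> : e3 - e3' = (e3 - f) - (e3' - f) by ring.
  have := lerB_dist (e3 - f) (e3' - f); rewrite (distrC e3' f); lra.
(* [G] will be the largest of the three gaps *)
have control G : `|e1 - e1'| <= G -> `|e2 - e2'| <= G -> `|e3 - e3'| <= G ->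
  [/\ `|x| <= (K1 + K2 + K3) * G, `|m2 - m2'| <= (K1 + K2 + K3) * G &
     `|s - s'| <= (K1 + K2 + K3) * G].
  move=> G1 G2 G3; have G0 : 0 <= G by exact: le_trans G1.
  have X : `|x| <= K1 * G by apply: (le_trans gap1); rewrite ler_wpM2l// ltW.
  have S : `|s - s'| <= K2 * G.
    rewrite /K2 mulrAC ler_pdivlMr// mulrC; apply: (le_trans gap2).
    have : D * `|x| <= D * (K1 * G) by rewrite ler_wpM2l.
    lra.
  have M : `|m2 - m2'| <= K3 * G.
    rewrite /K3 mulrAC ler_pdivlMr// mulrC; apply: (le_trans gap3).
    have : `|s - s'| / lo <= K2 * G / lo by rewrite ler_wpM2r// invr_ge0 ltW.
    have -> : (1 + K2 / lo) * G = G + K2 * G / lo by ring.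
    lra.
  have p1 : 0 <= K1 * G by rewrite mulr_ge0// ltW.
  have p2 : 0 <= K2 * G by rewrite mulr_ge0// ltW.
  have p3 : 0 <= K3 * G by rewrite mulr_ge0// ltW.
  by split; rewrite !mulrDl; lra.
have mb' := @measurable_bump R; have msu := @measurable_success R.
have su01 := @success01 R.
have [G12|/ltW G12] := leP `|e1 - e1'| `|e2 - e2'|.
  have [G23|/ltW G23] := leP `|e2 - e2'| `|e3 - e3'|.
    exists (@success R), e3, e3'; split => //.
    by apply: control => //; exact: le_trans G23.
  exists (bump m1'), e2, e2'; split => //.
  by apply: control.
have [G13|/ltW G13] := leP `|e1 - e1'| `|e3 - e3'|.
  exists (@success R), e3, e3'; split => //.
  by apply: control => //; exact: le_trans G13.
exists h1, e1, e1'; split => //.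
by apply: control.
Qed.

End separation.

(** * Envelopes of the joint density *)

Section effects_integral.
Context (R : realType).
Notation leb := (@lebesgue_measure R).
Implicit Types (s C : R).

Lemma integral_gauss0 s : 0 < s -> (\int[leb]_v (gauss s v)%:E = 1)%E.
Proof.
by move=> s0; have := integral_gauss 0 s0; under eq_integral do rewrite subr0.
Qed.

(** On the diagonal subject [i] meets the effects [u_i] and [u_(N + i)] only,
    so that the integral over all effects factorizes. *)
Lemma integral_effects_prod N (A : 'I_N -> R -> R) s C (e : 'I_N -> R) : 0 < s ->
  (forall i, measurable_fun [set: measurableTypeR R] (A i)) ->
  (forall i a, 0 <= A i a <= C) ->
  (forall i, \int[leb]_u \int[leb]_v (A i (u + v) * (gauss s u * gauss s v))%:E = (e i)%:E)%E ->
  (\int[power_measure leb (N + N)]_u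
     ((\prod_i A i (tnth u (lshift N i) + tnth u (rshift N i))) *
      \prod_k gauss s (tnth u k))%:E = (\prod_i e i)%:E)%E.
Proof.
move=> s0 mA A0C Ae.
have A0 i a : 0 <= A i a by case/andP: (A0C i a).
have g0 := @gauss_ge0 R s.
have mg := @measurable_gauss R s.
have mtn n (k : 'I_n) : measurable_fun [set: n.-tuple (measurableTypeR R)] (fun t => tnth t k : R).
  exact: measurable_tnth.
rewrite (@integral_power_measureD _ _ _ _ N N); last 2 first.
- apply/measurable_EFinP; apply: measurable_funM.
    apply: measurable_prod => i _; apply: (measurableT_comp (mA i)).
    by apply: measurable_funD; exact: mtn.
  exact: (measurable_prod_tnth (g := fun=> gauss s)).
- by move=> t; rewrite lee_fin mulr_ge0 ?prodr_ge0.
have mAg i : measurable_fun setT (fun q : measurableTypeR R * measurableTypeR R =>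
    (A i (q.1 + q.2) * (gauss s q.1 * gauss s q.2))%:E).
  apply/measurable_EFinP; apply: measurable_funM.
    by apply: (measurableT_comp (mA i)); exact: measurable_funD.
  by apply: measurable_funM; exact: (measurableT_comp mg).
have Ag0 i (u v : R) : (0 <= (A i (u + v) * (gauss s u * gauss s v))%:E)%E.
  by rewrite lee_fin !mulr_ge0.
pose B i u := fine (\int[leb]_v (A i (u + v) * (gauss s u * gauss s v))%:E)%E.
have Bfin i u : (\int[leb]_v (A i (u + v) * (gauss s u * gauss s v))%:E = (B i u)%:E)%E.
  rewrite fineK// ge0_fin_numE; last by apply: integral_ge0 => v _; exact: Ag0.
  apply: (@le_lt_trans _ _ (\int[leb]_v ((C * gauss s u)%:E * (gauss s v)%:E))%E).
    apply: ge0_le_integral => //.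
    - exact: (measurableT_comp (mAg i) (pair1_measurable (u : measurableTypeR R))).
    - by apply: measurable_funeM; apply/measurable_EFinP.
    - move=> v _; rewrite -EFinM lee_fin mulrA ler_wpM2r// ler_wpM2r//.
      by case/andP: (A0C i (u + v)).
  rewrite ge0_integralZl//.
  - by rewrite integral_gauss0// mule1 ltry.
  - by apply/measurable_EFinP.
  - by move=> v _; rewrite lee_fin.
  - by rewrite lee_fin mulr_ge0// (le_trans (A0 i 0)); case/andP: (A0C i 0).
transitivity (\int[power_measure leb N]_a (\prod_i B i (tnth a i))%:E)%E.
  apply: eq_integral => a _.
  rewrite (eq_integral (fun b : N.-tuple (measurableTypeR R) =>
     (\prod_i (A i (tnth a i + tnth b i) * (gauss s (tnth a i) * gauss s (tnth b i))))%:E)); last first.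
    move=> b _; congr _%:E; rewrite big_split/=; congr (_ * _).
      by apply: eq_bigr => i _; rewrite tnth_lshift tnth_rshift.
    rewrite big_split_ord/= big_split/=.
    by congr (_ * _); apply: eq_bigr => i _; rewrite ?tnth_lshift ?tnth_rshift.
  apply: (@integral_power_measure_prod _ _ R leb N (fun i v =>
    A i (tnth a i + v) * (gauss s (tnth a i) * gauss s v))
    (fun i => B i (tnth a i))) => //.
  - move=> i; apply/measurable_EFinP.
    exact: (measurableT_comp (mAg i) (pair1_measurable (tnth a i))).
  - by move=> i v; rewrite -lee_fin; exact: Ag0.
apply: (@integral_power_measure_prod _ _ R leb N B e).
- move=> i; apply/measurable_EFinP; rewrite (_ : _ \o _ = fubini_F leb
    (fun q : measurableTypeR R * measurableTypeR R =>
    (A i (q.1 + q.2) * (gauss s q.1 * gauss s q.2))%:E)); last first.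
    by apply/funext => u /=; rewrite -Bfin.
  by apply: measurable_fun_fubini_tonelli_F => //; move=> q; exact: Ag0.
- move=> i u; rewrite -lee_fin -Bfin; apply: integral_ge0 => v _; exact: Ag0.
- move=> i; rewrite -Ae; apply: eq_integral => u _; exact/esym/Bfin.
Qed.

End effects_integral.

Section envelope.
Context (R : realType).
Notation leb := (@lebesgue_measure R).
Notation response := (measurableTypeR R * bool)%type.
Notation nu := (product_measure leb (@counting bool R)).
Implicit Types (m s e : R) (z : response) (h psi : response -> R).

(** Upper envelope of the conditional densities [lik m1' m2'] with predictors
    within [e] of [m1] and [m2]. *)
Definition env_lik e m1 m2 z : R :=
  gauss_env e (z.1 - m1) * (expR e * logit_pmf m2 z.2).

Lemma env_lik_ge0 e m1 m2 z : 0 <= env_lik e m1 m2 z.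
Proof.
by rewrite mulr_ge0 ?gauss_env_ge0// mulr_ge0 ?expR_ge0 ?logit_pmf_ge0.
Qed.

Lemma env_lik0 m1 m2 z : env_lik 0 m1 m2 z = lik m1 m2 z.
Proof. by rewrite /env_lik gauss_env0 expR0 mul1r. Qed.

Lemma lik_le_env e m1 m2 m1' m2' z : e < 1 ->
  `|m1 - m1'| <= e -> `|m2' - m2| <= e -> lik m1' m2' z <= env_lik e m1 m2 z.
Proof.
move=> e1 m1e m2e; have e0 : 0 <= e by exact: le_trans m1e.
rewrite ler_pM ?gauss_ge0 ?logit_pmf_ge0//.
  have -> : z.1 - m1' = (z.1 - m1) + (m1 - m1') by ring.
  exact: gauss_le_env.
have -> : m2' = m2 + (m2' - m2) by ring.
apply: (le_trans (logit_pmf_le_expR _ _ _)).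
by rewrite ler_wpM2r ?logit_pmf_ge0// ler_expR.
Qed.

Lemma measurable_env_lik e d (T : measurableType d) (f1 f2 : T -> R) (g : T -> response) :
  measurable_fun setT f1 -> measurable_fun setT f2 -> measurable_fun setT g ->
  measurable_fun setT (fun t => env_lik e (f1 t) (f2 t) (g t)).
Proof.
move=> mf1 mf2 mg; apply: measurable_funM.
  apply: measurableT_comp; first exact: measurable_gauss_env.
  by apply: measurable_funB => //; apply: measurableT_comp => //.
apply: measurable_funM => //.
by apply: measurable_logit_pmf => //; exact: measurableT_comp.
Qed.

Lemma env_lik_mass e : 0 <= e -> e <= 2^-1 -> exists2 M,
  (forall m1 m2, \int[nu]_z (env_lik e m1 m2 z)%:E = M%:E)%E &
  1 <= M <= expR (3 * e).
Proof.
move=> e0 e2; have [M HM /andP[M1 Me]] := gauss_env_mass e0 e2.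
exists (M * expR e).
  move=> m1 m2; under eq_integral do rewrite /env_lik mulrA.
  rewrite (integral_logit_response m2 (g := fun y => gauss_env e (y - m1) * expR e)).
  - under eq_integral do rewrite EFinM.
    rewrite ge0_integralZr//.
    + by rewrite HM EFinM.
    + apply/measurable_EFinP; apply: measurableT_comp; first exact: measurable_gauss_env.
      exact: measurable_funB.
    + by move=> y _; rewrite lee_fin gauss_env_ge0.
  - apply: measurable_funM => //.
    apply: measurableT_comp; first exact: measurable_gauss_env.
    exact: measurable_funB.
  - by move=> y; rewrite mulr_ge0 ?gauss_env_ge0 ?expR_ge0.
have E1 : 1 <= expR e by rewrite -expR0 ler_expR.
rewrite -[X in X <= _ <= _]mulr1 ler_pM//=.
by rewrite (_ : 3 * e = 2 * e + e) ?expRD ?ler_wpM2r ?expR_ge0//; ring.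
Qed.

Definition lik_mean psi m1 m2 : R := fine (\int[nu]_z (psi z * lik m1 m2 z)%:E)%E.

Section test_function.
Variable psi : response -> R.
Hypothesis mpsi : measurable_fun setT psi.
Hypothesis psi2 : forall z, 2^-1 <= psi z <= 2.

Let psi0 z : 0 <= psi z. Proof. by case/andP: (psi2 z) => /(le_trans _) ->. Qed.

Let mlik m1 m2 : measurable_fun setT (fun z => (psi z * lik m1 m2 z)%:E).
Proof. by apply/measurable_EFinP; apply: measurable_funM => //; exact: measurable_lik. Qed.

Lemma lik_meanE m1 m2 :
  (\int[nu]_z (psi z * lik m1 m2 z)%:E = (lik_mean psi m1 m2)%:E)%E.
Proof.
rewrite fineK// ge0_fin_numE; last first.
  by apply: integral_ge0 => z _; rewrite lee_fin mulr_ge0 ?lik_ge0.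
apply: (@le_lt_trans _ _ (\int[nu]_z (2%:E * (lik m1 m2 z)%:E))%E).
  apply: ge0_le_integral => //.
  - by move=> z _; rewrite lee_fin mulr_ge0 ?lik_ge0.
  - by apply: measurable_funeM; apply/measurable_EFinP; exact: measurable_lik.
  - move=> z _; rewrite -EFinM lee_fin ler_wpM2r ?lik_ge0//.
    by case/andP: (psi2 z).
rewrite ge0_integralZl//.
- by rewrite integral_lik mule1 ltry.
- by apply/measurable_EFinP; exact: measurable_lik.
- by move=> z _; rewrite lee_fin lik_ge0.
Qed.

Lemma lik_mean_bounds m1 m2 : 2^-1 <= lik_mean psi m1 m2 <= 2.
Proof.
have cst c : 0 <= c -> (\int[nu]_z (c * lik m1 m2 z)%:E = c%:E)%E.
  move=> c0; under eq_integral do rewrite EFinM.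
  rewrite ge0_integralZl//.
  - by rewrite integral_lik mule1.
  - by apply/measurable_EFinP; exact: measurable_lik.
  - by move=> z _; rewrite lee_fin lik_ge0.
rewrite -!lee_fin -lik_meanE -(cst 2^-1)// -(cst 2)//; apply/andP; split.
- apply: ge0_le_integral => //.
  + by move=> z _; rewrite lee_fin mulr_ge0 ?lik_ge0.
  + apply/measurable_EFinP; apply: measurable_funM => //; exact: measurable_lik.
  + by move=> z _; rewrite lee_fin ler_wpM2r ?lik_ge0//; case/andP: (psi2 z).
- apply: ge0_le_integral => //.
  + by move=> z _; rewrite lee_fin mulr_ge0 ?lik_ge0.
  + apply/measurable_EFinP; apply: measurable_funM => //; exact: measurable_lik.
  + by move=> z _; rewrite lee_fin ler_wpM2r ?lik_ge0//; case/andP: (psi2 z).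
Qed.

Lemma measurable_lik_mean m1 m2 :
  measurable_fun [set: measurableTypeR R] (fun a => lik_mean psi (m1 + a) (m2 + a)).
Proof.
apply/measurable_EFinP.
pose f (q : measurableTypeR R * response) := (psi q.2 * lik (m1 + q.1) (m2 + q.1) q.2)%:E.
rewrite (_ : _ \o _ = fubini_F nu f); last first.
  by apply/funext => a /=; rewrite -lik_meanE.
apply: measurable_fun_fubini_tonelli_F.
- apply/measurable_EFinP; apply: measurable_funM; first exact: measurableT_comp.
  by apply: measurable_likT => //; exact: measurable_funD.
- by move=> q; rewrite lee_fin mulr_ge0 ?lik_ge0.
Qed.

(** The envelope exceeds [lik] by a small mass, on which [psi] is at most [2]. *)
Lemma env_lik_test e m1 m2 : 0 <= e -> e <= 2^-1 -> exists2 I,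
  (\int[nu]_z (psi z * env_lik e m1 m2 z)%:E = I%:E)%E &
  0 <= I <= expR (9 * e) * lik_mean psi m1 m2.
Proof.
move=> e0 e2; have [M HM /andP[M1 Me]] := gauss_env_mass e0 e2.
have e1 : e < 1 by lra.
pose f y := gauss_env e (y - m1) - gauss 1 (y - m1).
have f0 y : 0 <= f y.
  by rewrite subr_ge0 -[X in gauss 1 X]addr0 gauss_le_env// normr0.
have mge : measurable_fun [set: measurableTypeR R] (fun y => gauss_env e (y - m1)).
  apply: measurableT_comp; first exact: measurable_gauss_env.
  exact: measurable_funB.
have mg1 : measurable_fun [set: measurableTypeR R] (fun y => gauss 1 (y - m1)).
  apply: measurableT_comp; first exact: measurable_gauss.
  exact: measurable_funB.
have mf : measurable_fun [set: measurableTypeR R] f by exact: measurable_funB.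
have intf : (\int[leb]_y (f y)%:E = (M - 1)%:E)%E.
  have : (\int[leb]_y (gauss_env e (y - m1))%:E =
      \int[leb]_y (gauss 1 (y - m1))%:E + \int[leb]_y (f y)%:E)%E.
    rewrite -ge0_integralD//.
    - by apply: eq_integral => y _; rewrite -EFinD; congr _%:E; rewrite /f; ring.
    - by move=> y _; rewrite lee_fin gauss_ge0.
    - exact/measurable_EFinP.
    - by move=> y _; rewrite lee_fin.
    - exact/measurable_EFinP.
  rewrite HM integral_gauss// => /esym/eqP.
  rewrite addeC eq_sym -sube_eq ?fin_num_adde_defl//.
  by rewrite -EFinB => /eqP.
have mel : measurable_fun setT (env_lik e m1 m2).
  exact: (@measurable_env_lik e _ _ (fun=> m1) (fun=> m2) id).
have mfl : measurable_fun [set: response] (fun z => f z.1 * logit_pmf m2 z.2).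
  apply: measurable_funM; first exact: measurableT_comp.
  by apply: measurable_logit_pmf => //; exact: measurableT_comp.
have main : (\int[nu]_z (psi z * env_lik e m1 m2 z)%:E <=
   (expR e * (lik_mean psi m1 m2 + 2 * (M - 1)))%:E)%E.
  have -> : ((expR e * (lik_mean psi m1 m2 + 2 * (M - 1)))%:E =
     \int[nu]_z ((expR e)%:E * ((psi z * lik m1 m2 z)%:E +
        2%:E * (f z.1 * logit_pmf m2 z.2)%:E)))%E.
    rewrite ge0_integralZl//; last 2 first.
    - apply: emeasurable_funD => //; apply: measurable_funeM.
      exact/measurable_EFinP.
    - move=> z _; rewrite -EFinM -EFinD lee_fin addr_ge0//.
        by rewrite mulr_ge0 ?lik_ge0.
      by rewrite mulr_ge0// mulr_ge0 ?logit_pmf_ge0.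
    rewrite ge0_integralD//; last 3 first.
    - by move=> z _; rewrite lee_fin mulr_ge0 ?lik_ge0.
    - by move=> z _; rewrite -EFinM lee_fin mulr_ge0// mulr_ge0 ?logit_pmf_ge0.
    - by apply: measurable_funeM; exact/measurable_EFinP.
    rewrite ge0_integralZl//; last 2 first.
    - exact/measurable_EFinP.
    - by move=> z _; rewrite lee_fin mulr_ge0 ?logit_pmf_ge0.
    by rewrite (integral_logit_response m2 mf f0) intf lik_meanE.
  apply: ge0_le_integral => //.
  - by move=> z _; rewrite lee_fin mulr_ge0 ?env_lik_ge0.
  - by apply/measurable_EFinP; exact: measurable_funM.
  - apply: measurable_funeM; apply: emeasurable_funD => //; apply: measurable_funeM.
    exact/measurable_EFinP.
  - move=> z _; rewrite -[leRHS]/((expR e * (psi z * lik m1 m2 z +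
      2 * (f z.1 * logit_pmf m2 z.2)))%:E) lee_fin.
    have -> : psi z * env_lik e m1 m2 z =
       expR e * (psi z * lik m1 m2 z + psi z * (f z.1 * logit_pmf m2 z.2)).
      by rewrite /env_lik /lik /f; ring.
    rewrite ler_wpM2l ?expR_ge0// lerD2l ler_wpM2r ?mulr_ge0 ?logit_pmf_ge0//.
    by case/andP: (psi2 z).
have int0 : (0 <= \int[nu]_z (psi z * env_lik e m1 m2 z)%:E)%E.
  by apply: integral_ge0 => z _; rewrite lee_fin mulr_ge0 ?env_lik_ge0.
have fin : (\int[nu]_z (psi z * env_lik e m1 m2 z)%:E)%E \is a fin_num.
  by rewrite ge0_fin_numE// (le_lt_trans main)// ltry.
exists (fine (\int[nu]_z (psi z * env_lik e m1 m2 z)%:E)%E); first by rewrite fineK.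
rewrite -!lee_fin fineK// int0/=; apply: (le_trans main); rewrite lee_fin.
have /andP[a2 _] := lik_mean_bounds m1 m2.
(* [1 + 4 (M - 1) <= M ^ 4], where the mass [M] is at most [exp (2 e)] *)
have -> : 9 * e = e + 4%:R * (2 * e) by ring.
rewrite expRD expRM_natl -mulrA ler_wpM2l ?expR_ge0//.
have a0 : 0 <= lik_mean psi m1 m2 by lra.
apply: (@le_trans _ _ (M ^+ 4 * lik_mean psi m1 m2)); last first.
  rewrite ler_wpM2r// lerXn2r// nnegrE ?expR_ge0//; lra.
have M4 : 1 + 4 * (M - 1) <= M ^+ 4.
  have -> : M ^+ 4 = (1 + (M - 1)) ^+ 4 by congr (_ ^+ _); ring.
  have : 0 <= M - 1 by lra.
  move: (M - 1) => t t0.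
  have -> : (1 + t) ^+ 4 = 1 + 4 * t + (6 * t ^+ 2 + 4 * t ^+ 3 + t ^+ 4) by ring.
  by rewrite lerDl !addr_ge0 ?mulr_ge0 ?exprn_ge0.
apply: (@le_trans _ _ ((1 + 4 * (M - 1)) * lik_mean psi m1 m2)).
  nra.
by rewrite ler_wpM2r.
Qed.

End test_function.
End envelope.

Section joint_density.
Context (R : realType) (N : nat).
Notation leb := (@lebesgue_measure R).
Notation response := (measurableTypeR R * bool)%type.
Notation nu := (product_measure leb (@counting bool R)).
Implicit Types (e s : R) (y : observation R N) (u : effects R N).

Definition pair_effect u (i j : 'I_N) : R := tnth u (lshift N i) + tnth u (rshift N j).

Section fixed_predictors.
Variables mu1 mu2 : 'I_N -> 'I_N -> R.

(** Joint density of responses and random effects with fixed linear predictors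
    [mu1], [mu2] and variance component [s], each conditional density being
    replaced by its envelope of radius [e]. *)
Definition joint_env e s y u : R :=
  (\prod_i \prod_j env_lik e (mu1 i j + pair_effect u i j) (mu2 i j + pair_effect u i j)
     (tnth (tnth y i) j)) * \prod_k gauss s (tnth u k).

Lemma joint_env_ge0 e s y u : 0 <= joint_env e s y u.
Proof.
rewrite mulr_ge0// prodr_ge0// => i _; last exact: gauss_ge0.
by rewrite prodr_ge0// => j _; exact: env_lik_ge0.
Qed.

Lemma measurable_response d (T : measurableType d) (f : T -> observation R N) i j :
  measurable_fun setT f -> measurable_fun setT (fun t => tnth (tnth (f t) i) j).
Proof.
move=> mf.
have m1 : measurable_fun setT (fun t => tnth (f t) i).
  exact: (measurableT_comp (measurable_tnth i) mf).
exact: (measurableT_comp (measurable_tnth j) m1).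
Qed.

Lemma measurable_effect d (T : measurableType d) (f : T -> effects R N) k :
  measurable_fun setT f -> measurable_fun setT (fun t => tnth (f t) k : R).
Proof. by move=> mf; exact: (measurableT_comp (measurable_tnth k) mf). Qed.

Lemma measurable_joint_env e s d (T : measurableType d)
    (f : T -> observation R N) (g : T -> effects R N) :
  measurable_fun setT f -> measurable_fun setT g ->
  measurable_fun setT (fun t => joint_env e s (f t) (g t)).
Proof.
move=> mf mg; apply: measurable_funM.
  apply: measurable_prod => i _; apply: measurable_prod => j _.
  have mo : measurable_fun setT (fun t => pair_effect (g t) i j).
    by apply: measurable_funD; exact: measurable_effect.
  apply: measurable_env_lik.
  - exact: measurable_funD.
  - exact: measurable_funD.
  - exact: measurable_response.
apply: measurable_prod => k _; apply: measurableT_comp; first exact: measurable_gauss.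
exact: measurable_effect.
Qed.

Lemma integral_observation_prod (f : 'I_N -> 'I_N -> response -> R) (I : 'I_N -> 'I_N -> R) :
  (forall i j, measurable_fun setT (f i j)) -> (forall i j z, 0 <= f i j z) ->
  (forall i j, \int[nu]_z (f i j z)%:E = (I i j)%:E)%E ->
  (\int[observation_measure R N]_y (\prod_i \prod_j f i j (tnth (tnth y i) j))%:E =
   (\prod_i \prod_j I i j)%:E)%E.
Proof.
move=> mf f0 fI.
apply: (@integral_power_measure_prod _ _ R (power_measure nu N) N
  (fun i row => \prod_j f i j (tnth row j)) (fun i => \prod_j I i j)).
- move=> i; exact: measurable_prod_tnth.
- by move=> i row; rewrite prodr_ge0.
- move=> i; exact: (@integral_power_measure_prod _ _ R nu N (f i) (I i) (mf i) (f0 i) (fI i)).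
Qed.

(** Given the effects, the subjects are independent: those off the diagonal contribute
    the mass of their envelope, those on the diagonal the conditional mean of their
    statistic.  Distinct diagonal subjects meet distinct effects, hence the product. *)
Lemma integral_joint_env_test e s (psi : 'I_N -> response -> R) (c : 'I_N -> R) :
  0 <= e -> e <= 2^-1 -> 0 < s ->
  (forall i, measurable_fun setT (psi i)) -> (forall i z, 2^-1 <= psi i z <= 2) ->
  (forall i, subject_mean (mu1 i i) (mu2 i i) s (psi i) = (c i)%:E) ->
  (\int[observation_measure R N]_y ((\prod_i psi i (tnth (tnth y i) i))%:E *
      \int[power_measure leb (N + N)]_u (joint_env e s y u)%:E) <=
   (expR (9 * e) ^+ (N * N) * \prod_i c i)%:E)%E.
Proof.
move=> e0 e2 s0 mpsi psi2 psic.
have psi0 i z : 0 <= psi i z by case/andP: (psi2 i z) => /(le_trans _) ->.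
have [M HM /andP[M1 Me]] := env_lik_mass e0 e2.
pose A i a := lik_mean (psi i) (mu1 i i + a) (mu2 i i + a).
have A2 i a : 0 <= A i a <= 2.
  by have := lik_mean_bounds (mpsi i) (psi2 i) (mu1 i i + a) (mu2 i i + a); rewrite -/(A i a); lra.
have mA i : measurable_fun [set: measurableTypeR R] (A i).
  exact: (measurable_lik_mean (mpsi i) (psi2 i)).
pose Psi y := \prod_i psi i (tnth (tnth y i) i).
have mPsi d (T : measurableType d) (f : T -> observation R N) :
    measurable_fun setT f -> measurable_fun setT (fun t => Psi (f t)).
  move=> mf; apply: measurable_prod => i _; apply: (measurableT_comp (mpsi i)).
  exact: measurable_response.
have Psi0 y : 0 <= Psi y by rewrite prodr_ge0.
pose F (q : observation R N * effects R N) := (Psi q.1 * joint_env e s q.1 q.2)%:E.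
have mF : measurable_fun setT F.
  apply/measurable_EFinP; apply: measurable_funM; first exact: mPsi.
  exact: measurable_joint_env.
have F0 q : (0 <= F q)%E by rewrite lee_fin mulr_ge0 ?joint_env_ge0.
have -> : (\int[observation_measure R N]_y ((Psi y)%:E *
      \int[power_measure leb (N + N)]_u (joint_env e s y u)%:E) =
    \int[observation_measure R N]_y \int[power_measure leb (N + N)]_u F (y, u))%E.
  apply: eq_integral => y _; rewrite -ge0_integralZl//.
  - by apply/measurable_EFinP; exact: measurable_joint_env.
  - by move=> u _; rewrite lee_fin joint_env_ge0.
  - by rewrite lee_fin Psi0.
rewrite fubini_tonelli//.
pose D (u : effects R N) := ((expR (9 * e) ^+ (N * N))%:E *
  ((\prod_i A i (tnth u (lshift N i) + tnth u (rshift N i))) *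
      \prod_k gauss s (tnth u k))%:E)%E.
have mu_ : measurable_fun [set: effects R N] id by exact: measurable_id.
have mD : measurable_fun setT (fun u : effects R N =>
    ((\prod_i A i (tnth u (lshift N i) + tnth u (rshift N i))) *
      \prod_k gauss s (tnth u k))%:E).
  apply/measurable_EFinP; apply: measurable_funM.
    apply: measurable_prod => i _; apply: (measurableT_comp (mA i)).
    by apply: measurable_funD; exact: (measurable_effect _ mu_).
  apply: measurable_prod => k _; apply: measurableT_comp; first exact: measurable_gauss.
  exact: (measurable_effect _ mu_).
have D0 u : 0 <= (\prod_i A i (tnth u (lshift N i) + tnth u (rshift N i))) *
      \prod_k gauss s (tnth u k).
  rewrite mulr_ge0 ?prodr_ge0// => i _; last exact: gauss_ge0.
  by case/andP: (A2 i (tnth u (lshift N i) + tnth u (rshift N i))).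
apply: (@le_trans _ _ (\int[power_measure leb (N + N)]_u D u)%E); last first.
  rewrite ge0_integralZl//; last first.
    by move=> u _; rewrite lee_fin D0.
  rewrite (@integral_effects_prod _ N A s 2 c s0 mA A2) -?EFinM//.
  move=> i; rewrite -psic; apply/esym/subject_mean_iter => //.
  by move=> a; exact: lik_meanE.
apply: ge0_le_integral.
- exact: measurableT.
- by move=> u _; apply: integral_ge0.
- exact: measurable_fun_fubini_tonelli_G.
- exact: measurable_funeM.
move=> u _.
pose G := \prod_k gauss s (tnth u k).
have G0 : 0 <= G by rewrite prodr_ge0// => k _; exact: gauss_ge0.
pose f i j z := (if j == i then psi i z else 1) *
  env_lik e (mu1 i j + pair_effect u i j) (mu2 i j + pair_effect u i j) z.
have prodf y : F (y, u) = (G%:E * (\prod_i \prod_j f i j (tnth (tnth y i) j))%:E)%E.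
  rewrite -EFinM /F/= /joint_env -/G; congr _%:E.
  have -> : \prod_i \prod_j f i j (tnth (tnth y i) j) =
    Psi y * \prod_i \prod_j env_lik e (mu1 i j + pair_effect u i j) (mu2 i j + pair_effect u i j)
     (tnth (tnth y i) j).
    rewrite /Psi -big_split/=; apply: eq_bigr => i _.
    rewrite big_split/=; congr (_ * _).
    by rewrite -big_mkcond big_pred1_eq.
  by ring.
have mf i j : measurable_fun setT (f i j).
  apply: measurable_funM; first by case: eqP.
  exact: (@measurable_env_lik _ e _ _ (fun=> _) (fun=> _) id).
have f0 i j z : 0 <= f i j z.
  by rewrite mulr_ge0 ?env_lik_ge0//; case: ifP.
have fI i j : exists I, (\int[nu]_z (f i j z)%:E = I%:E)%E /\
    0 <= I <= expR (9 * e) * (if j == i then A i (pair_effect u i i) else 1).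
  rewrite /f; case: eqP => [->|_].
    by have [I -> ?] := env_lik_test (mpsi i) (psi2 i) (mu1 i i + pair_effect u i i)
      (mu2 i i + pair_effect u i i) e0 e2; exists I.
  exists M; split.
    rewrite -(HM (mu1 i j + pair_effect u i j) (mu2 i j + pair_effect u i j)).
    by apply: eq_integral => z _; rewrite mul1r.
  rewrite mulr1 (le_trans ler01 M1)/= (le_trans Me)// ler_expR; lra.
have [I0 I0f] := choice (fun q : 'I_N * 'I_N => fI q.1 q.2).
pose I i j := I0 (i, j).
have II i j : 0 <= I i j <= expR (9 * e) * (if j == i then A i (pair_effect u i i) else 1).
  by case: (I0f (i, j)).
have intF : (\int[observation_measure R N]_y F (y, u) = (G * \prod_i \prod_j I i j)%:E)%E.
  under eq_integral do rewrite prodf.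
  rewrite ge0_integralZl//; last 2 first.
  - apply/measurable_EFinP; apply: measurable_prod => i _; apply: measurable_prod => j _.
    by apply: (measurableT_comp (mf i j)); exact: measurable_response.
  - by move=> y _; rewrite lee_fin prodr_ge0// => i _; rewrite prodr_ge0.
  rewrite (@integral_observation_prod f I)// => i j.
  by case: (I0f (i, j)).
rewrite intF /D -EFinM lee_fin -/G [leRHS]mulrA [leRHS]mulrC ler_wpM2l//.
apply: (@le_trans _ _ (\prod_i \prod_j
   (expR (9 * e) * (if j == i then A i (pair_effect u i i) else 1)))).
  apply: ler_prod => i _; rewrite prodr_ge0/=; last first.
    by move=> j _; case/andP: (II i j).
  by apply: ler_prod => j _.
under eq_bigr => i _.
  rewrite big_split/= prodr_const card_ord -big_mkcond big_pred1_eq.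
  over.
by rewrite /= big_split/= prodr_const card_ord exprM.
Qed.

End fixed_predictors.
End joint_density.

(** * The exponential test *)

Section likelihood_test.
Context (R : realType) (N : nat).
Notation leb := (@lebesgue_measure R).
Notation response := (measurableTypeR R * bool)%type.
Implicit Types (e s C : R) (y : observation R N) (u : effects R N).

Definition marginal_env (mu1 mu2 : 'I_N -> 'I_N -> R) e s y : \bar R :=
  (\int[power_measure leb (N + N)]_u (joint_env mu1 mu2 e s y u)%:E)%E.

Lemma marginal_env_ge0 mu1 mu2 e s y : (0 <= marginal_env mu1 mu2 e s y)%E.
Proof. by apply: integral_ge0 => u _; rewrite lee_fin joint_env_ge0. Qed.

Lemma measurable_marginal_env mu1 mu2 e s :
  measurable_fun setT (marginal_env mu1 mu2 e s).
Proof.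
apply: (measurable_fun_fubini_tonelli_F (m2 := power_measure leb (N + N))
  (fun q : observation R N * effects R N => (joint_env mu1 mu2 e s q.1 q.2)%:E)).
  by apply/measurable_EFinP; exact: measurable_joint_env.
by move=> q; rewrite lee_fin joint_env_ge0.
Qed.

(** One factor of the exponential test: tilting by a statistic [h] in
    [[0, 1]], centred at the midpoint of its two means, by one eighth of their
    difference [e - e']. *)
Lemma subject_tilt (m1 m2 s : R) (h : response -> R) (e e' : R) : 0 < s ->
  measurable_fun setT h -> (forall z, 0 <= h z <= 1) ->
  0 <= e <= 1 -> 0 <= e' <= 1 ->
  subject_mean m1 m2 s h = e%:E ->
  exists c, subject_mean m1 m2 s
      (fun z => expR (- ((e - e') / 8 * (h z - (e + e') / 2)))) = c%:E /\
    0 <= c <= expR (- ((e - e') ^+ 2 / 32)).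
Proof.
move=> s0 mh h01 /andP[e0 e1] /andP[e'0 e'1] he.
have := @subject_mean_mgf _ m1 m2 s h e ((e + e') / 2) (- ((e - e') / 8)) s0 mh h01 he.
have t01 : 0 <= (e + e') / 2 <= 1 by lra.
have c2 : `|- ((e - e') / 8)| <= 2^-1.
  by rewrite normrN ler_norml; apply/andP; split; lra.
move=> /(_ t01 c2).
have -> : - ((e - e') / 8) * (e - (e + e') / 2) + 2 * (- ((e - e') / 8)) ^+ 2 =
   - ((e - e') ^+ 2 / 32) by field.
under [X in subject_mean _ _ _ X]eq_fun do rewrite mulNr.
set sm := subject_mean _ _ _ _ => H.
have sm0 : (0 <= sm)%E.
  apply: integral_ge0 => t _.
  by rewrite lee_fin mulr_ge0 ?expR_ge0 ?subject_density_ge0.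
have fin : sm \is a fin_num by rewrite ge0_fin_numE// (le_lt_trans H)// ltry.
exists (fine sm); split; first by rewrite fineK.
by rewrite -!lee_fin fineK// sm0.
Qed.

Lemma expR_tilt_bounds (e e' a : R) : 0 <= e <= 1 -> 0 <= e' <= 1 -> 0 <= a <= 1 ->
  2^-1 <= expR (- ((e - e') / 8 * (a - (e + e') / 2))) <= 2.
Proof.
move=> /andP[e0 e1] /andP[e'0 e'1] /andP[a0 a1].
set w := _ * _.
have w8 : `|w| <= 8^-1.
  rewrite normrM -[leRHS]mulr1 ler_pM//.
    by rewrite ler_norml; apply/andP; split; lra.
  by rewrite ler_norml; apply/andP; split; lra.
have [w1 w2] := ler_normlP _ _ w8.
apply/andP; split.
  by apply: le_trans (expR_ge1Dx _); lra.
apply: (le_trans (expR_le_quadratic _)); first by lra.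
rewrite sqrrN -(real_normK (num_real w)); have := normr_ge0 w; nra.
Qed.

(** Let [F] and [G] be the two marginal functions and [Psi] the product over the diagonal
    of the tilts. On the event [F <= C G], [F] is at most [F / Psi] where [Psi <= 1], and at
    most [C G Psi] where [Psi >= 1]. Both bounds have an exponentially small integral, the
    first one because [1 / Psi] is the product of the opposite tilts. *)
Lemma likelihood_ratio_test (mu1 mu2 nu1 nu2 : 'I_N -> 'I_N -> R) e s s0 C
    (q : 'I_N -> R) :
  0 <= e -> e <= 2^-1 -> 0 < s -> 0 < s0 -> 0 <= C ->
  (forall i, exists h : response -> R, exists a a', [/\ measurable_fun setT h,
    forall z, 0 <= h z <= 1, subject_mean (mu1 i i) (mu2 i i) s h = a%:E,
    subject_mean (nu1 i i) (nu2 i i) s0 h = a'%:E & q i <= (a - a') ^+ 2]) ->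
  (\int[observation_measure R N]_(y in
      [set y | marginal_env nu1 nu2 0 s0 y <= C%:E * marginal_env mu1 mu2 e s y])
      marginal_env nu1 nu2 0 s0 y <=
   ((1 + C * expR (9 * e) ^+ (N * N)) * expR (- ((\sum_i q i) / 32)))%:E)%E.
Proof.
move=> e0 e2 sp s0p C0 /choice[h /choice[a /choice[a' H]]].
have mh i : measurable_fun setT (h i) by case: (H i).
have h01 i z : 0 <= h i z <= 1 by case: (H i).
have ha i : subject_mean (mu1 i i) (mu2 i i) s (h i) = (a i)%:E by case: (H i).
have ha' i : subject_mean (nu1 i i) (nu2 i i) s0 (h i) = (a' i)%:E by case: (H i).
have qa i : q i <= (a i - a' i) ^+ 2 by case: (H i).
have a01 i : 0 <= a i <= 1.
  have [b + b01] := subject_mean_fin (mu1 i i) (mu2 i i) sp (mh i) (h01 i).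
  by rewrite ha => -[->].
have a'01 i : 0 <= a' i <= 1.
  have [b + b01] := subject_mean_fin (nu1 i i) (nu2 i i) s0p (mh i) (h01 i).
  by rewrite ha' => -[->].
have [c Hc] := choice (fun i => subject_tilt sp (mh i) (h01 i) (a01 i) (a'01 i) (ha i)).
have [c' Hc'] := choice (fun i => subject_tilt s0p (mh i) (h01 i) (a'01 i) (a01 i) (ha' i)).
pose psi i (z : response) := expR (- ((a i - a' i) / 8 * (h i z - (a i + a' i) / 2))).
pose phi i (z : response) := expR (- ((a' i - a i) / 8 * (h i z - (a' i + a i) / 2))).
have mpsi i : measurable_fun setT (psi i).
  apply: measurableT_comp => //; apply: measurableT_comp => //.
  by apply: measurable_funM => //; exact: measurable_funB.
have mphi i : measurable_fun setT (phi i).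
  apply: measurableT_comp => //; apply: measurableT_comp => //.
  by apply: measurable_funM => //; exact: measurable_funB.
have h02 : 0 <= 2^-1 :> R by rewrite invr_ge0.
have T1 := @integral_joint_env_test _ _ nu1 nu2 0 s0 phi c' (lexx 0)
  h02 s0p mphi (fun i z => expR_tilt_bounds (a'01 i) (a01 i) (h01 i z))
  (fun i => (Hc' i).1).
have T2 := @integral_joint_env_test _ _ mu1 mu2 e s psi c e0 e2 sp mpsi
  (fun i z => expR_tilt_bounds (a01 i) (a'01 i) (h01 i z)) (fun i => (Hc i).1).
have prod_le (b : 'I_N -> R) : (forall i, 0 <= b i <= expR (- ((a i - a' i) ^+ 2 / 32))) ->
    \prod_i b i <= expR (- ((\sum_i q i) / 32)).
  move=> hb; rewrite mulr_suml -sumrN expR_sum; apply: ler_prod => i _.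
  have /andP[-> /=] := hb i; move=> /le_trans; apply.
  by rewrite ler_expR lerN2 ler_wpM2r.
have c_le := prod_le c (fun i => (Hc i).2).
have c'_le : \prod_i c' i <= expR (- ((\sum_i q i) / 32)).
  by apply: prod_le => i; have [_] := Hc' i; rewrite -(sqrrN (_ - _)) opprB.
set E := expR _ in c_le c'_le *.
pose Psi (y : observation R N) := \prod_i psi i (tnth (tnth y i) i).
pose Phi (y : observation R N) := \prod_i phi i (tnth (tnth y i) i).
have Psi0 y : 0 <= Psi y by rewrite prodr_ge0// => i _; exact: expR_ge0.
have Phi0 y : 0 <= Phi y by rewrite prodr_ge0// => i _; exact: expR_ge0.
have PP y : Phi y * Psi y = 1.
  rewrite -big_split big1//= => i _.
  by rewrite -expRD -[RHS]expR0; congr expR; ring.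
have mid : measurable_fun [set: observation R N] id by exact: measurable_id.
have mPsi : measurable_fun setT Psi.
  apply: measurable_prod => i _; apply: (measurableT_comp (mpsi i)).
  exact: (measurable_response _ _ mid).
have mPhi : measurable_fun setT Phi.
  apply: measurable_prod => i _; apply: (measurableT_comp (mphi i)).
  exact: (measurable_response _ _ mid).
set F := marginal_env nu1 nu2 0 s0; set G := marginal_env mu1 mu2 e s.
have F0 y : (0 <= F y)%E by exact: marginal_env_ge0.
have G0 y : (0 <= G y)%E by exact: marginal_env_ge0.
have mF : measurable_fun setT F by exact: measurable_marginal_env.
have mG : measurable_fun setT G by exact: measurable_marginal_env.
have {}T1 : (\int[observation_measure R N]_y ((Phi y)%:E * F y) <=
  (expR (9 * 0) ^+ (N * N) * \prod_i c' i)%:E)%E := T1.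
have {}T2 : (\int[observation_measure R N]_y ((Psi y)%:E * G y) <=
  (expR (9 * e) ^+ (N * N) * \prod_i c i)%:E)%E := T2.
clearbody F G Psi Phi.
have mPF : measurable_fun setT (fun y => (Phi y)%:E * F y)%E.
  by apply: emeasurable_funM; [exact/measurable_EFinP|].
have mPG : measurable_fun setT (fun y => (Psi y)%:E * G y)%E.
  by apply: emeasurable_funM; [exact/measurable_EFinP|].
have PF0 y : (0 <= (Phi y)%:E * F y)%E by rewrite mule_ge0// lee_fin.
have PG0 y : (0 <= (Psi y)%:E * G y)%E by rewrite mule_ge0// lee_fin.
have mS : measurable_fun setT (fun y => (Phi y)%:E * F y + C%:E * ((Psi y)%:E * G y))%E.
  by apply: emeasurable_funD => //; exact: measurable_funeM.
have mA : measurable [set y | (F y <= C%:E * G y)%E].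
  rewrite -[X in measurable X]setTI; apply: emeasurable_fun_le => //.
  exact: measurable_funeM.
have S0 y : (0 <= (Phi y)%:E * F y + C%:E * ((Psi y)%:E * G y))%E.
  by rewrite adde_ge0// mule_ge0// lee_fin.
apply: (@le_trans _ _ (\int[observation_measure R N]_y
   ((Phi y)%:E * F y + C%:E * ((Psi y)%:E * G y)))%E).
  apply: (@le_trans _ _ (\int[observation_measure R N]_(y in [set y | (F y <= C%:E * G y)%E])
     ((Phi y)%:E * F y + C%:E * ((Psi y)%:E * G y)))%E).
    apply: ge0_le_integral => //.
    - exact: measurable_funS mF.
    - exact: measurable_funS mS.
    move=> y /= FG.
    have [P1|P1] := leP (Psi y) 1.
      have Phi1 : 1 <= Phi y.
        by rewrite -(PP y) ler_piMr.
      apply: (@le_trans _ _ ((Phi y)%:E * F y)%E); last first.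
        by rewrite leeDl// mule_ge0// lee_fin.
      by rewrite -[leLHS]mul1e lee_wpmul2r// lee_fin.
    apply: (le_trans FG); apply: (@le_trans _ _ (C%:E * ((Psi y)%:E * G y))%E).
      rewrite lee_wpmul2l ?lee_fin// -[leLHS]mul1e lee_wpmul2r// lee_fin.
      exact: ltW.
    by rewrite leeDr.
  by apply: ge0_subset_integral.
rewrite ge0_integralD//; last 2 first.
- by move=> y _; rewrite mule_ge0// lee_fin.
- exact: measurable_funeM.
rewrite ge0_integralZl// mulrDl mul1r EFinD leeD//.
  apply: (le_trans T1).
  by rewrite mulr0 expR0 expr1n mul1r lee_fin.
rewrite -mulrA EFinM lee_wpmul2l ?lee_fin//; apply: (le_trans T2).
by rewrite lee_fin ler_wpM2l// exprn_ge0// expR_ge0.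
Qed.

End likelihood_test.

(** * The density of the model *)

Section model_density.
Context (R : realType) (p N : nat).
Notation leb := (@lebesgue_measure R).
Variable x : 'I_N -> 'I_N -> 'cV[R]_p.
Implicit Types (theta : param R p) (y : observation R N) (u : effects R N).

Definition predictor (beta : 'cV[R]_p) (i j : 'I_N) : R := ((x i j)^T *m beta) ord0 ord0.

Lemma complete_densityE theta y u :
  cond_density x theta y u * effects_density theta u =
  joint_env (predictor (beta1 theta)) (predictor (beta2 theta)) 0 (var_comp theta) y u.
Proof.
rewrite /joint_env; congr (_ * _); rewrite /cond_density.
have gE z : gauss 1 z = (Num.sqrt (2 * pi))^-1 * expR (- z ^+ 2 / 2) :> R.
  by rewrite gaussE// !mulr1 sqrtrV// mulr_ge0// pi_ge0.
rewrite exprM -[X in _ ^+ X]card_ord -prodr_const expR_sum -big_split/=.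
apply: eq_bigr => i _.
rewrite -[X in _ ^+ X]card_ord -prodr_const expR_sum -big_split/=.
apply: eq_bigr => j _.
rewrite env_lik0 /lik gE /logit_pmf -mulrA -expRD /eta /predictor /pair_effect.
by rewrite !addrA.
Qed.

Lemma integral_prod_gauss s : 0 < s ->
  (\int[power_measure leb (N + N)]_u (\prod_k gauss s (tnth u k))%:E = 1)%E.
Proof.
move=> s0; rewrite (@integral_power_measure_prod _ _ R leb (N + N) (fun=> gauss s) (fun=> 1)).
- by rewrite big1.
- by move=> _; exact: measurable_gauss.
- by move=> _ v; exact: gauss_ge0.
- by move=> _; exact: integral_gauss0.
Qed.

Lemma measurable_prod_gauss s :
  measurable_fun setT (fun u : effects R N => \prod_k gauss s (tnth u k)).
Proof. exact: (measurable_prod_tnth (fun=> @measurable_gauss R s)). Qed.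

Lemma lik_le1 m1 m2 z : lik m1 m2 z <= 1 :> R.
Proof.
rewrite -[leRHS]mulr1 ler_pM ?gauss_ge0 ?logit_pmf_ge0 ?logit_pmf_le1//.
rewrite gaussE// -[leRHS]mulr1 ler_pM//.
  rewrite -[leRHS]sqrtr1 ler_wsqrtr// invf_le1; have := @pi_ge2 R; lra.
by rewrite expR_le1 mulNr oppr_le0 divr_ge0 ?sqr_ge0.
Qed.

Lemma prodr_le1 n (f : 'I_n -> R) : (forall i, 0 <= f i <= 1) -> \prod_i f i <= 1.
Proof.
move=> f01; apply: (@le_trans _ _ (\prod_(i < n) 1)); last by rewrite big1.
exact: ler_prod.
Qed.

Lemma joint_env0_le mu1 mu2 s y u :
  joint_env mu1 mu2 0 s y u <= \prod_k gauss s (tnth u k) :> R.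
Proof.
rewrite -[leRHS]mul1r ler_wpM2r ?prodr_ge0// => [k _|]; first exact: gauss_ge0.
apply: prodr_le1 => i; rewrite prodr_ge0 ?prodr_le1// => j.
- by rewrite env_lik_ge0 env_lik0 lik_le1.
- by rewrite env_lik_ge0.
Qed.

Lemma joint_env0_gt0 mu1 mu2 s y u : 0 < s -> 0 < joint_env mu1 mu2 0 s y u :> R.
Proof.
move=> s0; rewrite mulr_gt0// prodr_gt0// => i _; last exact: gauss_gt0.
rewrite prodr_gt0// => j _; rewrite env_lik0 mulr_gt0 ?gauss_gt0//.
exact: expR_gt0.
Qed.

Let measurable_joint mu1 mu2 e s y :
  measurable_fun setT (fun u => (joint_env mu1 mu2 e s y u)%:E : \bar R).
Proof. by apply/measurable_EFinP; exact: measurable_joint_env. Qed.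

Lemma marginal_env0_lty mu1 mu2 s y : 0 < s ->
  (marginal_env mu1 mu2 0 s y < +oo :> \bar R)%E.
Proof.
move=> s0; apply: (@le_lt_trans _ _ 1%E); last by rewrite ltry.
rewrite -(integral_prod_gauss s0); apply: ge0_le_integral.
- exact: measurableT.
- by move=> u _; rewrite lee_fin joint_env_ge0.
- exact: measurable_joint.
- by apply/measurable_EFinP; exact: measurable_prod_gauss.
- by move=> u _; rewrite lee_fin joint_env0_le.
Qed.

(** The integrand is positive: were its integral zero, it would vanish almost
    everywhere, against the unit mass of the effects. *)
Lemma marginal_env0_gt0 mu1 mu2 s y : 0 < s ->
  (0 < marginal_env mu1 mu2 0 s y :> \bar R)%E.
Proof.
move=> s0; rewrite lt_neqAle marginal_env_ge0 andbT eq_sym; apply/eqP => I0.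
have : ae_eq (power_measure leb (N + N)) setT
    (fun u => (joint_env mu1 mu2 0 s y u)%:E) (cst 0%E).
  apply/(ae_eq_integral_abs _ measurableT) => //.
  rewrite -[RHS]I0; apply: eq_integral => u _.
  by rewrite gee0_abs// lee_fin joint_env_ge0.
move=> ae0.
have := integral_prod_gauss s0.
rewrite (ae_eq_integral (cst 0%E))//.
- by rewrite integral0 => /eqP; rewrite eqe eq_sym oner_eq0.
- by apply/measurable_EFinP; exact: measurable_prod_gauss.
- apply: filterS ae0 => u /(_ I) /eqP; rewrite eqe.
  by rewrite gt_eqF// joint_env0_gt0.
Qed.

Lemma densityE theta y : Theta theta ->
  (density x theta y)%:E =
  marginal_env (predictor (beta1 theta)) (predictor (beta2 theta)) 0 (var_comp theta) y.
Proof.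
move=> s0; rewrite /density /Rintegral.
under eq_integral do rewrite complete_densityE.
by rewrite fineK// ge0_fin_numE ?marginal_env0_lty// marginal_env_ge0.
Qed.

Lemma density_gt0 theta y : Theta theta -> 0 < density x theta y.
Proof. by move=> s0; rewrite -lte_fin densityE// marginal_env0_gt0. Qed.

Lemma measurable_density theta : Theta theta -> measurable_fun setT (density x theta).
Proof.
move=> s0; apply/measurable_EFinP.
rewrite (_ : _ \o _ = marginal_env (predictor (beta1 theta))
   (predictor (beta2 theta)) 0 (var_comp theta)); first exact: measurable_marginal_env.
by apply/funext => y /=; rewrite densityE.
Qed.

(** The comparison is made with a variance component that is larger than that of
    [theta], since this is the direction in which the densities of the effects are
    comparable. *)
Lemma density_le_env theta theta' e y : Theta theta -> e < 1 ->
  (forall i j, `|predictor (beta1 theta') i j - predictor (beta1 theta) i j| <= e) ->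
  (forall i j, `|predictor (beta2 theta) i j - predictor (beta2 theta') i j| <= e) ->
  var_comp theta <= var_comp theta' <= expR (2 * e) * var_comp theta ->
  ((density x theta y)%:E <= (expR e ^+ (N + N))%:E *
    marginal_env (predictor (beta1 theta')) (predictor (beta2 theta')) e (var_comp theta') y)%E.
Proof.
move=> s0 e1 b1 b2 /andP[ss' s'e]; rewrite densityE// -ge0_integralZl//; last first.
  by move=> u _; rewrite lee_fin joint_env_ge0.
apply: ge0_le_integral.
- exact: measurableT.
- by move=> u _; rewrite lee_fin joint_env_ge0.
- exact: measurable_joint.
- by apply: measurable_funeM; exact: measurable_joint.
move=> u _; rewrite -EFinM lee_fin /joint_env [leRHS]mulrCA.
apply: ler_pM.
- by rewrite prodr_ge0// => i _; rewrite prodr_ge0// => j _; exact: env_lik_ge0.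
- by rewrite prodr_ge0// => k _; exact: gauss_ge0.
- apply: ler_prod => i _; rewrite prodr_ge0/=; last by move=> j _; exact: env_lik_ge0.
  apply: ler_prod => j _; rewrite env_lik_ge0/= env_lik0 lik_le_env//.
  + by rewrite opprD addrACA subrr addr0.
  + by rewrite opprD addrACA subrr addr0.
- rewrite -[X in _ ^+ X]card_ord -prodr_const -big_split/=.
  apply: ler_prod => k _; rewrite gauss_ge0/=.
  apply: (le_trans (gauss_var_le _ s0 ss')).
  rewrite ler_wpM2r ?gauss_ge0// -(ler_pXn2r (n:=2))// ?nnegrE ?expR_ge0//.
  rewrite sqr_sqrtr; last by rewrite divr_ge0// ltW// (lt_le_trans s0).
  by rewrite -expRM_natl ler_pdivrMr.
Qed.

End model_density.

(** * The smallest eigenvalue of the design *)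

Lemma cvg_bigsum (R : realType) (T : topologicalType) (F : set_system T) {FF : Filter F}
    (I : Type) (r : seq I) (f : I -> T -> R) (a : I -> R) :
  (forall i, f i t @[t --> F] --> a i) ->
  \sum_(i <- r) f i t @[t --> F] --> \sum_(i <- r) a i.
Proof.
move=> fa; elim: r => [|i r IH].
  by under eq_fun do rewrite big_nil; rewrite big_nil; exact: cvg_cst.
by under eq_fun do rewrite big_cons; rewrite big_cons; exact: cvgD.
Qed.

Section rayleigh.
Context (R : realType) (p : nat).
Implicit Types (A B : 'M[R]_p) (v w : 'rV[R]_p).

Definition quad A v : R := (v *m A *m v^T) ord0 ord0.

Lemma quad1E v : quad 1%:M v = \sum_i v ord0 i ^+ 2.
Proof.
rewrite /quad mulmx1 mxE; apply: eq_bigr => i _; by rewrite mxE expr2.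
Qed.

Lemma quadZ A a v : quad A (a *: v) = a ^+ 2 * quad A v.
Proof.
by rewrite /quad linearZ/= -!scalemxAl -scalemxAr scalerA mxE expr2.
Qed.

Lemma quadB A a v : quad (A - a%:M) v = quad A v - a * quad 1%:M v.
Proof.
rewrite /quad mulmxBr mulmxBl mulmx1 mul_mx_scalar -scalemxAl.
by rewrite [in LHS]mxE [X in _ + X]mxE [X in _ - X]mxE.
Qed.

Lemma quad1_gt0 v : v != 0 -> 0 < quad 1%:M v.
Proof.
move=> v0; rewrite quad1E lt_neqAle sumr_ge0 ?andbT; last by move=> *; exact: sqr_ge0.
apply: contraNN v0 => /eqP/esym/eqP; rewrite psumr_eq0; last by move=> *; exact: sqr_ge0.
move=> /allP H; apply/eqP/rowP => i; rewrite mxE.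
by have := H i (mem_index_enum i); rewrite sqrf_eq0 => /eqP.
Qed.

Lemma continuous_quad A : continuous (quad A).
Proof.
have -> : quad A = fun v => \sum_j (\sum_i v ord0 i * A i j) * v ord0 j.
  by apply/funext => v; rewrite /quad mxE; apply: eq_bigr => j _; rewrite !mxE.
move=> v; apply: (@cvg_bigsum R _ (nbhs v)) => j; apply: cvgM; last exact: coord_continuous.
apply: (@cvg_bigsum R _ (nbhs v)) => i; apply: cvgM; last exact: cvg_cst.
exact: coord_continuous.
Qed.

(** Otherwise the form would be negative at [w + t *: z], with [z := w *m B], for
    small negative [t]. *)
Lemma psd_kernel B w : B^T = B -> (forall v, 0 <= quad B v) -> quad B w = 0 ->
  w *m B = 0.
Proof.
move=> symB psd w0; apply/eqP/negPn/negP => z0; set z := w *m B in z0.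
have b0 := quad1_gt0 z0; have q0 := psd z.
set b := quad 1%:M z in b0; set q := quad B z in q0.
have expand t : quad B (w + t *: z) = t * (2 * b) + t ^+ 2 * q.
  have E1 : (w *m B *m z^T) ord0 ord0 = b by rewrite /b /quad mulmx1.
  have E2 : (z *m B *m w^T) ord0 ord0 = b.
    rewrite -[in LHS](trmxK (z *m B *m w^T)) mxE -E1 !trmx_mul trmxK symB.
    by rewrite mulmxA.
  have M : (w + t *: z) *m B *m (w + t *: z)^T = w *m B *m w^T +
      t *: (w *m B *m z^T) + t *: (z *m B *m w^T) + t ^+ 2 *: (z *m B *m z^T).
    rewrite linearD linearZ/= !mulmxDl !mulmxDr -!scalemxAl -!scalemxAr scalerA.
    by rewrite -expr2 !addrA.
  have add (a c : 'M[R]_1) : (a + c) ord0 ord0 = a ord0 ord0 + c ord0 ord0 by rewrite mxE.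
  have scale k (a : 'M[R]_1) : (k *: a) ord0 ord0 = k * a ord0 ord0 by rewrite mxE.
  by rewrite /quad M !add !scale -/(quad B w) w0 E1 E2 -/(quad B z) -/q; ring.
have := psd (w + (- (b / (q + 1))) *: z); rewrite expand.
have q1 : 0 < q + 1 by rewrite ltr_pwDr.
have -> : - (b / (q + 1)) * (2 * b) + (- (b / (q + 1))) ^+ 2 * q =
  - (b ^+ 2 * (q + 2) / (q + 1) ^+ 2) by field; rewrite gt_eqF.
rewrite oppr_ge0 leNgt => /negP; apply.
have q2 : 0 < q + 2 by rewrite ltr_wpDl.
by rewrite divr_gt0 ?mulr_gt0 ?exprn_gt0.
Qed.

(** The minimum of the form on the unit sphere is an eigenvalue, hence at least the
    infimum of the eigenvalues; it is attained by compactness, at a vector that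
    [psd_kernel] shows to be an eigenvector. *)
Lemma lambda_min_le_quad A v : A^T = A -> (forall w, 0 <= quad A w) ->
  lambda_min A * quad 1%:M v <= quad A v.
Proof.
move=> symA psd; have [->|v0] := eqVneq v 0.
  by rewrite /quad !mul0mx !mxE mulr0.
pose S := [set w : 'rV[R]_p | quad 1%:M w = 1].
have normalize w : w != 0 -> S ((Num.sqrt (quad 1%:M w))^-1 *: w).
  move=> w0; have q0 := quad1_gt0 w0.
  by rewrite /S/= quadZ exprVn sqr_sqrtr ?ltW// mulVf// gt_eqF.
have S0 : S !=set0 by eexists; exact: normalize v0.
have cS : compact S.
  apply: bounded_closed_compact.
    exists 1; split => // M M1 w /= w1; apply: le_trans (ltW M1).
    rewrite [leLHS]/Num.norm/= mx_normrE; apply/bigmax_leP; split => // -[i j] _ /=.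
    rewrite -(ler_pXn2r (n:=2))// ?nnegrE// expr1n -w1 quad1E (ord1 i).
    rewrite (bigD1 j)//= real_normK ?num_real// lerDl.
    by rewrite sumr_ge0// => k _; exact: sqr_ge0.
  rewrite (_ : S = quad 1%:M @^-1` [set 1])//.
  apply: preimage_closed; last exact: closed_eq.
  by move=> w _; exact: continuous_quad.
have [w wS wmin] := compact_EVT_min S0 cS (continuous_subspaceT (@continuous_quad A)).
have w1 : quad 1%:M w = 1 by move: wS; rewrite inE.
set mu := quad A w in wmin.
have psdB z : 0 <= quad (A - mu%:M) z.
  have [->|z0] := eqVneq z 0; first by rewrite /quad !mul0mx mxE.
  have q0 := quad1_gt0 z0.
  have := wmin _ (mem_set (normalize _ z0)).
  rewrite quadZ exprVn (sqr_sqrtr (ltW q0)) ler_pdivlMl// quadB mulrC; lra.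
have ker : w *m (A - mu%:M) = 0.
  apply: psd_kernel => //; first by rewrite linearB/= symA tr_scalar_mx.
  by rewrite quadB w1 mulr1 subrr.
have eig : eigenvalue A mu.
  apply/eigenvalueP; exists w.
    by move/eqP: ker; rewrite mulmxBr mul_mx_scalar subr_eq0 => /eqP.
  apply/eqP => w0; move: w1; rewrite w0 /quad !mul0mx mxE => /eqP.
  by rewrite eq_sym oner_eq0.
have lb : has_lbound [set a | eigenvalue A a].
  exists 0 => a /= /eigenvalueP[z zA z0].
  have := psd z; rewrite /quad zA -scalemxAl mxE.
  have := quad1_gt0 z0; rewrite /quad mulmx1 => q0.
  by rewrite pmulr_lge0.
have lmu : lambda_min A <= mu by exact: ge_inf lb _ eig.
have := psdB v; rewrite quadB; have := quad1_gt0 v0; nra.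
Qed.

Lemma quad_sum_outer N (a : R) (x : 'I_N -> 'cV[R]_p) v :
  quad (a *: \sum_(i < N) x i *m (x i)^T) v =
  a * \sum_(i < N) ((x i)^T *m v^T) ord0 ord0 ^+ 2.
Proof.
rewrite /quad -scalemxAr -scalemxAl mxE; congr (_ * _).
rewrite mulmx_sumr mulmx_suml summxE; apply: eq_bigr => i _.
have -> : v *m (x i *m (x i)^T) *m v^T = (v *m x i) *m ((x i)^T *m v^T) by rewrite !mulmxA.
rewrite mxE big_ord1 expr2; congr (_ * _).
have -> : v *m x i = ((x i)^T *m v^T)^T by rewrite trmx_mul !trmxK.
by rewrite mxE.
Qed.

Lemma lambda_min_le_sum N (x : 'I_N -> 'cV[R]_p) (b : 'cV[R]_p) : (0 < N)%N ->
  lambda_min (N%:R^-1 *: \sum_(i < N) x i *m (x i)^T) * (N%:R * \sum_k b k ord0 ^+ 2) <=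
  \sum_(i < N) ((x i)^T *m b) ord0 ord0 ^+ 2.
Proof.
move=> N0; have n0 : 0 < N%:R :> R by rewrite ltr0n.
have := @lambda_min_le_quad (N%:R^-1 *: \sum_(i < N) x i *m (x i)^T) b^T.
rewrite quad_sum_outer quad1E trmxK => H.
rewrite mulrCA -ler_pdivlMl//.
rewrite (eq_bigr (fun k => b^T ord0 k ^+ 2)); last by move=> k _; rewrite mxE.
apply: H.
  rewrite linearZ/= linear_sum/=; congr (_ *: _); apply: eq_bigr => i _.
  by rewrite trmx_mul trmxK.
move=> w; rewrite quad_sum_outer mulr_ge0 ?invr_ge0 ?ler0n//.
by rewrite sumr_ge0// => i _; exact: sqr_ge0.
Qed.

End rayleigh.

Lemma limn_einf_gt0 (R : realType) (u : nat -> R) :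
  (0 < limn_einf (fun n => (u n)%:E))%E ->
  exists2 c, 0 < c & \forall n \near \oo, c <= u n.
Proof.
rewrite limn_einf_lim => h.
have lim := @cvg_einfs_sup R (fun n => (u n)%:E).
rewrite (cvg_lim (@ereal_hausdorff R) lim) in h.
have [_ [n _ <-] h1] := ereal_sup_gt h.
have [c c0 cn] : exists2 c : R, 0 < c & (c%:E <= einfs (fun n => (u n)%:E) n)%E.
  move: h1; case: (einfs _ n) => [c c0|_|//]; first by exists c.
  by exists 1; rewrite ?leey.
exists c => //; exists n => // k /= nk; rewrite -lee_fin.
by apply: (le_trans cn); apply: ereal_inf_lbound; exists k.
Qed.

(** * Grids and separation of the parameters *)

Section coordinates.
Context (R : realType) (p : nat).
Implicit Types (theta : param R p) (b v : 'cV[R]_p).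

Lemma beta1E theta k : beta1 theta k ord0 = theta (lshift 1 (lshift p k)) ord0.
Proof. by rewrite !mxE. Qed.

Lemma beta2E theta k : beta2 theta k ord0 = theta (lshift 1 (rshift p k)) ord0.
Proof. by rewrite !mxE. Qed.

Lemma var_compE theta : var_comp theta = theta (rshift (p + p) ord0) ord0.
Proof. by rewrite /var_comp mxE. Qed.

Lemma predictorB N (x : 'I_N -> 'I_N -> 'cV[R]_p) b v i j :
  predictor x (b - v) i j = predictor x b i j - predictor x v i j.
Proof. by rewrite /predictor mulmxBr mxE [X in _ + X]mxE. Qed.

Lemma predictor_le N (x : 'I_N -> 'I_N -> 'cV[R]_p) b i j :
  enorm (x i j) <= 1 -> `|predictor x b i j| <= \sum_k `|b k ord0|.
Proof.
move=> x1; rewrite /predictor mxE; apply: (le_trans (ler_norm_sum _ _ _)).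
apply: ler_sum => k _; rewrite normrM mxE ler_piMl//.
apply: le_trans x1; rewrite /enorm -sqrtr_sqr ler_wsqrtr// (bigD1 k)//= lerDl.
by rewrite sumr_ge0// => l _; exact: sqr_ge0.
Qed.

Lemma sum_param_sqr theta :
  \sum_k theta k ord0 ^+ 2 =
  \sum_k beta1 theta k ord0 ^+ 2 + \sum_k beta2 theta k ord0 ^+ 2 + var_comp theta ^+ 2.
Proof.
rewrite big_split_ord/= big_split_ord/= big_ord1 var_compE.
by congr (_ + _ + _); apply: eq_bigr => k _; rewrite ?beta1E ?beta2E.
Qed.

Lemma beta1B theta theta' : beta1 (theta - theta') = beta1 theta - beta1 theta'.
Proof. by rewrite /beta1 !linearB. Qed.

Lemma beta2B theta theta' : beta2 (theta - theta') = beta2 theta - beta2 theta'.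
Proof. by rewrite /beta2 !linearB. Qed.

Lemma var_compB theta theta' : var_comp (theta - theta') = var_comp theta - var_comp theta'.
Proof. by rewrite !var_compE !mxE. Qed.

End coordinates.

Section grid.
Context (R : realType).

Lemma grid_round (r t : R) M : 0 < r -> (0 < M)%N -> `|t| <= r ->
  exists j : 'I_(2 * M).+1, t <= r * (j%:R - M%:R) / M%:R <= t + r / M%:R.
Proof.
move=> r0 M0 /ler_normlP[tr1 tr2]; have m0 : 0 < M%:R :> R by rewrite ltr0n.
pose v := (t + r) * M%:R / r.
have v2 : v <= (2 * M)%:R.
  by rewrite /v natrM ler_pdivrMr//; nra.
have v0 : 0 <= v by rewrite divr_ge0 ?mulr_ge0 ?(ltW m0) ?(ltW r0)//; lra.
(* rounding up, so that a grid point dominates each of the points of its cell *)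
have exj : exists j : nat, v <= j%:R by exists (2 * M)%N.
case: (ex_minnP exj) => j vj jmin.
have jM : (j < (2 * M).+1)%N by rewrite ltnS; exact: jmin.
have jv : j%:R <= v + 1.
  case: j vj jmin jM => [|j] vj jmin _; first by rewrite addr_ge0.
  rewrite -natr1 lerD2r leNgt; apply/negP => /ltW/jmin.
  by rewrite ltnn.
exists (Ordinal jM) => /=.
have -> : t = r * (v - M%:R) / M%:R by rewrite /v; field; rewrite !gt_eqF.
have -> : r * (v - M%:R) / M%:R + r / M%:R = r * (v + 1 - M%:R) / M%:R.
  by field; rewrite gt_eqF.
by rewrite !ler_wpM2r ?invr_ge0 ?(ltW m0)// ler_wpM2l ?(ltW r0)// lerD2r.
Qed.

(** The [2 M + 1] equidistant values of each coordinate, including both ends of the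
    interval of radius [r]. *)
Definition grid_point d (c : 'cV[R]_d) (r : R) M (f : {ffun 'I_d -> 'I_(2 * M).+1}) : 'cV[R]_d :=
  \col_k (c k ord0 + r * ((f k)%:R - M%:R) / M%:R).

Lemma grid_point_near d (c : 'cV[R]_d) r M f : 0 < r -> (0 < M)%N ->
  forall k, `|grid_point c r (M:=M) f k ord0 - c k ord0| <= r.
Proof.
move=> r0 M0 k; have m0 : 0 < M%:R :> R by rewrite ltr0n.
rewrite mxE addrAC subrr add0r -mulrA normrM gtr0_norm// ler_piMr ?(ltW r0)//.
rewrite normrM (gtr0_norm (_ : 0 < M%:R^-1)) ?invr_gt0// ler_pdivrMr// mul1r.
have : (f k)%:R <= (2 * M)%:R :> R by rewrite ler_nat -ltnS ltn_ord.
have : 0 <= (f k)%:R :> R by [].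
by rewrite natrM ler_norml => *; apply/andP; split; lra.
Qed.

Lemma grid_point_exists d (c : 'cV[R]_d) r M (t : 'cV[R]_d) : 0 < r -> (0 < M)%N ->
  (forall k, `|t k ord0 - c k ord0| <= r) ->
  exists f, forall k, t k ord0 <= grid_point c r (M:=M) f k ord0 <= t k ord0 + r / M%:R.
Proof.
move=> r0 M0 /(_ _)/(grid_round r0 M0) H.
have [f Hf] := choice H; exists [ffun k => f k] => k.
rewrite mxE ffunE; have /andP[f1 f2] := Hf k.
by apply/andP; split; lra.
Qed.

End grid.

Lemma measure_bigsetU_le_sum d (T : measurableType d) (R : realType)
    (mu : {measure set T -> \bar R}) (I : Type) (s : seq I) (A : I -> set T) :
  (forall i, measurable (A i)) ->
  (mu (\big[setU/set0]_(i <- s) A i) <= \sum_(i <- s) mu (A i))%E.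
Proof.
move=> mA; elim: s => [|i s IH]; first by rewrite !big_nil measure0.
rewrite !big_cons; apply: (@le_trans _ _ (mu (A i) + mu (\big[setU/set0]_(i <- s) A i))%E).
  by apply: measureU2 => //; exact: bigsetU_measurable.
by rewrite leeD2l.
Qed.

Section separation_of_parameters.
Context (R : realType) (p : nat).
Implicit Types (theta : param R p).

(** [subject_separation] is summed over the diagonal; the smallest eigenvalue of the
    design turns the squared differences of the predictors into those of the
    coefficients. *)
Lemma parameter_separation D lo hi c : 0 <= D -> 0 < lo -> lo <= hi -> 0 < c ->
  exists2 kappa : R, 0 < kappa & forall N (x : 'I_N -> 'I_N -> 'cV[R]_p) theta theta0,
    (0 < N)%N ->
    (forall i, `|predictor x (beta1 theta) i i| <= D) ->
    (forall i, `|predictor x (beta2 theta) i i| <= D) ->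
    (forall i, `|predictor x (beta1 theta0) i i| <= D) ->
    (forall i, `|predictor x (beta2 theta0) i i| <= D) ->
    lo <= var_comp theta <= hi -> lo <= var_comp theta0 <= hi ->
    c <= lambda_min (N%:R^-1 *: \sum_(i < N) x i i *m (x i i)^T) ->
    exists2 q : 'I_N -> R,
      kappa * N%:R * (\sum_k (theta - theta0) k ord0 ^+ 2) <= \sum_i q i &
      forall i, exists h : measurableTypeR R * bool -> R, exists a a',
      [/\ measurable_fun setT h, forall z, 0 <= h z <= 1,
        subject_mean (predictor x (beta1 theta) i i) (predictor x (beta2 theta) i i)
          (var_comp theta) h = a%:E,
        subject_mean (predictor x (beta1 theta0) i i) (predictor x (beta2 theta0) i i)
          (var_comp theta0) h = a'%:E & q i <= (a - a') ^+ 2].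
Proof.
move=> D0 lo0 lohi c0; have [K K0 sep] := subject_separation D0 lo0 lohi.
have [m m0 [mc m1]] : exists2 m : R, 0 < m & m <= c /\ m <= 1.
  by exists (Num.min c 1); rewrite ?lt_min ?c0 ?ltr01// !ge_min !lexx orbT.
have K2 : 0 < 3 * K ^+ 2 by rewrite mulr_gt0// exprn_gt0.
exists (m / (3 * K ^+ 2)); first exact: divr_gt0.
move=> N x theta theta0 N0 t1 t2 t01 t02 st st0 cl.
have n0 : 0 < N%:R :> R by rewrite ltr0n.
pose d : param R p := theta - theta0.
pose Q i := predictor x (beta1 d) i i ^+ 2 + predictor x (beta2 d) i i ^+ 2 + var_comp d ^+ 2.
exists (fun i => Q i / (3 * K ^+ 2)).
  rewrite -mulr_suml mulrAC -[leLHS]mulrA mulrAC.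
  rewrite ler_wpM2r ?invr_ge0 ?(ltW K2)//.
  rewrite -/d sum_param_sqr !big_split/= sumr_const card_ord -[X in _ <= _ + X]mulr_natl.
  have H (b : 'cV[R]_p) : m * (N%:R * \sum_k b k ord0 ^+ 2) <= \sum_i predictor x b i i ^+ 2.
    apply: le_trans (lambda_min_le_sum (fun i => x i i) b N0).
    rewrite ler_wpM2r ?mulr_ge0 ?(ltW n0)//.
      by rewrite sumr_ge0// => k _; exact: sqr_ge0.
    exact: le_trans cl.
  have H1 := H (beta1 d); have H2 := H (beta2 d).
  have H3 : m * (N%:R * var_comp d ^+ 2) <= N%:R * var_comp d ^+ 2.
    by rewrite ler_piMl// mulr_ge0 ?sqr_ge0 ?(ltW n0).
  move: H1 H2 H3; set S1 := \sum_k _; set S2 := \sum_k _; set s2 := _ ^+ 2.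
  by move: S1 S2 s2 => S1 S2 s2; lra.
move=> i.
have [h [a [a' [mh h01 ha ha' [g1 g2 g3]]]]] :=
  sep _ _ _ _ _ _ (And4 (t1 i) (t2 i) (t01 i) (t02 i)) st st0.
exists h, a, a'; split => //.
rewrite ler_pdivrMr// mulrC /Q /d beta1B beta2B !predictorB var_compB.
have sq z : `|z| <= K * `|a - a'| -> z ^+ 2 <= K ^+ 2 * (a - a') ^+ 2.
  move=> zK; rewrite -[X in X <= _](real_normK (num_real z)).
  rewrite -[X in _ * X](real_normK (num_real (a - a'))) -exprMn.
  by rewrite lerXn2r// nnegrE// mulr_ge0// ltW.
by have := sq _ g1; have := sq _ g2; have := sq _ g3; lra.
Qed.

End separation_of_parameters.

(** * The likelihood far from the true parameter *)

Section bad_event.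
Context (R : realType) (p : nat).
Variables (x : forall N : nat, 'I_N -> 'I_N -> 'cV[R]_p).
Arguments x : clear implicits.
Hypothesis hx : forall (N : nat) (i j : 'I_N), enorm (x N i j) <= 1.
Variables (theta0 : param R p) (r eps c : R).
Hypotheses (r0 : 0 < r) (r_s0 : r <= var_comp theta0 / 2) (eps0 : 0 < eps) (c0 : 0 < c).
Implicit Types (theta : param R p).

Let s0 := var_comp theta0.
Let s00 : 0 < s0. Proof. by rewrite /s0; have := r0; have := r_s0; lra. Qed.

Definition in_box theta := forall k, `|theta k ord0 - theta0 k ord0| <= r.

(** Lipschitz constant turning the mesh of the grid into an envelope radius. *)
Let L := p%:R * r + r / s0.
Let L0 : 0 < L.
Proof. by rewrite ltr_wpDl ?divr_gt0// mulr_ge0// ltW. Qed.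

Let D := \sum_k `|theta0 k ord0| + (p + p + 1)%:R * r.

Let box_abs theta k : in_box theta -> `|theta k ord0| <= `|theta0 k ord0| + r.
Proof.
move=> th; have := th k.
have -> : theta k ord0 = theta0 k ord0 + (theta k ord0 - theta0 k ord0) by ring.
move=> h; apply: (le_trans (ler_normD _ _)); rewrite lerD2l.
by move: h; rewrite addrAC subrr add0r.
Qed.

Let sum_abs theta : in_box theta -> \sum_k `|theta k ord0| <= D.
Proof.
move=> th; rewrite /D -[X in X%:R]card_ord mulr_natl -sumr_const -big_split/=.
by apply: ler_sum => k _; exact: box_abs.
Qed.

Let box_predictor theta N i j : in_box theta ->
  `|predictor (x N) (beta1 theta) i j| <= D /\ `|predictor (x N) (beta2 theta) i j| <= D.
Proof.
move=> th; have := sum_abs th; rewrite big_split_ord/= big_split_ord/= big_ord1.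
set S1 := \sum_(k < p) _; set S2 := \sum_(k < p) _ => H.
have S10 : 0 <= S1 by exact: sumr_ge0.
have S20 : 0 <= S2 by exact: sumr_ge0.
have v0 := normr_ge0 (theta (rshift (p + p) ord0) ord0).
split; apply: (le_trans (predictor_le _ (hx i j))).
  by under eq_bigr do rewrite beta1E; rewrite -/S1; lra.
by under eq_bigr do rewrite beta2E; rewrite -/S2; lra.
Qed.

Let box_var theta : in_box theta -> s0 / 2 <= var_comp theta <= 3 / 2 * s0.
Proof.
move=> th; have := th (rshift (p + p) ord0); rewrite -!var_compE -/s0 => /ler_normlP[h1 h2].
by have rs := r_s0; rewrite -/s0 in rs; apply/andP; split; lra.
Qed.

Let box0 : in_box theta0.
Proof. by move=> k; rewrite subrr normr0 ltW. Qed.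

Section cell.
Variables (N M : nat) (theta theta' : param R p).
Hypotheses (M0 : (0 < M)%N) (th : in_box theta).
Hypothesis cell : forall k, theta k ord0 <= theta' k ord0 <= theta k ord0 + r / M%:R.
Let e := L / M%:R.
Let m0 : 0 < M%:R :> R. Proof. by rewrite ltr0n. Qed.
Let rM0 : 0 <= r / M%:R. Proof. by rewrite divr_ge0 ?ltW. Qed.

Let predictor_close (b b' : 'cV[R]_p) i j :
  (forall k, b k ord0 <= b' k ord0 <= b k ord0 + r / M%:R) ->
  `|predictor (x N) b' i j - predictor (x N) b i j| <= e.
Proof.
move=> bb; rewrite -predictorB; apply: (le_trans (predictor_le _ (hx i j))).
apply: (@le_trans _ _ (\sum_(k < p) (r / M%:R))).
  apply: ler_sum => k _; have /andP[b1 b2] := bb k.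
  by rewrite mxE [X in _ + X]mxE ler_norml; apply/andP; split; lra.
rewrite sumr_const card_ord -[leLHS]mulr_natl mulrA /e ler_wpM2r ?invr_ge0 ?(ltW m0)//.
by rewrite lerDl divr_ge0// ltW.
Qed.

Lemma density_le_cell_env y : e < 1 ->
  ((density (x N) theta y)%:E <= (expR e ^+ (N + N))%:E *
    marginal_env (predictor (x N) (beta1 theta')) (predictor (x N) (beta2 theta')) e
      (var_comp theta') y)%E.
Proof.
move=> e1; have /andP[v1 v2] := box_var th.
apply: density_le_env => //.
- by rewrite /Theta/=; have := s00; lra.
- by move=> i j; apply: predictor_close => k; rewrite !beta1E.
- by move=> i j; rewrite distrC; apply: predictor_close => k; rewrite !beta2E.
have := cell (rshift (p + p) ord0); rewrite -!var_compE => /andP[-> /= h].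
apply: (le_trans h); apply: (@le_trans _ _ ((1 + 2 * e) * var_comp theta)); last first.
  by rewrite ler_wpM2r ?expR_ge1Dx//; have := s00; lra.
rewrite mulrDl mul1r lerD2l.
have rs : r / s0 / M%:R <= e.
  by rewrite /e ler_wpM2r ?invr_ge0 ?(ltW m0)// lerDr mulr_ge0// ltW.
have -> : r / M%:R = r / s0 / M%:R * s0 by field; rewrite !gt_eqF.
have : 0 <= r / s0 / M%:R by rewrite !divr_ge0 ?ltW.
by have := s00; nra.
Qed.

End cell.

(** The bad event is the union, over a grid of mesh [r / N ^ 2] in the box, of the
    events that the envelope around a grid point beats the true density; each
    has probability exponentially small in [N], and the grid has polynomial size. *)
Lemma bad_event : exists A kappa : R, [/\ 0 <= A, 0 < kappa & \forall N \near \oo,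
  c <= lambda_min (N%:R^-1 *: \sum_(i < N) x N i i *m (x N i i)^T) ->
  forall mu : {measure set (observation R N) -> \bar R},
  (forall B, measurable B ->
    mu B = (\int[observation_measure R N]_(y in B) (density (x N) theta0 y)%:E)%E) ->
  exists B, [/\ measurable B,
    forall y, ~ B y -> forall theta, in_box theta ->
      forall k, eps <= `|theta k ord0 - theta0 k ord0| ->
      density (x N) theta y < density (x N) theta0 y &
    (mu B <= (A * (2 * (N * N)).+1%:R ^+ (p + p + 1) * expR (- (kappa * N%:R)))%:E)%E]].
Proof.
have D0 : 0 <= D by apply: le_trans (sum_abs box0); exact: sumr_ge0.
have lo0 : 0 < s0 / 2 by rewrite divr_gt0.
have lohi : s0 / 2 <= 3 / 2 * s0 by have := s00; lra.
have [kappa kappa0 sep] := parameter_separation p D0 lo0 lohi c0.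
exists (1 + expR (11 * L)), (kappa * (eps / 2) ^+ 2 / 32); split.
- by rewrite addr_ge0 ?expR_ge0.
- by rewrite divr_gt0 ?mulr_gt0 ?exprn_gt0 ?divr_gt0.
near=> N => cN mu hmu.
have N0 : (0 < N)%N by near: N; exists 1%N.
have n0 : 0 < N%:R :> R by rewrite ltr0n.
have n1 : 1 <= N%:R :> R by rewrite ler1n.
(* with this mesh, the radius of the envelopes summed over all subjects is bounded *)
pose M := (N * N)%N; have M0 : (0 < M)%N by rewrite muln_gt0 N0.
have m0 : 0 < M%:R :> R by rewrite ltr0n.
have NM : N%:R <= M%:R :> R by rewrite ler_nat leq_pmulr.
pose e := L / M%:R.
have e0 : 0 <= e by rewrite divr_ge0 ?ltW.
have e2 : e <= 2^-1.
  rewrite ler_pdivrMr//; have : 2 * L <= N%:R by near: N; exact: nbhs_infty_ger.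
  lra.
have e1 : e < 1 by lra.
(* a cell that meets the region at distance [eps] has its corner at distance [eps / 2] *)
have rM : r / M%:R <= eps / 2.
  rewrite ler_pdivrMr//.
  have : 2 * r / eps <= N%:R by near: N; exact: nbhs_infty_ger.
  rewrite ler_pdivrMr// => h.
  have : N%:R * eps <= M%:R * eps by rewrite ler_wpM2r// ltW.
  lra.
have far (a b t : R) : b <= a -> a <= b + r / M%:R -> eps <= `|b - t| ->
    eps / 2 <= `|a - t|.
  move=> ba ab bt; have -> : a - t = (b - t) + (a - b) by ring.
  have := lerB_normD (b - t) (a - b).
  rewrite (ger0_norm (_ : 0 <= a - b)) ?subr_ge0//; lra.
pose gp f := grid_point theta0 r (M:=M) f.
pose good (f : {ffun 'I_(p + p + 1) -> 'I_(2 * M).+1}) :=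
  [exists k, eps / 2 <= `|gp f k ord0 - theta0 k ord0|].
pose C := expR e ^+ (N + N).
pose G f := [set y | (marginal_env (predictor (x N) (beta1 theta0))
   (predictor (x N) (beta2 theta0)) 0 s0 y <=
   C%:E * marginal_env (predictor (x N) (beta1 (gp f))) (predictor (x N) (beta2 (gp f))) e
      (var_comp (gp f)) y)%E].
pose B f := if good f then G f else set0.
have mG f : measurable (G f).
  rewrite -[X in measurable X]setTI; apply: emeasurable_fun_le => //.
    exact: measurable_marginal_env.
  by apply: measurable_funeM; exact: measurable_marginal_env.
have mB f : measurable (B f) by rewrite /B; case: ifP.
have gbox f : in_box (gp f) by exact: grid_point_near.
exists (\big[setU/set0]_f B f); split.
- exact: bigsetU_measurable.
- move=> y; rewrite -bigcup_seq/= => nB theta th k epsk.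
  have [f ftheta] := grid_point_exists r0 M0 th.
  rewrite ltNge; apply/negP => le0; apply: nB; exists f; first by rewrite /= mem_index_enum.
  have -> : B f = G f.
    rewrite /B ifT//; apply/existsP; exists k.
    have /andP[f1 f2] := ftheta k; rewrite -/(gp f) in f1 f2.
    exact: far f1 f2 epsk.
  rewrite /G/= -densityE; last by rewrite /Theta/= -/s0.
  apply: le_trans (density_le_cell_env M0 th ftheta y _).
    by rewrite lee_fin.
  exact: e1.
apply: (le_trans (measure_bigsetU_le_sum _ _ mB)).
have E0 : 0 <= (1 + expR (11 * L)) * expR (- (kappa * (eps / 2) ^+ 2 / 32 * N%:R)).
  by rewrite mulr_ge0 ?expR_ge0// addr_ge0 ?expR_ge0.
have Bf f : (mu (B f) <=
    ((1 + expR (11 * L)) * expR (- (kappa * (eps / 2) ^+ 2 / 32 * N%:R)))%:E)%E.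
  rewrite /B; case: ifP => [/existsP[k kf]|_]; last by rewrite measure0 lee_fin.
  rewrite hmu//.
  have box_pred t (tb : in_box t) i := box_predictor i i tb.
  have [q qsum qsep] := sep N (x N) (gp f) theta0 N0
    (fun i => (box_predictor i i (gbox f)).1) (fun i => (box_predictor i i (gbox f)).2)
    (fun i => (box_predictor i i box0).1) (fun i => (box_predictor i i box0).2)
    (box_var (gbox f)) (box_var box0) cN.
  have /andP[v1 _] := box_var (gbox f).
  have gv0 : 0 < var_comp (gp f) by exact: lt_le_trans v1.
  have C0 : 0 <= C by rewrite exprn_ge0 ?expR_ge0.
  have := likelihood_ratio_test e0 e2 gv0 s00 C0 qsep.
  under eq_integral do rewrite -densityE ?/Theta//=.
  move=> /le_trans; apply; rewrite lee_fin ler_pM ?expR_ge0//.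
  - by rewrite addr_ge0// mulr_ge0// exprn_ge0 ?expR_ge0.
  - rewrite lerD2l /C -!expRM_natl -expRD ler_expR.
    have Me : M%:R * e = L by rewrite /e mulrC divfK// gt_eqF.
    have : N%:R * e <= L by rewrite -Me ler_wpM2r.
    rewrite natrD -/M; lra.
  - rewrite ler_expR lerN2.
    have -> : kappa * (eps / 2) ^+ 2 / 32 * N%:R = kappa * N%:R * (eps / 2) ^+ 2 / 32 by ring.
    rewrite ler_wpM2r//; apply: le_trans qsum.
    rewrite ler_wpM2l ?mulr_ge0 ?(ltW kappa0) ?(ltW n0)//.
    rewrite (bigD1 k)//= -[leLHS]addr0 lerD//; last first.
      by rewrite sumr_ge0// => l _; exact: sqr_ge0.
    rewrite !mxE -[leRHS](real_normK (num_real _)) lerXn2r ?nnegrE//.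
      by rewrite divr_ge0// ltW.
    by move: kf; rewrite !mxE.
apply: (@le_trans _ _ (\sum_(f : {ffun 'I_(p + p + 1) -> 'I_(2 * M).+1})
   ((1 + expR (11 * L)) * expR (- (kappa * (eps / 2) ^+ 2 / 32 * N%:R)))%:E)%E).
  by apply: lee_sum => f _.
rewrite sumEFin lee_fin sumr_const card_ffun !card_ord -[leLHS]mulr_natl natrX.
by rewrite mulrA [X in X * _ <= _]mulrC.
Unshelve. all: by end_near. Qed.

End bad_event.

(** * Differentiability of the likelihood *)

Section differentiability.
Context (R : realType) (d : nat).
Implicit Types (a h : 'cV[R]_d) (f : 'cV[R]_d -> R).

Definition lin_form (G : 'I_d -> R) (h : 'cV[R]_d) : R := \sum_k h k ord0 * G k.

Lemma lin_form_linear G : linear (lin_form G).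
Proof.
move=> c h h'; rewrite /lin_form scaler_sumr -big_split/=; apply: eq_bigr => k _.
by rewrite !mxE mulrDl -mulrA.
Qed.

HB.instance Definition _ G := GRing.isLinear.Build R 'cV[R]_d R _ (lin_form G)
  (lin_form_linear G).

Lemma continuous_lin_form G : continuous (lin_form G).
Proof.
move=> h; apply: (@cvg_bigsum R _ (nbhs h)) => k; apply: cvgM; last exact: cvg_cst.
exact: coord_continuous.
Qed.

Lemma coord_le_norm h k : `|h k ord0| <= `|h|.
Proof.
rewrite [leRHS]/Num.norm/= mx_normrE.
exact: (le_bigmax_cond 0 (fun ij : 'I_d * 'I_1 => `|h ij.1 ij.2|) (j := (k, ord0))).
Qed.

(** A quadratic remainder, unlike a little-o, passes under an integral. *)
Lemma differentiable_quadratic f a (G : 'I_d -> R) (K rho : R) : 0 < rho ->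
  (forall h, `|h| <= rho -> `|f (h + a) - f a - lin_form G h| <= K * `|h| ^+ 2) ->
  differentiable f a.
Proof.
move=> rho0 fK.
have near0 (t : R) : 0 < t -> \forall h \near nbhs (0 : 'cV[R]_d), `|h| <= t.
  by move=> t0; exact: (@nbhs0_le R 'cV[R]_d t t0).
have E : (f : 'cV[R]_d -> R^o) \o shift a =
    (cst (f a : R^o) : 'cV[R]_d -> R^o) + (lin_form G : 'cV[R]_d -> R^o) +o_ (0 : 'cV[R]_d) id.
  apply/eqaddoP => _/posnumP[e]; near=> h.
  have hrho : `|h| <= rho.
    by near: h; exact: near0.
  have := fK h hrho.
  rewrite [X in _ -> `|X| <= _](_ : _ = f (h + a) - f a - lin_form G h); last first.
    by rewrite !fctE opprD addrA.
  move=> /le_trans; apply; rewrite expr2 mulrA ler_wpM2r//.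
  apply: (@le_trans _ _ ((`|K| + 1) * `|h|)).
    by rewrite ler_wpM2r// (le_trans (ler_norm _))// lerDl.
  have k0 : 0 < `|K| + 1 by rewrite ltr_wpDl.
  rewrite -ler_pdivlMl// mulrC; near: h; apply: near0; exact: divr_gt0.
apply/diff_locallyP.
have -> := diff_unique (@continuous_lin_form G) E.
by split; [exact: continuous_lin_form|].
Unshelve. all: by end_near. Qed.

End differentiability.

(** Fermat's rule on each coordinate line through the maximum. *)
Lemma gradient_max0 (R : realType) d (f : 'cV[R]_d -> R) (a : 'cV[R]_d) (e : R) :
  0 < e -> (forall b, `|b - a| < e -> differentiable f b) ->
  (forall b, `|b - a| < e -> f b <= f a) -> gradient f a = 0.
Proof.
move=> e0 df fmax; apply/colP => k; rewrite !mxE.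
set v := delta_mx k ord0.
pose g (t : R) := f (t *: v + a).
have -> : 'D_v f a = 'D_1 g 0.
  have E : (fun h : R => h^-1 *: ((f \o shift a) (h *: v) - f a)) =
           (fun h : R => h^-1 *: ((g \o shift 0) (h *: (1 : R)) - g 0)).
    by apply/funext => h /=; rewrite /g/= addr0 scale0r add0r [h *: 1]mulr1.
  by rewrite /derive E.
pose e' := e / (`|v| + 1).
have v0 : 0 < `|v| + 1 by rewrite ltr_wpDl.
have e'0 : 0 < e' by rewrite divr_gt0.
have near_a t : t \in `](- e'), e'[%R -> `|t *: v + a - a| < e.
  rewrite in_itv/= addrK normrZ -ltr_norml => te.
  have : `|t| * (`|v| + 1) < e by rewrite -ltr_pdivlMr.
  by apply: le_lt_trans; rewrite ler_wpM2l// lerDl.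
have dg t : t \in `](- e'), e'[%R -> derivable g t 1.
  move=> te; apply/derivable1_diffP.
  apply: (@differentiable_comp R R _ _ (fun t : R => t *: v + a) f).
    exact: ex_diff.
  by apply: df; exact: near_a.
have [_] : is_derive (0 : R) 1 g 0.
  apply: (derive1_at_max _ dg).
  - by rewrite ge0_cp// ltW.
  - by rewrite in_itv/= oppr_lt0 e'0.
  - by move=> t te; rewrite {2}/g scale0r add0r; apply: fmax; exact: near_a.
by [].
Qed.

Lemma differentiable_ln_comp (R : realType) (V : normedModType R) (f : V -> R) a :
  differentiable f a -> 0 < f a -> differentiable (fun b => ln (f b)) a.
Proof.
move=> df f0; apply: (@differentiable_comp R _ _ _ f (@ln R)) => //.
by apply/derivable1_diffP; apply: ex_derive; exact: is_derive1_ln.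
Qed.

Section expansions.
Context (R : realType).
Implicit Types (t b c s u w A : R).

Lemma ln1D_bounds t : `|t| <= 10^-1 -> t - 4 * t ^+ 2 <= ln (1 + t) <= t.
Proof.
move=> /ler_normlP[t1 t2]; have t0 : 0 < 1 + t by lra.
apply/andP; split; last by apply: le_ln1Dx; lra.
rewrite -[leLHS]expRK ler_ln ?posrE ?expR_gt0//.
apply: (le_trans (expR_le_quadratic _)); first by have := sqr_ge0 t; nra.
have -> : 2 * (t - 4 * t ^+ 2) ^+ 2 = 2 * t ^+ 2 * (1 - 4 * t) ^+ 2 by ring.
have : (1 - 4 * t) ^+ 2 <= 2 by nra.
have := sqr_ge0 t; nra.
Qed.

Lemma expR_remainder (t : R) : `|expR t - 1 - t| <= t ^+ 2 * expR `|t|.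
Proof.
have h1 := expR_ge1Dx t; have h2 := expR_ge1Dx (- t).
have e0 := expR_gt0 t; rewrite expRN in h2.
have h3 : expR t - 1 <= t * expR t.
  have : (1 - t) * expR t <= 1 by rewrite -ler_pdivlMr// div1r.
  lra.
rewrite ger0_norm; last by lra.
have [t0|t0] := leP 0 t.
  rewrite ger0_norm//; nra.
rewrite ltr0_norm//; have : 1 <= expR (- t) by rewrite -[leLHS]expR0 ler_expR; lra.
have := sqr_ge0 t; nra.
Qed.

(** Exponential of an expansion: [l] is the linear part of the exponent [q]. *)
Lemma expR_expansion (q l A t rho : R) : 1 <= A -> 0 <= t -> t <= rho -> rho <= 1 ->
  `|l| <= A * t -> `|q - l| <= A * t ^+ 2 ->
  `|expR q - 1 - l| <= t ^+ 2 * (5 * A ^+ 2 * expR (2 * A * rho)).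
Proof.
move=> A1 t0 trho rho1 lA qA.
have qn : `|q| <= 2 * A * t.
  have -> : q = l + (q - l) by ring.
  apply: (le_trans (ler_normD _ _)).
  have : A * t ^+ 2 <= A * t by rewrite ler_wpM2l ?expr2 ?ler_piMr//; lra.
  lra.
have E1 : 1 <= expR (2 * A * rho) by rewrite -[leLHS]expR0 ler_expR !mulr_ge0//; lra.
have R1 : t ^+ 2 * A <= t ^+ 2 * (A ^+ 2 * expR (2 * A * rho)).
  rewrite ler_wpM2l ?sqr_ge0//; nra.
have R2 : q ^+ 2 * expR `|q| <= t ^+ 2 * (4 * A ^+ 2 * expR (2 * A * rho)).
  rewrite mulrA ler_pM ?sqr_ge0 ?expR_ge0//.
    rewrite -(real_normK (num_real q)).
    have -> : t ^+ 2 * (4 * A ^+ 2) = (2 * A * t) ^+ 2 by ring.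
    by rewrite lerXn2r// nnegrE// (le_trans _ qn).
  rewrite ler_expR (le_trans qn)// ler_wpM2l//; lra.
have -> : expR q - 1 - l = (expR q - 1 - q) + (q - l) by ring.
apply: (le_trans (ler_normD _ _)).
have := expR_remainder q; lra.
Qed.

Lemma gauss1_shift w a : gauss 1 (w - a) = gauss 1 w * expR (w * a - a ^+ 2 / 2).
Proof.
by rewrite !gaussE// -[RHS]mulrA -expRD; congr (_ * expR _); field.
Qed.

Definition softplus t : R := ln (1 + expR t).

Lemma logit_pmf_shift h b k :
  logit_pmf (h + b) k = logit_pmf h k * expR (k%:R * b - (softplus (h + b) - softplus h)).
Proof. by rewrite /logit_pmf -expRD; congr expR; rewrite /softplus; ring. Qed.

Lemma softplus_expansion h b : `|b| <= 20^-1 ->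
  `|softplus (h + b) - softplus h - logit_pmf h true * b| <= 4 * b ^+ 2.
Proof.
move=> b20; set L := logit_pmf h true.
have h0 : 0 < 1 + expR h by rewrite addr_gt0// expR_gt0.
have L0 : 0 <= L by exact: logit_pmf_ge0.
have L1 : L <= 1 by exact: logit_pmf_le1.
have /ler_normlP[b1 b2] := b20.
pose v := L * (expR b - 1).
have vE : softplus (h + b) - softplus h = ln (1 + v).
  rewrite -ln_div ?posrE ?addr_gt0 ?expR_gt0//; congr ln.
  by rewrite /v /L logit_pmfT expRD; field; rewrite gt_eqF.
have e1 := expR_ge1Dx b; have e2 : expR b <= 1 + b + 2 * b ^+ 2.
  by apply: expR_le_quadratic; lra.
have b0 := sqr_ge0 b.
have v1 : L * b <= v by rewrite /v ler_wpM2l//; lra.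
have v2 : v <= L * b + 2 * b ^+ 2.
  rewrite /v; have : L * (expR b - 1) <= L * (b + 2 * b ^+ 2) by rewrite ler_wpM2l//; lra.
  nra.
have Lb : `|L * b| <= 10^-1.
  rewrite normrM ger0_norm//; apply: (@le_trans _ _ `|b|); last by lra.
  by rewrite ler_piMl.
have /andP[l1 _] := ln1D_bounds Lb.
have Lb2 : (L * b) ^+ 2 <= b ^+ 2.
  by rewrite exprMn ler_piMl// expr_le1.
have /ler_normlP[lb1 lb2] := Lb.
have p1 : 0 < 1 + L * b by lra.
have p2 : 0 < 1 + v by lra.
have l2 : ln (1 + L * b) <= ln (1 + v) by rewrite ler_ln ?posrE// lerD2l.
have l3 : ln (1 + v) <= v by apply: le_ln1Dx; lra.
by rewrite vE ler_norml; apply/andP; split; lra.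
Qed.

Lemma gauss_var_shift s c u : 0 < s -> 0 < s + c ->
  gauss (s + c) u = gauss s u *
    expR (- (ln (1 + c / s) / 2) + u ^+ 2 / 2 * (c / (s * (s + c)))).
Proof.
move=> s0 sc0; rewrite !gaussE//.
have r0 : 0 < 1 + c / s.
  have -> : 1 + c / s = (s + c) / s by field; rewrite gt_eqF.
  exact: divr_gt0.
have -> : expR (- (ln (1 + c / s) / 2) + u ^+ 2 / 2 * (c / (s * (s + c)))) =
  Num.sqrt (1 + c / s)^-1 * expR (u ^+ 2 / 2 * (c / (s * (s + c)))).
  rewrite expRD; congr (_ * _); apply/eqP.
  rewrite -(eqrXn2 (n:=2)) ?expR_ge0 ?sqrtr_ge0//; apply/eqP.
  rewrite sqr_sqrtr ?invr_ge0 ?ltW// -expRM_natl.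
  have -> : 2 * - (ln (1 + c / s) / 2) = - ln (1 + c / s) by field.
  by rewrite expRN lnK// posrE.
rewrite mulrACA -expRD -sqrtrM; last first.
  by rewrite invr_ge0 !mulr_ge0 ?pi_ge0 ?(ltW s0).
have := @pi_gt0 R; move: (pi : R) => q q0.
congr (Num.sqrt _ * expR _); field; rewrite ?gt_eqF//.
Qed.

Lemma gauss_var_expansion s c u : 0 < s -> `|c| <= s / 10 ->
  `|(- (ln (1 + c / s) / 2) + u ^+ 2 / 2 * (c / (s * (s + c)))) -
    (- (2 * s)^-1 + u ^+ 2 / (2 * s ^+ 2)) * c| <=
  (2 / s ^+ 2 + u ^+ 2 / s ^+ 3) * c ^+ 2.
Proof.
move=> s0 cs; have s0' : s != 0 by rewrite gt_eqF.
have /ler_normlP[c1 c2] := cs.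
have sc0 : s / 2 < s + c by lra.
have sc00 : 0 < s + c by lra.
have t10 : `|c / s| <= 10^-1.
  by rewrite normrM (gtr0_norm (_ : 0 < s^-1)) ?invr_gt0// ler_pdivrMr//; lra.
have /andP[l1 l2] := ln1D_bounds t10.
have E1 : `|c / s - ln (1 + c / s)| <= 4 * (c / s) ^+ 2.
  by rewrite ler_norml; apply/andP; split; have := sqr_ge0 (c / s); lra.
have -> : (- (ln (1 + c / s) / 2) + u ^+ 2 / 2 * (c / (s * (s + c)))) -
    (- (2 * s)^-1 + u ^+ 2 / (2 * s ^+ 2)) * c =
   (c / s - ln (1 + c / s)) / 2 - u ^+ 2 * c ^+ 2 / (2 * s ^+ 2 * (s + c)).
  by field; rewrite s0' gt_eqF.
apply: (le_trans (ler_normB _ _)); rewrite [leRHS]mulrDl lerD//.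
  rewrite normrM (ger0_norm (_ : 0 <= 2^-1)) ?invr_ge0//.
  have -> : 2 / s ^+ 2 * c ^+ 2 = 4 * (c / s) ^+ 2 / 2 by field.
  by rewrite ler_wpM2r ?invr_ge0.
have den0 : 0 < 2 * s ^+ 2 * (s + c) by rewrite !mulr_gt0 ?exprn_gt0.
rewrite ger0_norm; last first.
  by rewrite divr_ge0 ?(ltW den0)// mulr_ge0 ?sqr_ge0.
rewrite [leLHS]mulrAC ler_wpM2r ?sqr_ge0// ler_wpM2l ?sqr_ge0//.
rewrite lef_pV2 ?posrE ?exprn_gt0//.
have := exprn_gt0 2 s0; rewrite exprS; nra.
Qed.

(** Polynomial growth is absorbed by part of the Gaussian decay. *)
Lemma gaussian_domination C s : 1 <= C -> 0 < s -> exists2 K : R, 0 <= K &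
  forall S rho, 0 <= S -> 0 <= rho -> 2 * C * rho <= (16 * s)^-1 ->
    5 * (C * (1 + S)) ^+ 2 * expR (2 * (C * (1 + S)) * rho) <= K * expR (S / (4 * s)).
Proof.
move=> C1 s0; pose k := 1 + 16 * s.
have k1 : 1 <= k by rewrite /k lerDl mulr_ge0// ltW.
exists (5 * C ^+ 2 * k ^+ 2 * expR (16 * s)^-1).
  by rewrite !(sqr_ge0, expR_ge0, mulr_ge0).
move=> S rho S0 rho0 Crho.
have sv0 : 0 < (16 * s)^-1 by rewrite invr_gt0 mulr_gt0.
have lin : 1 + S <= k * expR (S / (16 * s)).
  have := expR_ge1Dx (S / (16 * s)).
  have : 0 <= S / (16 * s) by rewrite divr_ge0// mulr_ge0// ltW.
  have : S = 16 * s * (S / (16 * s)) by field; rewrite gt_eqF.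
  move: (S / _) => z Sz z0 ez; rewrite Sz /k; nra.
have e1 : expR (2 * (C * (1 + S)) * rho) <= expR (16 * s)^-1 * expR (S / (16 * s)).
  rewrite -expRD ler_expR.
  have -> : 2 * (C * (1 + S)) * rho = (2 * C * rho) * (1 + S) by ring.
  have -> : (16 * s)^-1 + S / (16 * s) = (16 * s)^-1 * (1 + S) by ring.
  by rewrite ler_wpM2r//; lra.
have e2 : (1 + S) ^+ 2 <= k ^+ 2 * expR (S / (8 * s)).
  have -> : k ^+ 2 * expR (S / (8 * s)) = (k * expR (S / (16 * s))) ^+ 2.
    by rewrite exprMn -expRM_natl; congr (_ * expR _); field; rewrite gt_eqF.
  by rewrite lerXn2r// nnegrE ?mulr_ge0 ?expR_ge0//; lra.
have e3 : expR (S / (8 * s)) * expR (S / (16 * s)) <= expR (S / (4 * s)).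
  rewrite -expRD ler_expR.
  have : 0 <= S / (16 * s) by rewrite divr_ge0// mulr_ge0// ltW.
  have -> : S / (8 * s) = 2 * (S / (16 * s)) by field; rewrite gt_eqF.
  have -> : S / (4 * s) = 4 * (S / (16 * s)) by field; rewrite gt_eqF.
  lra.
apply: (@le_trans _ _ (5 * C ^+ 2 * (k ^+ 2 * expR (S / (8 * s))) *
    (expR (16 * s)^-1 * expR (S / (16 * s))))).
  have -> : 5 * (C * (1 + S)) ^+ 2 = 5 * C ^+ 2 * (1 + S) ^+ 2 by ring.
  apply: ler_pM.
  - by rewrite !(sqr_ge0, mulr_ge0).
  - exact: expR_ge0.
  - by rewrite ler_wpM2l// !(sqr_ge0, mulr_ge0).
  - exact: e1.
have -> : 5 * C ^+ 2 * (k ^+ 2 * expR (S / (8 * s))) *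
    (expR (16 * s)^-1 * expR (S / (16 * s))) =
  5 * C ^+ 2 * k ^+ 2 * expR (16 * s)^-1 * (expR (S / (8 * s)) * expR (S / (16 * s))) by ring.
by rewrite ler_wpM2l// !(sqr_ge0, expR_ge0, mulr_ge0).
Qed.

End expansions.

Section differentiation_under_the_integral.
Context (R : realType) (n : nat) d (T : measurableType d) (mu : {measure set T -> \bar R}).
Implicit Types (h a : 'cV[R]_n) (u : T).

Lemma linear_lin_form (f : 'cV[R]_n -> R) :
  (forall c h h', f (c *: h + h') = c * f h + f h') ->
  forall h, f h = lin_form (fun k => f (delta_mx k ord0)) h.
Proof.
move=> fl h.
have f0 : f 0 = 0.
  by have := fl 1 0 0; rewrite scaler0 addr0 mul1r => /eqP; rewrite -subr_eq subrr eq_sym => /eqP.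
have fs (s : seq 'I_n) (c : 'I_n -> R) : f (\sum_(k <- s) c k *: delta_mx k ord0) =
    \sum_(k <- s) c k * f (delta_mx k ord0).
  by elim: s => [|k s IH]; rewrite ?big_nil ?big_cons// fl IH.
rewrite /lin_form -fs; congr f.
apply/colP => k; rewrite summxE (bigD1 k)//= big1 ?addr0; last first.
  by move=> l lk; rewrite !mxE eq_sym (negbTE lk) mulr0.
by rewrite !mxE !eqxx mulr1.
Qed.

(** One integrable [B] dominates the differential [D] and the quadratic remainder. *)
Lemma differentiable_Rintegral (F D : 'cV[R]_n -> T -> R) (B : T -> R) a (rho : R) :
  0 < rho ->
  (forall h, `|h| <= rho -> mu.-integrable setT (EFin \o F (h + a))) ->
  (forall h, measurable_fun setT (D h)) ->
  (forall c h h' u, D (c *: h + h') u = c * D h u + D h' u) ->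
  mu.-integrable setT (EFin \o B) ->
  (forall h u, `|D h u| <= `|h| * B u) ->
  (forall h u, `|h| <= rho -> `|F (h + a) u - F a u - D h u| <= `|h| ^+ 2 * B u) ->
  differentiable (fun b => \int[mu]_u F b u) a.
Proof.
move=> rho0 iF mD linD iB DB FDB.
have iZB t : mu.-integrable setT (EFin \o (fun u => t * B u)).
  exact: (integrableZl measurableT t iB).
have iD h : mu.-integrable setT (EFin \o D h).
  apply: (le_integrable measurableT _ _ (iZB `|h|)).
    by apply/measurable_EFinP; exact: mD.
  move=> u _ /=; rewrite lee_fin; apply: (le_trans (DB h u)); exact: ler_norm.
pose G h := \int[mu]_u D h u.
have Glin c h h' : G (c *: h + h') = c * G h + G h'.
  have iDc : mu.-integrable setT (EFin \o (fun u => c * D h u)).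
    exact: (integrableZl measurableT c (iD h)).
  rewrite /G -RintegralZl// -RintegralD//.
  by apply: eq_Rintegral => u _; rewrite linD.
have iFa : mu.-integrable setT (EFin \o F a).
  by have := iF 0; rewrite add0r; apply; rewrite normr0 ltW.
apply: (@differentiable_quadratic _ _ _ _ (fun k => G (delta_mx k ord0))
  (\int[mu]_u B u) rho rho0) => h hrho.
rewrite -(linear_lin_form Glin) /G.
have iFFa : mu.-integrable setT (EFin \o (fun u => F (h + a) u - F a u)).
  exact: (integrableB measurableT (iF h hrho) iFa).
rewrite -RintegralB//; last exact: iF.
rewrite -RintegralB//.
apply: (le_trans (le_normr_Rintegral measurableT _)).
  exact: (integrableB measurableT iFFa (iD h)).
rewrite mulrC -RintegralZl//; apply: le_Rintegral => //.
  exact: (integrable_norm (integrableB measurableT iFFa (iD h))).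
by move=> u _; exact: FDB.
Qed.

End differentiation_under_the_integral.

Section density_differentiable.
Context (R : realType) (p N : nat).
Notation leb := (@lebesgue_measure R).
Variable x : 'I_N -> 'I_N -> 'cV[R]_p.
Hypothesis hx : forall i j, enorm (x i j) <= 1.
Variables (theta : param R p) (y : observation R N).
Hypothesis theta_s : Theta theta.
Implicit Types (h : param R p) (u : effects R N).

Let s := var_comp theta.
Let s0 : 0 < s. Proof. exact: theta_s. Qed.
Let m1 i j := predictor x (beta1 theta) i j.
Let m2 i j := predictor x (beta2 theta) i j.
Let z i j := tnth (tnth y i) j.
Let w u i j := (z i j).1 - (m1 i j + pair_effect u i j).
Let eta2 u i j := m2 i j + pair_effect u i j.
Let sumsq u := \sum_k (tnth u k : R) ^+ 2.

Let J b u := joint_env (predictor x (beta1 b)) (predictor x (beta2 b)) 0 (var_comp b) y u.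

Let fixed_score h u i j :=
  w u i j * predictor x (beta1 h) i j +
  ((z i j).2%:R - logit_pmf (eta2 u i j) true) * predictor x (beta2 h) i j.

Let var_score h (v : R) := (- (2 * s)^-1 + v ^+ 2 / (2 * s ^+ 2)) * var_comp h.

(** Directional derivative along [h] of the complete-data log-likelihood. *)
Let score h u := \sum_i \sum_j fixed_score h u i j + \sum_k var_score h (tnth u k).

Let fixed_ratio h u i j :=
  (w u i j * predictor x (beta1 h) i j - predictor x (beta1 h) i j ^+ 2 / 2) +
  ((z i j).2%:R * predictor x (beta2 h) i j -
    (softplus (eta2 u i j + predictor x (beta2 h) i j) - softplus (eta2 u i j))).

Let var_ratio h (v : R) := - (ln (1 + var_comp h / s) / 2) +
  v ^+ 2 / 2 * (var_comp h / (s * (s + var_comp h))).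

Let log_ratio h u := \sum_i \sum_j fixed_ratio h u i j + \sum_k var_ratio h (tnth u k).

Lemma beta1D (b b' : param R p) : beta1 (b + b') = beta1 b + beta1 b'.
Proof. by rewrite /beta1 !linearD. Qed.
Lemma beta2D (b b' : param R p) : beta2 (b + b') = beta2 b + beta2 b'.
Proof. by rewrite /beta2 !linearD. Qed.
Lemma beta1Z c (b : param R p) : beta1 (c *: b) = c *: beta1 b.
Proof. by rewrite /beta1 !linearZ. Qed.
Lemma beta2Z c (b : param R p) : beta2 (c *: b) = c *: beta2 b.
Proof. by rewrite /beta2 !linearZ. Qed.
Lemma predictorD b b' i j : predictor x (b + b') i j = predictor x b i j + predictor x b' i j.
Proof. by rewrite /predictor mulmxDr mxE. Qed.
Lemma predictorZ c b i j : predictor x (c *: b) i j = c * predictor x b i j.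
Proof. by rewrite /predictor -scalemxAr mxE. Qed.
Lemma var_compD (b b' : param R p) : var_comp (b + b') = var_comp b + var_comp b'.
Proof. by rewrite !var_compE mxE. Qed.
Lemma var_compZ c (b : param R p) : var_comp (c *: b) = c * var_comp b.
Proof. by rewrite !var_compE mxE. Qed.

Let score_linear c h h' u : score (c *: h + h') u = c * score h u + score h' u.
Proof.
rewrite /score mulrDr addrACA; congr (_ + _).
  rewrite mulr_sumr -big_split/=; apply: eq_bigr => i _.
  rewrite mulr_sumr -big_split/=; apply: eq_bigr => j _.
  by rewrite /fixed_score beta1D beta1Z beta2D beta2Z !predictorD !predictorZ; ring.
rewrite mulr_sumr -big_split/=; apply: eq_bigr => k _.
by rewrite /var_score var_compD var_compZ; ring.
Qed.

Let joint_ratio h u : 0 < s + var_comp h -> J (h + theta) u = J theta u * expR (log_ratio h u).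
Proof.
move=> sh0; rewrite /J /joint_env /log_ratio expRD mulrACA; congr (_ * _).
  rewrite expR_sum -big_split/=; apply: eq_bigr => i _.
  rewrite expR_sum -big_split/=; apply: eq_bigr => j _.
  rewrite !env_lik0 /lik beta1D beta2D !predictorD /fixed_ratio expRD mulrACA.
  congr (_ * _).
    rewrite -gauss1_shift; congr gauss; rewrite /w /z /m1; ring.
  by rewrite -logit_pmf_shift; congr logit_pmf; rewrite /eta2 /m2; ring.
rewrite expR_sum -big_split/=; apply: eq_bigr => k _.
by rewrite var_compD addrC gauss_var_shift.
Qed.

Let pred_le (b : 'cV[R]_p) i j t : (forall k, `|b k ord0| <= t) ->
  `|predictor x b i j| <= p%:R * t.
Proof.
move=> bt; apply: (le_trans (predictor_le _ (hx i j))).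
rewrite -[X in X%:R]card_ord mulr_natl -sumr_const; exact: ler_sum.
Qed.

Let pred1_le h i j : `|predictor x (beta1 h) i j| <= p%:R * `|h|.
Proof. by apply: pred_le => k; rewrite beta1E coord_le_norm. Qed.

Let pred2_le h i j : `|predictor x (beta2 h) i j| <= p%:R * `|h|.
Proof. by apply: pred_le => k; rewrite beta2E coord_le_norm. Qed.

Let var_le h : `|var_comp h| <= `|h|.
Proof. by rewrite var_compE coord_le_norm. Qed.

Let W := \sum_i \sum_j `|(z i j).1 - m1 i j|.

Let sumsq_ge0 u : 0 <= sumsq u.
Proof. by rewrite sumr_ge0// => k _; exact: sqr_ge0. Qed.

Let coord_sumsq u k : `|tnth u k : R| <= (1 + sumsq u) / 2.
Proof.
have : (tnth u k : R) ^+ 2 <= sumsq u.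
  by rewrite /sumsq (bigD1 k)//= lerDl sumr_ge0// => l _; exact: sqr_ge0.
rewrite -(real_normK (num_real (tnth u k : R))); have := sqr_ge0 (`|tnth u k : R| - 1).
by move: `|tnth u k : R| => t; nra.
Qed.

Let w_le u i j : `|w u i j| <= W + 1 + sumsq u.
Proof.
have -> : w u i j = ((z i j).1 - m1 i j) - (tnth u (lshift N i) + tnth u (rshift N j)).
  by rewrite /w /pair_effect; ring.
apply: (le_trans (ler_normB _ _)); rewrite -addrA lerD//.
  rewrite /W (bigD1 i)//= (bigD1 j)//= -addrA lerDl addr_ge0 ?sumr_ge0//.
  by move=> k _; rewrite sumr_ge0.
apply: (le_trans (ler_normD _ _)).
by have := coord_sumsq u (lshift N i); have := coord_sumsq u (rshift N j); lra.
Qed.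

Let C1 := (N * N)%:R * (p%:R * (W + 2)) + N%:R / s + (2 * s ^+ 2)^-1.
Let C2 := (N * N)%:R * (5 * p%:R ^+ 2) + 4 * N%:R / s ^+ 2 + (s ^+ 3)^-1.
Let C := 1 + C1 + C2.

Let W0 : 0 <= W.
Proof. by rewrite sumr_ge0// => i _; rewrite sumr_ge0. Qed.

Let C10 : 0 <= C1.
Proof.
rewrite !addr_ge0// ?mulr_ge0// ?invr_ge0 ?mulr_ge0 ?sqr_ge0// ?(ltW s0)//.
by rewrite addr_ge0.
Qed.

Let C20 : 0 <= C2.
Proof.
by rewrite !addr_ge0// ?mulr_ge0// ?invr_ge0 ?exprn_ge0// ?(ltW s0).
Qed.

Let sum2_const (c : R) : \sum_(i < N) \sum_(j < N) c = (N * N)%:R * c.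
Proof. by rewrite !sumr_const card_ord -mulrnA mulr_natl. Qed.

Let score_le h u : `|score h u| <= C * (1 + sumsq u) * `|h|.
Proof.
have S0 := sumsq_ge0 u; have h0 := normr_ge0 h.
have fixed : `|\sum_i \sum_j fixed_score h u i j| <=
    (N * N)%:R * (p%:R * (W + 2)) * (1 + sumsq u) * `|h|.
  apply: (le_trans (ler_norm_sum _ _ _)).
  apply: (@le_trans _ _ (\sum_(i < N) \sum_(j < N) (p%:R * (W + 2) * (1 + sumsq u) * `|h|))).
    apply: ler_sum => i _; apply: (le_trans (ler_norm_sum _ _ _)).
    apply: ler_sum => j _; apply: (le_trans (ler_normD _ _)).
    have f1 : `|w u i j * predictor x (beta1 h) i j| <= (W + 1 + sumsq u) * (p%:R * `|h|).
      by rewrite normrM ler_pM.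
    have f2 : `|((z i j).2%:R - logit_pmf (eta2 u i j) true) * predictor x (beta2 h) i j| <=
        1 * (p%:R * `|h|).
      rewrite normrM ler_pM//.
      have l0 := logit_pmf_ge0 (eta2 u i j) true; have l1 := logit_pmf_le1 (eta2 u i j) true.
      by rewrite ler_norml; case: (z i j).2 => /=; apply/andP; split; lra.
    have ph : 0 <= p%:R * `|h| by rewrite mulr_ge0.
    have : (W + 1 + sumsq u + 1) * (p%:R * `|h|) <= (W + 2) * (1 + sumsq u) * (p%:R * `|h|).
      by rewrite ler_wpM2r//; have := mulr_ge0 W0 S0; lra.
    lra.
  by rewrite sum2_const !mulrA.
have var : `|\sum_k var_score h (tnth u k)| <=
    (N%:R / s + (2 * s ^+ 2)^-1) * (1 + sumsq u) * `|h|.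
  apply: (le_trans (ler_norm_sum _ _ _)).
  apply: (@le_trans _ _ (\sum_(k < N + N)
     ((2 * s)^-1 + (tnth u k : R) ^+ 2 / (2 * s ^+ 2)) * `|h|)).
    apply: ler_sum => k _; rewrite normrM ler_pM//.
    apply: (le_trans (ler_normD _ _)); rewrite normrN !ger0_norm//.
      by rewrite divr_ge0 ?sqr_ge0// mulr_ge0 ?sqr_ge0.
    by rewrite invr_ge0 mulr_ge0// ltW.
  rewrite -mulr_suml ler_wpM2r// big_split/= sumr_const card_ord -mulr_suml -/(sumsq u).
  have -> : (2 * s)^-1 *+ (N + N) = N%:R / s.
    by rewrite -[LHS]mulr_natl natrD; field; rewrite gt_eqF.
  have i0 : 0 <= (2 * s ^+ 2)^-1 by rewrite invr_ge0 mulr_ge0 ?sqr_ge0.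
  have i1 : 0 <= N%:R / s by rewrite divr_ge0// ltW.
  nra.
apply: (le_trans (ler_normD _ _)).
have : 0 <= (1 + C2) * (1 + sumsq u) * `|h| by rewrite !mulr_ge0// addr_ge0.
rewrite /C /C1; lra.
Qed.

Let log_ratio_le h u : p%:R * `|h| <= 20^-1 -> `|h| <= s / 10 ->
  `|log_ratio h u - score h u| <= C * (1 + sumsq u) * `|h| ^+ 2.
Proof.
move=> ph sh; have S0 := sumsq_ge0 u; have h0 := sqr_ge0 `|h|.
have fixed : `|\sum_i \sum_j fixed_ratio h u i j - \sum_i \sum_j fixed_score h u i j| <=
    (N * N)%:R * (5 * p%:R ^+ 2) * `|h| ^+ 2.
  rewrite -sumrB; apply: (le_trans (ler_norm_sum _ _ _)).
  apply: (@le_trans _ _ (\sum_(i < N) \sum_(j < N) (5 * p%:R ^+ 2 * `|h| ^+ 2))).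
    apply: ler_sum => i _; rewrite -sumrB; apply: (le_trans (ler_norm_sum _ _ _)).
    apply: ler_sum => j _.
    set a := predictor x (beta1 h) i j; set b := predictor x (beta2 h) i j.
    have -> : fixed_ratio h u i j - fixed_score h u i j = - (a ^+ 2 / 2) -
      (softplus (eta2 u i j + b) - softplus (eta2 u i j) - logit_pmf (eta2 u i j) true * b).
      by rewrite /fixed_ratio /fixed_score -/a -/b; ring.
    have sq (t : R) : `|t| <= p%:R * `|h| -> t ^+ 2 <= p%:R ^+ 2 * `|h| ^+ 2.
      by move=> tp; rewrite -(real_normK (num_real t)) -exprMn lerXn2r// nnegrE mulr_ge0.
    have a2 := sq _ (pred1_le h i j); have b2 := sq _ (pred2_le h i j).
    rewrite -/a in a2; rewrite -/b in b2.
    have b20 : `|b| <= 20^-1 by exact: le_trans (pred2_le h i j) ph.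
    apply: (le_trans (ler_normB _ _)); rewrite normrN (ger0_norm (_ : 0 <= a ^+ 2 / 2)).
      have := softplus_expansion (eta2 u i j) b20; have := sqr_ge0 a; lra.
    by rewrite divr_ge0 ?sqr_ge0.
  by rewrite sum2_const !mulrA.
have var : `|\sum_k var_ratio h (tnth u k) - \sum_k var_score h (tnth u k)| <=
    (4 * N%:R / s ^+ 2 + (s ^+ 3)^-1) * (1 + sumsq u) * `|h| ^+ 2.
  rewrite -sumrB; apply: (le_trans (ler_norm_sum _ _ _)).
  apply: (@le_trans _ _ (\sum_(k < N + N)
     (2 / s ^+ 2 + (tnth u k : R) ^+ 2 / s ^+ 3) * `|h| ^+ 2)).
    apply: ler_sum => k _.
    apply: (le_trans (gauss_var_expansion _ s0 (le_trans (var_le h) sh))).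
    rewrite ler_wpM2l//; last first.
      by rewrite -(real_normK (num_real (var_comp h))) lerXn2r// nnegrE.
    by rewrite addr_ge0// divr_ge0 ?sqr_ge0 ?exprn_ge0 ?(ltW s0).
  rewrite -mulr_suml ler_wpM2r// big_split/= sumr_const card_ord -mulr_suml -/(sumsq u).
  have -> : (2 / s ^+ 2) *+ (N + N) = 4 * N%:R / s ^+ 2.
    by rewrite -[LHS]mulr_natl natrD; ring.
  have i0 : 0 <= (s ^+ 3)^-1 by rewrite invr_ge0 exprn_ge0// ltW.
  have i1 : 0 <= 4 * N%:R / s ^+ 2 by rewrite divr_ge0 ?sqr_ge0 ?mulr_ge0.
  nra.
have -> : log_ratio h u - score h u =
  (\sum_i \sum_j fixed_ratio h u i j - \sum_i \sum_j fixed_score h u i j) +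
  (\sum_k var_ratio h (tnth u k) - \sum_k var_score h (tnth u k)).
  by rewrite /log_ratio /score; ring.
apply: (le_trans (ler_normD _ _)).
have : 0 <= (1 + C1) * (1 + sumsq u) * `|h| ^+ 2 by rewrite !mulr_ge0// addr_ge0.
have : 0 <= (N * N)%:R * (5 * p%:R ^+ 2) * sumsq u * `|h| ^+ 2.
  by rewrite !mulr_ge0// sqr_ge0.
rewrite /C /C2; lra.
Qed.

Let Gamma u := \prod_k gauss (2 * s) (tnth u k).

Let gauss_double (v : R) : gauss s v = Num.sqrt 2 * expR (- v ^+ 2 / (4 * s)) * gauss (2 * s) v.
Proof.
have s2 : 0 < 2 * s by rewrite mulr_gt0.
rewrite !gaussE//; have := @pi_gt0 R; move: (pi : R) => q q0.
rewrite mulrACA -expRD -sqrtrM//; congr (Num.sqrt _ * expR _).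
  by field; rewrite !gt_eqF.
by field; rewrite gt_eqF.
Qed.

Let joint_le u : J theta u <= Num.sqrt 2 ^+ (N + N) * expR (- (sumsq u / (4 * s))) * Gamma u.
Proof.
apply: (le_trans (joint_env0_le _ _ _ _ _)); rewrite -/s.
rewrite /sumsq mulr_suml -sumrN expR_sum -[X in _ ^+ X]card_ord -prodr_const -!big_split/=.
by apply: ler_prod => k _; rewrite gauss_ge0/= gauss_double mulNr.
Qed.

Let J0 u : 0 <= J theta u. Proof. exact: joint_env_ge0. Qed.

Let measurable_score h : measurable_fun setT (score h).
Proof.
have mid : measurable_fun [set: effects R N] id by exact: measurable_id.
have mpe i j : measurable_fun setT (fun u => pair_effect u i j).
  by apply: measurable_funD; exact: (measurable_effect _ mid).
apply: measurable_funD.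
  apply: measurable_sum => i; apply: measurable_sum => j; apply: measurable_funD.
    apply: measurable_funM => //; apply: measurable_funB => //.
    exact: measurable_funD.
  apply: measurable_funM => //; apply: measurable_funB => //.
  by apply: measurable_logit_pmf => //; exact: measurable_funD.
apply: measurable_sum => k; apply: measurable_funM => //; apply: measurable_funD => //.
apply: measurable_funM => //; apply: measurable_funX.
exact: (measurable_effect _ mid).
Qed.

Let integrable_joint b : Theta b ->
  (power_measure leb (N + N)).-integrable setT (EFin \o J b).
Proof.
have mid : measurable_fun [set: effects R N] id by exact: measurable_id.
move=> bT; apply/integrableP; split.
  by apply/measurable_EFinP; exact: measurable_joint_env.
apply: le_lt_trans (marginal_env0_lty (predictor x (beta1 b)) (predictor x (beta2 b)) y bT).
by under eq_integral => u _ do rewrite /= ger0_norm ?joint_env_ge0//.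
Qed.

(** Differentiation under the integral sign: the complete-data density at
    [h + theta] is the one at [theta] times [exp (score h + O (|h| ^ 2))] with a
    remainder growing quadratically in the random effects, which the Gaussian
    density of the effects absorbs. *)
Lemma differentiable_density : differentiable (fun b => density x b y) theta.
Proof.
have Cge1 : 1 <= C by rewrite /C -addrA lerDl addr_ge0.
have [K K0 HK] := gaussian_domination Cge1 s0.
have s20 : 0 < 2 * s by rewrite mulr_gt0.
pose c := Num.sqrt 2 ^+ (N + N) * K.
have c0 : 0 <= c by rewrite mulr_ge0// exprn_ge0.
have Gamma0 u : 0 <= Gamma u by rewrite prodr_ge0// => k _; exact: gauss_ge0.
pose r := 1 + 20 * p%:R + 10 / s + 32 * C * s.
have C0 : 0 <= C by lra.
have Cs : 0 <= 32 * C * s by rewrite !mulr_ge0// ltW.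
have s10 : 0 <= 10 / s by rewrite divr_ge0// ltW.
have p0 : 0 <= p%:R :> R by [].
have r1 : 1 <= r by rewrite /r; lra.
have r0 : 0 < r by lra.
have rho0 : 0 < r^-1 by rewrite invr_gt0.
have dom u : J theta u * (K * expR (sumsq u / (4 * s))) <= c * Gamma u.
  apply: (le_trans (ler_wpM2r _ (joint_le u))); first by rewrite mulr_ge0 ?expR_ge0.
  have -> : Num.sqrt 2 ^+ (N + N) * expR (- (sumsq u / (4 * s))) * Gamma u *
      (K * expR (sumsq u / (4 * s))) =
     c * Gamma u * (expR (sumsq u / (4 * s)) * expR (- (sumsq u / (4 * s)))).
    by rewrite /c; ring.
  by rewrite expRxMexpNx_1 mulr1.
have small h : `|h| <= r^-1 -> [/\ p%:R * `|h| <= 20^-1, `|h| <= s / 10, `|h| <= 1 &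
    2 * C * r^-1 <= (16 * s)^-1].
  move=> hr; have hr1 : `|h| * r <= 1 by rewrite -ler_pdivlMr// div1r.
  have h0 := normr_ge0 h.
  have q1 : 0 <= `|h| * p%:R by rewrite mulr_ge0.
  have q2 : 0 <= `|h| * (10 / s) by rewrite mulr_ge0.
  have q3 : 0 <= `|h| * (32 * C * s) by rewrite mulr_ge0.
  have rE : `|h| * r = `|h| + 20 * (`|h| * p%:R) + `|h| * (10 / s) + `|h| * (32 * C * s).
    by rewrite /r; ring.
  rewrite rE in hr1; clear rE.
  have h10 : `|h| * (10 / s) <= 1 by lra.
  split; [by rewrite mulrC; lra| |by lra|].
    by rewrite ler_pdivlMr//; move: h10; rewrite mulrA ler_pdivrMr//; lra.
  rewrite ler_pdivrMr// ler_pdivlMl ?mulr_gt0// /r; lra.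
have iGamma : (power_measure leb (N + N)).-integrable setT (EFin \o Gamma).
  apply/integrableP; split.
    by apply/measurable_EFinP; exact: measurable_prod_gauss.
  rewrite (eq_integral (fun u => (Gamma u)%:E)); last first.
    by move=> u _; rewrite gee0_abs// lee_fin.
  by rewrite integral_prod_gauss// ltry.
have -> : (fun b => density x b y) = (fun b => \int[power_measure leb (N + N)]_u J b u).
  by apply/funext => b; apply: eq_Rintegral => u _; rewrite complete_densityE.
apply: (@differentiable_Rintegral _ _ _ _ (power_measure leb (N + N)) J
  (fun h u => J theta u * score h u) (fun u => c * Gamma u) theta r^-1 rho0).
- move=> h hr; have [_ hs _ _] := small h hr; apply: integrable_joint.
  rewrite /Theta/= var_compD -/s; have /ler_normlP[v1 v2] := le_trans (var_le h) hs.
  by have := s0; lra.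
- move=> h; apply: measurable_funM; last exact: measurable_score.
  by apply: measurable_joint_env => //; exact: measurable_id.
- by move=> a h h' u; rewrite score_linear; ring.
- exact: (integrableZl measurableT c iGamma).
- move=> h u; rewrite normrM (ger0_norm (J0 u)).
  apply: (@le_trans _ _ (J theta u * (K * expR (sumsq u / (4 * s))) * `|h|)).
    rewrite -mulrA ler_wpM2l//; apply: (le_trans (score_le h u)); rewrite ler_wpM2r//.
    apply: le_trans (HK (sumsq u) 0 (sumsq_ge0 u) (lexx 0) _); last first.
      by rewrite mulr0 invr_ge0 mulr_ge0// ltW.
    rewrite mulr0 expR0 mulr1.
    have A1 : 1 <= C * (1 + sumsq u).
      by have := sumsq_ge0 u; move: (sumsq u) => t t0; nra.
    nra.
  by rewrite [leRHS]mulrC ler_wpM2r.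
- move=> h u hr; have [ph hs h1 Cr] := small h hr.
  have sh0 : 0 < s + var_comp h.
    by have /ler_normlP[v1 v2] := le_trans (var_le h) hs; have := s0; lra.
  rewrite joint_ratio//.
  have -> : J theta u * expR (log_ratio h u) - J theta u - J theta u * score h u =
    J theta u * (expR (log_ratio h u) - 1 - score h u) by ring.
  rewrite normrM (ger0_norm (J0 u)).
  have A1 : 1 <= C * (1 + sumsq u).
    by have := sumsq_ge0 u; move: (sumsq u) => t t0; nra.
  have rle1 : r^-1 <= 1 by rewrite invf_le1.
  have exp2 := expR_expansion A1 (normr_ge0 h) hr rle1 (score_le h u) (log_ratio_le u ph hs).
  apply: (le_trans (ler_wpM2l (J0 u) exp2)); rewrite mulrCA ler_wpM2l ?sqr_ge0//.
  apply: le_trans (dom u); rewrite ler_wpM2l//.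
  by apply: HK => //; exact: ltW.
Qed.

End density_differentiable.

(** * Measurable maximizers *)

Section countable_unions.
Context d (T : measurableType d) (I : countType).

Lemma measurable_bigcup_count (F : I -> set T) :
  (forall i, measurable (F i)) -> measurable (\bigcup_i F i).
Proof.
move=> mF.
rewrite (_ : \bigcup_i F i = \bigcup_n (if unpickle n is Some i then F i else set0)).
  by apply: bigcupT_measurable => n; case: unpickle.
apply/seteqP; split => [t [i _ Fi]|t [n _]].
  by exists (pickle i) => //; rewrite pickleK.
by case: unpickle => // i Fi; exists i.
Qed.

Lemma measurable_bigcap_count (F : I -> set T) :
  (forall i, measurable (F i)) -> measurable (\bigcap_i F i).
Proof.
move=> mF; rewrite -[X in measurable X]setCK setC_bigcap.
by apply/measurableC/measurable_bigcup_count => i; exact/measurableC.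
Qed.

Lemma measurable_fiber_comp (R : realType) (g : T -> I) (phi : I -> R) :
  (forall i, measurable [set t | g t = i]) -> measurable_fun setT (fun t => phi (g t)).
Proof.
move=> mg _ B mB; rewrite setTI.
rewrite (_ : _ @^-1` B = \bigcup_i (if `[< B (phi i) >] then [set t | g t = i] else set0)).
  by apply: measurable_bigcup_count => i; case: ifP.
apply/seteqP; split => [t /= Bt|t [i _]].
  by exists (g t) => //; rewrite asboolT.
by case: ifP => // /asboolP Bi /= ->.
Qed.

End countable_unions.

Lemma measurable_find d (T : measurableType d) (S : Type) (A : S -> set T) (e : seq S) i :
  (forall s, measurable (A s)) ->
  measurable [set t | find (fun s => `[< A s t >]) e = i].
Proof.
move=> mA; elim: e i => [|s e IH] i /=.
  by case: i => [|i]; [rewrite (_ : [set _ | _] = setT)|rewrite (_ : [set _ | _] = set0)] => //;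
    apply/seteqP; split.
case: i => [|i].
  rewrite (_ : [set _ | _] = A s)//; apply/seteqP; split => t /=; case: asboolP => //.
rewrite (_ : [set _ | _] = ~` A s `&` [set t | find (fun s => `[< A s t >]) e = i]).
  by apply: measurableI => //; exact: measurableC.
apply/seteqP; split => t /=; case: asboolP => At //=.
- by move=> [].
- by move=> [].
- by move=> [_ ->].
Qed.

Section cubes.
Context (R : realType) (d : nat).
Implicit Types (l v th : 'cV[R]_d) (w : R).

Definition cube l w : set 'cV[R]_d := [set v | forall k, l k ord0 <= v k ord0 <= l k ord0 + w].

Lemma mx_norm_le v w : 0 <= w -> (forall k, `|v k ord0| <= w) -> `|v| <= w.
Proof.
move=> w0 vw; rewrite [leLHS]/Num.norm/= mx_normrE; apply/bigmax_leP; split => // -[k j] _ /=.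
by rewrite (ord1 j).
Qed.

Lemma continuous_trmx_rV : continuous (@trmx R 1 d).
Proof.
move=> v; apply: (@cvgrPdist_le R 'cV[R]_d _ _ (nbhs_filter v) _ _).2 => e e0; near=> u.
apply: mx_norm_le; first exact: ltW.
move=> k; rewrite !mxE.
have : `|v - u| <= e by near: u; exact: (@cvgr_dist_le R 'rV[R]_d _ (nbhs v) _ id v cvg_id).
apply: le_trans; rewrite [leRHS]/Num.norm/= mx_normrE.
have -> : `|v ord0 k - u ord0 k| = `|(v - u) ord0 k| by rewrite !mxE.
exact: (le_bigmax_cond 0 (fun ij : 'I_1 * 'I_d => `|(v - u) ij.1 ij.2|) (j := (ord0, k))).
Unshelve. all: by end_near. Qed.

Lemma compact_cube l w : compact (cube l w).
Proof.
have -> : cube l w = @trmx R 1 d @`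
    [set v : 'rV[R]_d | forall k, `[l k ord0, l k ord0 + w]%classic (v ord0 k)].
  apply/seteqP; split => [v vl|_ [v vl <-] k].
    exists v^T; last by rewrite trmxK.
    by move=> k; rewrite /= mxE in_itv/=; exact: vl.
  by rewrite mxE; have := vl k; rewrite /= in_itv.
apply: continuous_compact; first exact/continuous_subspaceT/continuous_trmx_rV.
apply: (@rV_compact R d (fun k => `[l k ord0, l k ord0 + w]%classic)) => k.
exact: segment_compact.
Qed.

(** The rational parameters are clipped to the unit interval: the countable family then
    stays inside the cube and is dense in it up to the boundary. *)
Definition cube_point l w (q : 'cV[rat]_d) : 'cV[R]_d :=
  \col_k (l k ord0 + w * Num.max 0 (Num.min 1 (ratr (q k ord0)))).

Lemma cube_point_in l w q : 0 <= w -> cube l w (cube_point l w q).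
Proof.
move=> w0 k; rewrite mxE lerDl lerD2l; set m := Num.max _ _.
have m0 : 0 <= m by rewrite le_max lexx.
have m1 : m <= 1 by rewrite ge_max ler01 ge_min lexx.
by rewrite mulr_ge0// ler_piMr.
Qed.

Lemma cube_point_dense l w v e : 0 < w -> 0 < e -> cube l w v ->
  exists q, `|cube_point l w q - v| <= e.
Proof.
move=> w0 e0 vl.
have pick_q k : exists q : rat, `|ratr q - (v k ord0 - l k ord0) / w| <= e / w.
  have ew : 0 < e / w by rewrite divr_gt0.
  have lt_pm : (v k ord0 - l k ord0) / w - e / w < (v k ord0 - l k ord0) / w + e / w by lra.
  have [q] := rat_in_itvoo lt_pm.
  rewrite in_itv/= => /andP[q1 q2]; exists q; rewrite ler_norml.
  by apply/andP; split; lra.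
have [q Hq] := choice pick_q; exists (\col_k q k).
apply: mx_norm_le; first exact: ltW.
move=> k; rewrite !mxE; have /andP[v1 v2] := vl k.
have := Hq k; set a := (v k ord0 - l k ord0) / w.
have a0 : 0 <= a by rewrite divr_ge0 ?subr_ge0// ltW.
have a1 : a <= 1 by rewrite ler_pdivrMr// mul1r lerBlDl.
have -> : l k ord0 + w * Num.max 0 (Num.min 1 (ratr (q k))) - v k ord0 =
  w * (Num.max 0 (Num.min 1 (ratr (q k))) - a) by rewrite /a; field; rewrite gt_eqF.
move=> qa; rewrite normrM gtr0_norm// mulrC -ler_pdivlMr//; apply: le_trans qa.
move: (ratr (q k)) => z.
have [z1|z1] := leP 1 z; last have [z0|z0] := leP 0 z.
- rewrite max_r// !ger0_norm; lra.
- by [].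
- rewrite ler0_norm ?ler0_norm; lra.
Qed.

Definition subcube l w (s : {ffun 'I_d -> bool}) : 'cV[R]_d := \col_k (l k ord0 + w / 2 * (s k)%:R).

Lemma subcube_cover l w v : cube l w v -> exists s, cube (subcube l w s) (w / 2) v.
Proof.
move=> vl; exists [ffun k => l k ord0 + w / 2 <= v k ord0] => k.
have /andP[v1 v2] := vl k; rewrite !mxE ffunE.
by have [h|h] := leP (l k ord0 + w / 2) (v k ord0); rewrite ?mulr1 ?mulr0; apply/andP; split; lra.
Qed.

Lemma subcube_sub l w s : 0 <= w -> cube (subcube l w s) (w / 2) `<=` cube l w.
Proof.
move=> w0 v vl k; have := vl k; rewrite !mxE.
by case: (s k) => /= /andP[v1 v2]; apply/andP; split; lra.
Qed.

End cubes.

(** A nest of dyadic subcubes is followed, each being the first one that still contains a maximizer; that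
    a cube contains a maximizer is a countable condition on the values of the
    function at rational points, so that the path in the nest is measurable. *)
Section argmax.
Context d0 (T : measurableType d0) (R : realType) (d : nat).
Variables (f : T -> 'cV[R]_d -> R) (l0 : 'cV[R]_d) (w0 : R).
Hypothesis w00 : 0 < w0.
Let K := cube l0 w0.
Hypothesis mf : forall th, K th -> measurable_fun setT (f ^~ th).
Hypothesis cf : forall t th, K th -> {for th, continuous (f t)}.
Local Notation child := {ffun 'I_d -> bool}.
Implicit Types (t : T) (s : seq child).

Definition has_argmax t l w :=
  exists2 th, cube l w th & forall th', K th' -> f t th' <= f t th.

Lemma cube_point_approx t l w th e : 0 < w -> cube l w `<=` K -> cube l w th -> 0 < e ->
  exists q, `|f t th - f t (cube_point l w q)| < e.
Proof.
move=> w1 lK lth e0.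
have : \forall u \near nbhs th, `|f t th - f t u| < e.
  exact: (@cvgr_dist_lt R R _ (nbhs th) _ (f t) (f t th) (cf (lK _ lth))).
move=> /nbhs_ballP[del /= del0 H].
have [q hq] := cube_point_dense w1 (divr_gt0 del0 (ltr0n R 2)) lth.
exists q; apply: H; rewrite -ball_normE/= distrC; apply: le_lt_trans hq _.
by rewrite ltr_pdivrMr// ltr_pMr// ltr1n.
Qed.

Lemma cube_has_max t l w : 0 < w -> cube l w `<=` K ->
  exists2 th, cube l w th & forall th', cube l w th' -> f t th' <= f t th.
Proof.
move=> w1 lK; have ne : cube l w !=set0.
  by exists (cube_point l w 0); exact/cube_point_in/ltW.
have cw : {within cube l w, continuous (f t)}.
  by apply: continuous_in_subspaceT => th; rewrite inE => /lK; exact: cf.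
have [c cl cmax] := compact_EVT_max ne (@compact_cube R d l w) cw.
exists c; first by move: cl; rewrite inE.
by move=> th' lth'; apply: cmax; rewrite inE.
Qed.

(** By density of the rational points and continuity, the cube contains a maximizer
    if and only if each value at a rational point of the large cube is exceeded, up to any
    [1 / n], at some rational point of the small one. *)
Lemma measurable_has_argmax l w : 0 < w -> cube l w `<=` K ->
  measurable [set t | has_argmax t l w].
Proof.
move=> w1 lK.
rewrite (_ : [set t | _] = \bigcap_q \bigcap_n \bigcup_q'
   [set t | f t (cube_point l0 w0 q) < f t (cube_point l w q') + n.+1%:R^-1]).
  apply: measurable_bigcap_count => q; apply: bigcapT_measurable => n.
  apply: measurable_bigcup_count => q'; rewrite -[X in measurable X]setTI.
  have m1 : measurable_fun setT (f ^~ (cube_point l0 w0 q)).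
    by apply: mf; exact/cube_point_in/ltW.
  have m2 : measurable_fun setT (fun t => f t (cube_point l w q') + n.+1%:R^-1).
    by apply: measurable_funD => //; apply: mf; apply: lK; exact/cube_point_in/ltW.
  exact: (measurable_fun_ltr m1 m2 measurableT (Y := [set true]) I).
apply/seteqP; split => [t [th lth thmax] q _ n _|t H].
  have n0 : 0 < n.+1%:R^-1 :> R by rewrite invr_gt0.
  have [q' hq'] := cube_point_approx t w1 lK lth n0; exists q' => //=.
  have := thmax _ (cube_point_in l0 q (ltW w00)).
  by move: n0 hq'; move: (n.+1%:R^-1) => e e0 /ltr_normlP[]; lra.
have [c lc cmax] := cube_has_max t w1 lK; exists c => // th' Kth'.
rewrite leNgt; apply/negP => lt; pose del := (f t th' - f t c) / 2.
have del0 : 0 < del by rewrite divr_gt0// subr_gt0.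
have [q /ltr_normlP[q1 q2]] := cube_point_approx t w00 (@subset_refl _ K) Kth' del0.
have [n hn] : exists n, n.+1%:R^-1 < del.
  have := near_infty_natSinv_lt (PosNum del0).
  by case/filter_ex => n; exists n.
have [q' _ /= hq'] := H q I n I.
have := cmax _ (cube_point_in l q' (ltW w1)).
rewrite /del in q1 q2 hn; move: hn hq'; move: (n.+1%:R^-1) => e; lra.
Qed.

Lemma has_argmax_subcube t l w : has_argmax t l w ->
  exists a, has_argmax t (subcube l w a) (w / 2).
Proof. by move=> [th /subcube_cover[a la] thmax]; exists a, th. Qed.

Let width n := w0 * 2^-1 ^+ n.
Let width_gt0 n : 0 < width n.
Proof. by rewrite mulr_gt0// exprn_gt0// invr_gt0. Qed.
Let widthS n : width n.+1 = width n / 2.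
Proof. by rewrite /width exprSr mulrA. Qed.

Fixpoint corner s : 'cV[R]_d :=
  if s is a :: s' then subcube (corner s') (width (size s')) a else l0.

Let corner_sub s : cube (corner s) (width (size s)) `<=` K.
Proof.
elim: s => [|a s IH]; first by rewrite /width/= expr0 mulr1.
by apply: subset_trans IH; rewrite /= widthS; exact/subcube_sub/ltW.
Qed.

Let child_has s a : set T := [set t | has_argmax t (corner (a :: s)) (width (size s).+1)].

Definition next t s : child :=
  nth [ffun=> false] (enum child) (find (fun a => `[< child_has s a t >]) (enum child)).

Fixpoint nest t n : seq child :=
  if n is n'.+1 then next t (nest t n') :: nest t n' else [::].

Let size_nest t n : size (nest t n) = n.
Proof. by elim: n => //= n ->. Qed.

Let nest_has_argmax t n : has_argmax t (corner (nest t n)) (width n).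
Proof.
elim: n => [|n IH].
  by rewrite /= /width expr0 mulr1; exact: cube_has_max.
have := has_argmax_subcube IH; rewrite -widthS => -[a ha].
rewrite /= size_nest /next.
pose P a := `[< child_has (nest t n) a t >]; have hP : has P (enum child).
  by apply/hasP; exists a; rewrite ?mem_enum// /P /child_has/= size_nest; exact/asboolP.
by have := nth_find ([ffun=> false] : child) hP => /asboolP; rewrite /P /child_has/= size_nest.
Qed.

Let measurable_next s a : measurable [set t | next t s = a].
Proof.
rewrite (_ : [set t | _] = \bigcup_i (if nth [ffun=> false] (enum child) i == a
  then [set t | find (fun a => `[< child_has s a t >]) (enum child) = i] else set0)).
  apply: bigcupT_measurable => i; case: ifP => // _.
  apply: (measurable_find (A := child_has s)) => b.
  by apply: measurable_has_argmax => //; exact: (corner_sub (s := b :: s)).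
apply/seteqP; split => [t /= <-|t [i _]].
  by exists (find (fun a => `[< child_has s a t >]) (enum child)) => //; rewrite /next eqxx.
by case: eqP => //= <- <-.
Qed.

Let measurable_nest n s : measurable [set t | nest t n = s].
Proof.
elim: n s => [|n IH] [|a s] /=.
- by rewrite (_ : [set _ | _] = setT)//; apply/seteqP; split.
- by rewrite (_ : [set _ | _] = set0)//; apply/seteqP; split.
- by rewrite (_ : [set _ | _] = set0)//; apply/seteqP; split.
rewrite (_ : [set _ | _] = [set t | nest t n = s] `&` [set t | next t s = a]).
  by apply: measurableI => //; exact: measurable_next.
by apply/seteqP; split => t /= [<- <-].
Qed.

Let corner_le t k : nondecreasing_seq (fun n => corner (nest t n) k ord0).
Proof.
apply/nondecreasing_seqP => n; rewrite /= mxE size_nest lerDl mulr_ge0//.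
by rewrite divr_ge0// ltW.
Qed.

Let corner_in t n : K (corner (nest t n)).
Proof.
apply: (corner_sub (s := nest t n)) => k; rewrite lexx/= lerDl; exact: ltW.
Qed.

Let corner_cvg t k : cvgn (fun n => corner (nest t n) k ord0).
Proof.
apply: nondecreasing_is_cvgn; first exact: corner_le.
by exists (l0 k ord0 + w0) => _ [n _ <-]; have /andP[] := corner_in t n k.
Qed.

(** The corners of the nest increase to a point that is also the limit of maximizers,
    hence a maximizer by continuity. *)
Theorem measurable_argmax : exists g : T -> 'cV[R]_d,
  [/\ forall k, measurable_fun setT (fun t => g t k ord0),
     forall t, K (g t) & forall t th, K th -> f t th <= f t (g t)].
Proof.
pose g t : 'cV[R]_d := \col_k limn (fun n => corner (nest t n) k ord0).
have gcvg t k : (fun n => corner (nest t n) k ord0) @ \oo --> g t k ord0.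
  by rewrite mxE; exact: corner_cvg.
have gK t : K (g t).
  move=> k; rewrite !mxE; apply/andP; split.
    by apply: limr_ge; [exact: corner_cvg|]; near=> n; have /andP[] := corner_in t n k.
  by apply: limr_le; [exact: corner_cvg|]; near=> n; have /andP[] := corner_in t n k.
exists g; split => //.
  move=> k; apply: (measurable_fun_cvg (h := fun n t => corner (nest t n) k ord0)).
    move=> n; apply: (measurable_fiber_comp (g := nest ^~ n) (fun s => corner s k ord0)).
    by move=> s; exact: measurable_nest.
  by move=> t _; exact: gcvg.
move=> t th Kth; apply/ler_addgt0Pl => e e0.
have : \forall u \near nbhs (g t), `|f t (g t) - f t u| < e.
  exact: (@cvgr_dist_lt R R _ (nbhs (g t)) _ (f t) (f t (g t)) (cf (gK t))).
move=> /nbhs_ballP[del /= del0 H].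
have del4 : 0 < del / 4 by rewrite divr_gt0.
have [n [n1 n2]] : exists n, (forall k, `|g t k ord0 - corner (nest t n) k ord0| < del / 4) /\
    width n < del / 4.
  have near1 : \forall n \near \oo, forall k, `|g t k ord0 - corner (nest t n) k ord0| < del / 4.
    apply: filter_forall => k.
    exact: (@cvgr_dist_lt R R _ \oo _ _ _ (gcvg t k)).
  have near2 : \forall n \near \oo, width n < del / 4.
    have z1 : `|2^-1 : R| < 1 by rewrite gtr0_norm ?invr_gt0// invf_lt1// ltr1n.
    near=> n; have : `|0 - geometric w0 2^-1 n| < del / 4.
      by near: n; exact: (@cvgr_dist_lt R R _ \oo _ _ _ (cvg_geometric w0 z1)).
    by rewrite sub0r normrN; apply: le_lt_trans; exact: ler_norm.
  by have [n [h1 h2]] := filter_ex (filterI near1 near2); exists n.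
have [thn lthn thnmax] := nest_has_argmax t n.
have near_thn : `|f t (g t) - f t thn| < e.
  apply: H; rewrite -ball_normE/=; apply: (@le_lt_trans _ _ (del / 2)); last first.
    by rewrite ltr_pdivrMr// ltr_pMr// ltr1n.
  apply: mx_norm_le => [|k]; first by rewrite divr_ge0// ltW.
  have := n1 k; have := lthn k; rewrite !mxE => /andP[a1 a2] /ltr_normlP[b1 b2].
  by rewrite ler_norml; apply/andP; split; lra.
have := thnmax _ Kth; move: near_thn => /ltr_normlP[]; lra.
Unshelve. all: by end_near. Qed.

End argmax.

(** * The estimator *)

(** Half of the exponential rate absorbs the polynomial factor. *)
Lemma poly_exp_le_geometric (R : realType) (A kappa : R) (m : nat) :
  0 <= A -> 0 < kappa -> exists C z, [/\ 0 <= C, 0 <= z < 1 &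
    forall N, A * (2 * (N * N)).+1%:R ^+ m * expR (- (kappa * N%:R)) <= C * z ^+ N].
Proof.
move=> A0 k0; (* [(2 N ^ 2 + 1) <= (1 + 2 N) ^ 2 <= K ^ 2 exp (c N)], raised to the power [m] *)
pose c := kappa / (2 * m.+1%:R); pose K := 1 + 4 / c.
have m0 : 0 < m.+1%:R :> R by rewrite ltr0n.
have c0 : 0 < c by rewrite divr_gt0// mulr_gt0.
have K0 : 0 <= K by rewrite /K addr_ge0// divr_ge0// ltW.
exists (A * K ^+ (2 * m)), (expR (- (kappa / 2))); split.
- by rewrite mulr_ge0// exprn_ge0.
- by rewrite expR_ge0/= expR_lt1 oppr_lt0 divr_gt0.
move=> N.
have lin : 1 + 2 * N%:R <= K * expR (c * N%:R / 2).
  apply: (@le_trans _ _ (K * (1 + c * N%:R / 2))); last first.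
    by rewrite ler_wpM2l// expR_ge1Dx.
  have -> : K * (1 + c * N%:R / 2) = 1 + 2 * N%:R + 4 / c + c * N%:R / 2.
    by rewrite /K; field; rewrite gt_eqF.
  by rewrite -addrA lerDl addr_ge0// divr_ge0// ?mulr_ge0// ltW.
have quad : (2 * (N * N)).+1%:R <= K ^+ 2 * expR (c * N%:R).
  apply: (@le_trans _ _ ((1 + 2 * N%:R) ^+ 2)).
    rewrite -natr1 natrM natrM; have : 0 <= N%:R :> R by [].
    by move: (N%:R : R) => t t0; nra.
  have -> : K ^+ 2 * expR (c * N%:R) = (K * expR (c * N%:R / 2)) ^+ 2.
    by rewrite exprMn expr2 -[expR _ ^+ 2]expRM_natl; congr (_ * expR _); lra.
  by rewrite lerXn2r ?nnegrE// ?(le_trans _ lin)// addr_ge0// mulr_ge0.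
rewrite -!mulrA ler_wpM2l//.
apply: (@le_trans _ _ ((K ^+ 2 * expR (c * N%:R)) ^+ m * expR (- (kappa * N%:R)))).
  by rewrite ler_wpM2r ?expR_ge0// lerXn2r ?nnegrE// mulr_ge0 ?expR_ge0// exprn_ge0.
rewrite exprMn -exprM -mulrA ler_wpM2l ?exprn_ge0//.
rewrite -!expRM_natl -expRD ler_expR.
have -> : kappa = c * (2 * m.+1%:R) by rewrite /c divfK// gt_eqF// mulr_gt0.
rewrite -(natr1 m); have : 0 <= N%:R :> R by [].
move: (N%:R : R) (m%:R : R) => n t n0.
have : 0 <= c * n by rewrite mulr_ge0// ltW.
by nra.
Qed.

Lemma nneseries_geometric_lty (R : realType) (C z : R) : 0 <= C -> 0 <= z < 1 ->
  (\sum_(0 <= n <oo) (C * z ^+ n)%:E < +oo)%E.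
Proof.
move=> C0 /andP[z0 z1]; apply: (@le_lt_trans _ _ (C / (1 - z))%:E); last exact: ltry.
apply: lime_le.
  by apply: is_cvg_nneseries => n _ _; rewrite lee_fin mulr_ge0// exprn_ge0.
near=> n; rewrite sumEFin lee_fin.
have -> : \sum_(0 <= i < n) C * z ^+ i = C * (1 - z ^+ n) / (1 - z).
  have zn1 : z != 1 by rewrite lt_eqF.
  by have /(congr1 (@^~ n)) := geometric_seriesE C zn1.
rewrite ler_wpM2r ?invr_ge0 ?subr_ge0 ?(ltW z1)//.
by rewrite ler_piMr// gerBl exprn_ge0.
Unshelve. all: by end_near. Qed.

(** Borel-Cantelli. *)
Lemma ae_eventually_notin d (T : measurableType d) (R : realType) (P : probability T R)
    (F : nat -> set T) (C z : R) : (forall n, measurable (F n)) -> 0 <= C -> 0 <= z < 1 ->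
  (forall n, (P (F n) <= (C * z ^+ n)%:E)%E) ->
  {ae P, forall w, \forall n \near \oo, ~ F n w}.
Proof.
move=> mF C0 z01 PF; exists (lim_sup_set F); split.
- by apply: bigcapT_measurable => n; apply: bigcup_measurable.
- apply: lim_sup_set_cvg0 => //; apply: le_lt_trans (nneseries_geometric_lty C0 z01).
  by apply: lee_nneseries => // n _; exact: PF.
move=> w /= nF n _; apply: contrapT => nw; apply: nF; exists n => // k /= nk Fk.
by apply: nw; exists k.
Qed.

Lemma enorm_gt_coord (R : realType) d (v : 'cV[R]_d) eps : 0 < eps -> eps < enorm v ->
  exists k, eps / d.+1%:R <= `|v k ord0|.
Proof.
move=> eps0; apply: contraPP => /forallNP H; apply/negP; rewrite -leNgt.
have d0 : 0 < d.+1%:R :> R by rewrite ltr0n.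
have del0 : 0 <= eps / d.+1%:R by rewrite divr_ge0 ?ltW.
rewrite /enorm -[leRHS]gtr0_norm// -sqrtr_sqr ler_sqrt ?sqr_ge0//.
apply: (@le_trans _ _ (\sum_(k < d) (eps / d.+1%:R) ^+ 2)).
  apply: ler_sum => k _; rewrite -(real_normK (num_real (v k ord0))) lerXn2r ?nnegrE//.
  by have /negP := H k; rewrite -ltNge; exact: ltW.
apply: (@le_trans _ _ (\sum_(k < d.+1) (eps / d.+1%:R) ^+ 2)).
  by rewrite big_ord_recr/= lerDl sqr_ge0.
rewrite sumr_const card_ord -[leLHS]mulr_natl expr_div_n.
have -> : d.+1%:R * (eps ^+ 2 / d.+1%:R ^+ 2) = eps ^+ 2 / d.+1%:R.
  by field; rewrite gt_eqF.
by rewrite ler_pdivrMr// ler_peMr ?sqr_ge0// ler1n.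
Qed.

Lemma measurable_enorm d (T : measurableType d) (R : realType) n (g : T -> 'cV[R]_n) :
  (forall k, measurable_fun setT (fun t => g t k ord0)) ->
  measurable_fun setT (fun t => enorm (g t)).
Proof.
move=> mg; apply: (measurableT_comp (f := @Num.sqrt R)).
  by apply: continuous_measurable_fun => t; exact: sqrt_continuous.
by apply: measurable_sum => k; apply: measurable_funX.
Qed.

Section estimator.
Context (R : realType) (p : nat).
Variables (x : forall N : nat, 'I_N -> 'I_N -> 'cV[R]_p).
Arguments x : clear implicits.
Hypothesis hx : forall (N : nat) (i j : 'I_N), enorm (x N i j) <= 1.
Variable theta0 : param R p.
Hypothesis s0 : 0 < var_comp theta0.
Let r := var_comp theta0 / 2.
Let r0 : 0 < r. Proof. by rewrite divr_gt0. Qed.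
Local Notation box := (in_box theta0 r).

Let box_Theta theta : box theta -> Theta theta.
Proof.
move=> /(_ (rshift (p + p) ord0)); rewrite -!var_compE /Theta/= => /ler_normlP[h1 _].
by move: s0 h1; rewrite /r; lra.
Qed.

Let box0 : box theta0.
Proof. by move=> k; rewrite subrr normr0 ltW. Qed.

Lemma measurable_mle N : exists g : observation R N -> param R p,
  [/\ forall k, measurable_fun setT (fun y => g y k ord0),
     forall y, box (g y) &
     forall y theta, box theta -> density (x N) theta y <= density (x N) (g y) y].
Proof.
have cubeE theta : cube (theta0 - const_mx r) (2 * r) theta <-> box theta.
  split=> h k; have := h k; rewrite !mxE.
    by move=> /andP[h1 h2]; rewrite ler_norml; apply/andP; split; lra.
  by rewrite ler_norml => /andP[h1 h2]; apply/andP; split; lra.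
have [|theta /cubeE/box_Theta th|y theta /cubeE/box_Theta th|g [mg gbox gmax]] :=
  @measurable_argmax _ (observation R N) R _ (fun y theta => density (x N) theta y)
    (theta0 - const_mx r) (2 * r).
- by rewrite mulr_gt0.
- exact: measurable_density.
- exact/differentiable_continuous/(differentiable_density (hx (N := N)) y th).
exists g; split; [exact: mg|move=> y; exact/cubeE/gbox|move=> y theta th].
by apply: gmax; exact/cubeE.
Qed.

(** [Lambda] is an increasing function of the density, so that it has the same
    maximizers. *)
Lemma interior_max_likelihood_root N (y : observation R N) (theta : param R p) :
  (forall k, `|theta k ord0 - theta0 k ord0| < r) ->
  (forall theta', box theta' -> density (x N) theta' y <= density (x N) theta y) ->
  likelihood_root (x N) theta0 y theta.
Proof.
move=> thr thmax.
have thn : `|theta - theta0| < r.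
  rewrite [ltLHS]/Num.norm/= mx_normrE; apply/bigmax_ltP; split => // -[k j] _ /=.
  by rewrite (ord1 j) !mxE.
have nearbox theta' : `|theta' - theta| < r - `|theta - theta0| -> box theta'.
  move=> h k; have -> : theta' k ord0 - theta0 k ord0 = (theta' - theta0) k ord0.
    by rewrite !mxE.
  apply: (le_trans (coord_le_norm _ _)); rewrite -(subrKA theta).
  by apply: (le_trans (ler_normD _ _)); move: h; rewrite ltrBrDr; exact: ltW.
have pos theta' : box theta' -> 0 < density (x N) theta' y.
  by move=> th'; apply: density_gt0; exact: box_Theta.
have f0 := pos _ box0.
have dL theta' : box theta' -> differentiable (Lambda (x N) theta0 y) theta'.
  move=> bth'; have th' := box_Theta bth'.
  apply: (differentiable_ln_comp (f := fun b => density (x N) b y / density (x N) theta0 y)).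
    have -> : (fun b => density (x N) b y / density (x N) theta0 y) =
        (density (x N) theta0 y)^-1 *: (fun b => density (x N) b y : R^o).
      by apply/funext => b; rewrite mulrC.
    by apply: differentiableZ; exact: (differentiable_density (hx (N := N)) y th').
  by apply: divr_gt0; [exact: pos|exact: f0].
have th : box theta by move=> k; exact: ltW.
split; [exact: box_Theta|exact: dL|].
apply: (gradient_max0 (e := r - `|theta - theta0|)).
- by rewrite subr_gt0.
- by move=> b /nearbox; exact: dL.
- move=> b /nearbox bb; have fb := pos _ bb; have ft := pos _ th.
  have := thmax _ bb; rewrite /Lambda.
  move: (density _ b _) (density _ theta _) (density _ theta0 _) fb ft f0 => u v w u0 v0 w0 uv.
  by rewrite ler_ln ?posrE ?divr_gt0// ler_pM2r ?invr_gt0.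
Qed.

Section probability.
Context (d : measure_display) (Omega : measurableType d) (P : probability Omega R).
Variable Y : forall N : nat, {RV P >-> observation R N}.
Arguments Y : clear implicits.
Hypothesis hY : forall (N : nat) (A : set (observation R N)), measurable A ->
  distribution P (Y N) A =
  (\int[observation_measure R N]_(y in A) (density (x N) theta0 y)%:E)%E.
Hypothesis hlam : (0 < limn_einf (fun N : nat =>
  (lambda_min (N%:R^-1 *: \sum_(i < N) x N i i *m (x N i i)^T))%:E))%E.

(** [bad_event] made uniform in [N]: the polynomial size of the grid is absorbed in the
    geometric rate, and the event is empty for the finitely many [N] below [N0]. *)
Lemma geometric_bad_event eps : 0 < eps ->
  exists N0 C z (B : forall N, set (observation R N)),
  [/\ 0 <= C, 0 <= z < 1, forall N, measurable (B N),
     forall N, (P (Y N @^-1` B N) <= (C * z ^+ N)%:E)%E &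
     forall N y, (N0 <= N)%N -> ~ B N y -> forall theta, box theta ->
       density (x N) theta0 y <= density (x N) theta y ->
       forall k, `|theta k ord0 - theta0 k ord0| < eps].
Proof.
move=> eps0; have [c c0 hc] := limn_einf_gt0 hlam.
have [A [kappa [A0 k0 bad]]] := bad_event hx r0 (lexx _) eps0 c0.
have [C [z [C0 z01 Cz]]] := poly_exp_le_geometric (p + p + 1) A0 k0.
have [N0 _ HN0] := filterI hc bad.
have pick N : exists B : set (observation R N), [/\ measurable B,
     (P (Y N @^-1` B) <= (C * z ^+ N)%:E)%E &
     (N0 <= N)%N -> forall y, ~ B y -> forall theta, box theta ->
       density (x N) theta0 y <= density (x N) theta y ->
       forall k, `|theta k ord0 - theta0 k ord0| < eps].
  have [NN|NN] := leqP N0 N; last first.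
    exists set0; split => //.
    by rewrite preimage_set0 measure0 lee_fin mulr_ge0// exprn_ge0//; case/andP: z01.
  have [cN badN] := HN0 N NN; have [B [mB Bmax PB]] := badN cN (distribution P (Y N)) (@hY N).
  exists B; split => // [|_ y nB theta th le0 k].
    by apply: le_trans PB _; rewrite lee_fin; exact: Cz.
  rewrite ltNge; apply/negP => le_eps.
  by have := Bmax y nB theta th k le_eps; rewrite ltNge le0.
pose B N := sval (cid (pick N)); have HB N := svalP (cid (pick N)).
exists N0, C, z, B; split => // [N|N|N y NN]; have [] := HB N => //.
by move=> _ _; exact.
Qed.

End probability.

End estimator.

Unset Implicit Arguments.
Theorem theorem3p7 (R : realType) (p : nat)
    (x : forall N : nat, 'I_N -> 'I_N -> 'cV[R]_p)
    (hx : forall (N : nat) (i j : 'I_N), enorm (x N i j) <= 1)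
    (theta0 : param R p) (htheta0 : (Theta (R := R) (p := p))° theta0)
    (d : measure_display) (Omega : measurableType d) (P : probability Omega R)
    (Y : forall N : nat, {RV P >-> observation R N})
    (hY : forall (N : nat) (A : set (observation R N)), measurable A ->
      distribution P (Y N) A =
      (\int[observation_measure R N]_(y in A) (density (x N) theta0 y)%:E)%E)
    (hlam : (0 < limn_einf (fun N : nat =>
      (lambda_min (N%:R^-1 *: \sum_(i < N) x N i i *m (x N i i)^T))%:E))%E) :
  exists thetahat : forall N : nat, observation R N -> param R p,
    [/\ (forall (N : nat) (k : 'I_(p + p + 1)),
           measurable_fun setT (fun y => thetahat N y k ord0)),
        {ae P, forall w, \forall N \near \oo,
           likelihood_root (x N) theta0 (Y N w) (thetahat N (Y N w))}
      & forall eps : R, 0 < eps ->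
          P [set w | eps < enorm (thetahat N (Y N w) - theta0)] @[N --> \oo]
            --> 0%E].
Proof.
have s0 : 0 < var_comp theta0 := interior_subset htheta0.
pose r := var_comp theta0 / 2.
have r0 : 0 < r by rewrite divr_gt0.
have box0 : in_box theta0 r theta0 by move=> k; rewrite subrr normr0 ltW.
pose thetahat N := sval (cid (measurable_mle hx s0 N)).
have mle N : [/\ forall k, measurable_fun setT (fun y => thetahat N y k ord0),
     forall y, in_box theta0 r (thetahat N y) &
     forall y theta, in_box theta0 r theta ->
       density (x N) theta y <= density (x N) (thetahat N y) y].
  exact: (svalP (cid (measurable_mle hx s0 N))).
clearbody thetahat.
have mY N B : measurable B -> measurable (Y N @^-1` B).
  by move=> mB; rewrite -[X in measurable X]setTI; exact: measurable_funP.
exists thetahat; split.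
- by move=> N k; have [+ _ _] := mle N; exact.
- have [N0 [C [z [B [C0 z01 mB PB far]]]]] := geometric_bad_event hx s0 hY hlam r0.
  have := ae_eventually_notin (fun N => mY N _ (mB N)) C0 z01 PB.
  apply: filterS => w /= hw.
  near=> N; have [_ gbox gmax] := mle N.
  have NN : (N0 <= N)%N by near: N; exists N0.
  have nB : ~ B N (Y N w) by near: N; exact: hw.
  apply: (interior_max_likelihood_root hx s0 _ (gmax _)) => k.
  by apply: (far N _ NN nB _ (gbox _)); exact: gmax.
- (* some coordinate is off by [eps / (d + 1)] when the Euclidean distance exceeds [eps] *)
  move=> eps eps0; have del0 : 0 < eps / (p + p + 1).+1%:R by rewrite divr_gt0.
  have [N0 [C [z [B [C0 z01 mB PB far]]]]] := geometric_bad_event hx s0 hY hlam del0.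
  apply: (@squeeze_cvge _ _ _ _ (cst 0%E) _ (fun N => (C * z ^+ N)%:E)).
  + near=> N; rewrite measure_ge0/=; apply: le_trans (PB N).
    have [mth gbox gmax] := mle N.
    have NN : (N0 <= N)%N by near: N; exists N0.
    have menorm : measurable_fun setT (fun y => enorm (thetahat N y - theta0)).
      apply: measurable_enorm => k.
      rewrite (_ : (fun y => _) = (fun y => thetahat N y k ord0 - theta0 k ord0)).
        by apply: measurable_funB => //; exact: mth.
      by apply/funext => y; rewrite !mxE.
    apply: le_measure; rewrite ?inE; last 1 first.
    * move=> w /= /(enorm_gt_coord eps0)[k]; rewrite !mxE => hk.
      apply: contrapT => nB; have := far N _ NN nB _ (gbox _) (gmax _ _ box0) k.
      by rewrite ltNge hk.
    * apply: (mY N [set y | eps < enorm (thetahat N y - theta0)]).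
      have := measurable_fun_ltr (measurable_cst eps) menorm measurableT (Y := [set true]) I.
      by rewrite setTI.
    * by apply: mY; exact: mB.
  + exact: cvg_cst.
  + apply: cvg_EFin; first by near=> N.
    have z1 : `|z| < 1 by case/andP: z01 => z0 z1; rewrite ger0_norm.
    exact: cvg_geometric.
Unshelve. all: by end_near. Qed.
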